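(* Let $W$ be a finite-dimensional simple $\mathfrak{gl}_N$-module, $\gamma\in\mathbb C^N$, $h\in\mathbb C$. There exists a non-degenerate contragredient bilinear pairing of simple $\mathcal D\ltimes\mathcal K$-modules $$L(W,\gamma,h)\times L(W^*,\gamma,h)\to\mathbb C,$$ i.e. a non-degenerate pairing satisfying $\langle xu,v\rangle=\langle u,\sigma(x)v\rangle$ for all $x\in\mathcal D\ltimes\mathcal K$, $u\in L(W,\gamma,h)$, $v\in L(W^*,\gamma,h)$.
   Context: Let $N\ge1$. $\mathcal D=\mathrm{Der}\,\mathbb C[t_0^{\pm1},\dots,t_N^{\pm1}]=\bigoplus_{a=0}^N\mathbb C[t_0^{\pm1},\dots,t_N^{\pm1}]d_a$, $d_a=t_a\partial/\partial t_a$. $\mathcal K=\Omega^1(\mathbb T^{N+1})/d\Omega^0(\mathbb T^{N+1})$ is the quotient of $\bigoplus_{a=0}^N\mathbb C[t_0^{\pm1},\dots,t_N^{\pm1}]k_a$, $k_a=t_a^{-1}dt_a$, by differentials of Laurent polynomials. In $\mathcal D\ltimes\mathcal K$ the ideal $\mathcal K$ is abelian and $\mathcal D$ acts by the Lie derivative: $[f_1d_a,f_2k_b]=f_1d_a(f_2)k_b+\delta_{ab}f_2\,d(f_1)$. For $r\in\mathbb Z^N$, $t^r=t_1^{r_1}\cdots t_N^{r_N}$. The anti-involution $\sigma$ of $\mathcal D\ltimes\mathcal K$ is $\sigma(t_0^jt^rd_a)=t_0^{-j}t^{-r}d_a$, $\sigma(t_0^jt^rk_a)=t_0^{-j}t^{-r}k_a$,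 $a=0,\dots,N$. If the identity matrix $I$ acts on $W$ by the scalar $\alpha$, then $W^*$ denotes the dual space of $W$ with the dual $\mathfrak{sl}_N$-module structure but with $I$ acting by $N-\alpha$; thus $\langle E^{ab}w|w^*\rangle=\langle w|-E^{ab}w^*+\delta_{ab}w^*\rangle$ for matrix units $E^{ab}$. Normal ordering (even fields): for $a(z)=\sum_j a_{(j)}z^{-j-1}$ put $a(z)_-=\sum_{j\ge0}a_{(j)}z^{-j-1}$, $a(z)_+=\sum_{j\le-1}a_{(j)}z^{-j-1}$, and $:a(z)b(z):\;=a(z)_+b(z)+b(z)a(z)_-$. Fock space: $M_{\rm Hyp}(\gamma)=q^\gamma\mathbb C[q_1^{\pm1},\dots,q_N^{\pm1}]\otimes\mathbb C[u_{pj},v_{pj}\mid 1\le p\le N,\ j\ge1]$ with operators, for $j\ge1$, $u^p_{(-j)}=j u_{pj}$, $v^p_{(-j)}=jv_{pj}$ (multiplication), $u^p_{(j)}=\partial/\partial v_{pj}$, $v^p_{(j)}=\partial/\partial u_{pj}$, $u^p_{(0)}=0$, $v^p_{(0)}=q_p\partial/\partial q_p$; $u^p(z)=\sum_{j\in\mathbb Z} u^p_{(j)}z^{-j-1}$, $v^p(z)=\sum_{j\in\mathbb Z} v^p_{(j)}z^{-j-1}$; $\omega^{\rm Hyp}(z)=\sum_p:u^p(z)v^p(z):$; and $$Y(q^r,z)=q^r\exp\Big(\sum_{p=1}^N r_p\sum_{j\ge1}\tfrac{z^j}{j}u^p_{(-j)}\Big)\exp\Big(-\sum_{p=1}^N r_p\sum_{j\ge1}\tfrac{z^{-j}}{j}u^p_{(j)}\Big).$$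 Affine algebra: $\widehat{gl}_N=\mathbb C[t,t^{-1}]\otimes\mathfrak{gl}_N\oplus\mathbb C C$, $C$ central, $[t^n\otimes X,t^m\otimes Y]=t^{n+m}\otimes[X,Y]+n\delta_{n,-m}\mathrm{Tr}(XY)C$; $X_{(n)}=t^n\otimes X$, $X(z)=\sum_n X_{(n)}z^{-n-1}$. $L_{\mathfrak{gl}_N}(W)$ is the irreducible quotient of the $\widehat{gl}_N$-module induced from $W$, where $t\mathbb C[t]\otimes\mathfrak{gl}_N$ acts on $W$ by $0$ and $C$ acts by $1$. Put $$\omega^{\mathfrak{gl}_N}(z)=\tfrac1{2(N+1)}\Big(\sum_{i,j=1}^N:E^{ij}(z)E^{ji}(z):+:I(z)I(z):\Big)+\tfrac12\tfrac{d}{dz}I(z).$$ Virasoro: $L_{\rm Vir}(h)$ is the irreducible highest weight module of central charge $0$ over the Virasoro algebra $[L_n,L_m]=(n-m)L_{n+m}+\delta_{n,-m}\frac{n^3-n}{12}C_{\rm Vir}$, with highest weight vector $\mathrm v_h$, $L_0\mathrm v_h=h\mathrm v_h$; $\omega^{\rm Vir}(z)=\sum_j L_jz^{-j-2}$. Let $\omega(z)=\omega^{\rm Hyp}(z)+\omega^{\mathfrak{gl}_N}(z)+\omega^{\rm Vir}(z)$ and $L(W,\gamma,h)=M_{\rm Hyp}(\gamma)\otimes L_{\mathfrak{gl}_N}(W)\otimes L_{\rm Vir}(h)$. It is an irreducible $\mathcal D\ltimes\mathcal K$-module (a known theorem) by (for $a=1,\dots,N$, $r\in\mathbb Z^N$)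 $$\sum_j t_0^jt^rk_0z^{-j}\mapsto Y(q^r,z),\qquad \sum_j t_0^jt^rk_az^{-j-1}\mapsto u^a(z)Y(q^r,z),$$ $$\sum_{j}t_0^jt^rd_a\,z^{-j-1}\mapsto\; :v^a(z)Y(q^r,z):+\sum_{p=1}^N r_pE^{pa}(z)Y(q^r,z),$$ $$\sum_j t_0^jt^rd_0\,z^{-j-2}\mapsto -:\omega(z)Y(q^r,z):-\sum_{i,j=1}^N r_iu^j(z)E^{ij}(z)Y(q^r,z)+\sum_{p=1}^N r_p\Big(\tfrac{d}{dz}u^p(z)\Big)Y(q^r,z).$$ *)

(* Defs.v *)
From HB Require Import structures.
From mathcomp Require Import all_boot all_order all_algebra.
From mathcomp Require Import generic_quotient ring_quotient finmap.
From mathcomp.multinomials Require Import monalg.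
From mathcomp Require Import boolp classical_sets functions cardinality.
From mathcomp Require Import fsbigop reals complex ring.

Set Implicit Arguments.
Unset Strict Implicit.
Unset Printing Implicit Defensive.

Import Order.TTheory GRing.Theory Num.Theory.

Local Open Scope classical_set_scope.
Local Open Scope ring_scope.
Local Open Scope quotient_scope.

(** * Subspaces, quotients, free modules and tensor products *)

Section Subspaces.
Variables (F : fieldType) (V : lmodType F).

Definition subspace (S : set V) : Prop :=
  S 0 /\ forall (c : F) x y, S x -> S y -> S (c *: x + y).

Definition lspan (A : set V) : {pred V} :=
  fun x => `[< forall S : set V, subspace S -> A `<=` S -> S x >].

Lemma lspan_submod_closed (A : set V) : submod_closed (lspan A).
Proof.
split=> [|c x y]; rewrite !unfold_in; first by apply/asboolP=> S [].
move=> /asboolP xA /asboolP yA; apply/asboolP => S sS AS.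
by apply: sS.2; [exact: xA | exact: yA].
Qed.

HB.instance Definition _ (A : set V) :=
  GRing.isSubmodClosed.Build F V (lspan A) (lspan_submod_closed A).

Lemma sub_lspan (A : set V) x : A x -> x \in lspan A.
Proof. by move=> Ax; rewrite unfold_in; apply/asboolP => S _; apply. Qed.

End Subspaces.

Section LinearQuotient.
Variables (F : fieldType) (V : lmodType F) (A : set V).

Local Notation I := (lspan A).

(** The quotient of [V] by the subspace spanned by [A]. *)
Definition lquot : Type := Quotient.quot I.

HB.instance Definition _ := EqQuotient.on lquot.
HB.instance Definition _ := GRing.Zmodule.on lquot.

Definition lpi (x : V) : lquot := \pi_(Quotient.quot I) x.
Definition lrepr (x : lquot) : V := repr (x : Quotient.quot I).

Lemma lreprK : cancel lrepr lpi.
Proof. by move=> x; exact: reprK. Qed.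

Lemma lpi_eq x y : (lpi x = lpi y) <-> (x - y \in I).
Proof.
by split=> [/eqP|xy]; [|apply/eqP]; rewrite /lpi -Quotient.idealrBE.
Qed.

Lemma lpiD x y : lpi (x + y) = lpi x + lpi y.
Proof. exact: (Quotient.pi_add I x y). Qed.

Lemma lpi_repr x : x - lrepr (lpi x) \in I.
Proof. by apply/lpi_eq; rewrite lreprK. Qed.

Definition lquot_scale (c : F) (x : lquot) : lquot := lpi (c *: lrepr x).

Lemma lpiZ_subproof c x : lpi (c *: x) = lquot_scale c (lpi x).
Proof. by apply/lpi_eq; rewrite -scalerBr rpredZ ?lpi_repr. Qed.

Lemma lquot_scaleA a b x :
  lquot_scale a (lquot_scale b x) = lquot_scale (a * b) x.
Proof. by rewrite -[x]lreprK -!lpiZ_subproof scalerA. Qed.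

Lemma lquot_scale1 : left_id 1 lquot_scale.
Proof. by move=> x; rewrite -[x]lreprK -lpiZ_subproof scale1r. Qed.

Lemma lquot_scaleDr : right_distributive lquot_scale +%R.
Proof.
move=> c x y; rewrite -[x]lreprK -[y]lreprK -lpiD -!lpiZ_subproof -lpiD.
by rewrite scalerDr.
Qed.

Lemma lquot_scaleDl x : {morph lquot_scale^~ x : a b / a + b}.
Proof.
by move=> a b; rewrite -[x]lreprK -!lpiZ_subproof -lpiD scalerDl.
Qed.

HB.instance Definition _ := GRing.Zmodule_isLmodule.Build F lquot
  lquot_scaleA lquot_scale1 lquot_scaleDr lquot_scaleDl.

Lemma lpi_is_linear : linear lpi.
Proof. by move=> c x y; rewrite lpiD lpiZ_subproof. Qed.

HB.instance Definition _ :=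
  GRing.isLinear.Build F V lquot _ lpi lpi_is_linear.

End LinearQuotient.

Section LinearExtension.
Variables (F : fieldType) (K : choiceType) (V : lmodType F).

(** Linear extension of [phi] from the basis [<< k >>] of [{malg F[K]}]. *)
Definition mlin (phi : K -> V) (f : {malg F[K]}) : V :=
  \sum_(k <- msupp f) f@_k *: phi k.

Lemma mlinEw phi (f : {malg F[K]}) (D : {fset K}) : (msupp f `<=` D)%fset ->
  mlin phi f = \sum_(k <- D) f@_k *: phi k.
Proof.
move=> fD; rewrite /mlin; apply: big_fset_incl => // k _ /mcoeff_outdom ->.
by rewrite scale0r.
Qed.

Lemma mlin_is_linear phi : linear (mlin phi).
Proof.
move=> c f g; pose D := (msupp f `|` msupp g `|` msupp (c *: f + g))%fset.
have fD : (msupp f `<=` D)%fset by rewrite /D -fsetUA fsubsetUl.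
have gD : (msupp g `<=` D)%fset by rewrite /D fsetUAC fsubsetUr.
have hD : (msupp (c *: f + g) `<=` D)%fset by rewrite fsubsetUr.
rewrite (mlinEw _ fD) (mlinEw _ gD) (mlinEw _ hD) scaler_sumr -big_split /=.
by apply: eq_bigr => k _; rewrite mcoeffD mcoeffZ scalerDl scalerA.
Qed.

HB.instance Definition _ phi :=
  GRing.isLinear.Build F {malg F[K]} V _ (mlin phi) (mlin_is_linear phi).

Lemma mlinU phi k : mlin phi << k >> = phi k.
Proof.
by rewrite (mlinEw _ msuppU_le) big_seq_fset1 mcoeffUU scale1r.
Qed.

End LinearExtension.

Section Tensor.
Variables (F : fieldType) (V U : lmodType F).

Definition tensor_rel : set {malg F[(V * U)%type]} :=
  [set x | (exists c v1 v2 u,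
             x = << (c *: v1 + v2, u) >> - (c *: << (v1, u) >> + << (v2, u) >>))
        \/ (exists c v u1 u2,
             x = << (v, c *: u1 + u2) >> - (c *: << (v, u1) >> + << (v, u2) >>))].

Definition tensor : lmodType F := lquot tensor_rel.

Definition tens (v : V) (u : U) : tensor := lpi _ << (v, u) >>.

Lemma tens_linear_l u : linear (tens^~ u).
Proof.
move=> c v1 v2; rewrite /tens -linearP; apply/lpi_eq/sub_lspan.
by left; exists c, v1, v2, u.
Qed.

Lemma tens_linear_r v : linear (tens v).
Proof.
move=> c u1 u2; rewrite /tens -linearP; apply/lpi_eq/sub_lspan.
by right; exists c, v, u1, u2.
Qed.

(** The linear map out of the tensor product induced by [f]; meaningful when
    [f] is bilinear ([tlift_tens]). *)
Definition tlift (T : lmodType F) (f : V -> U -> T) (x : tensor) : T :=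
  mlin (fun vu => f vu.1 vu.2) (lrepr x).

Section Lift.
Variables (T : lmodType F) (f : V -> U -> T).
Hypotheses (fl : forall u, linear (f^~ u)) (fr : forall v, linear (f v)).

Lemma tlift_pi x : tlift f (lpi _ x) = mlin (fun vu => f vu.1 vu.2) x.
Proof.
apply/eqP; rewrite eq_sym -subr_eq0 /tlift -linearB /=.
have := lpi_repr tensor_rel x; rewrite unfold_in => /asboolP.
move/(_ [set y | mlin (fun vu => f vu.1 vu.2) y == 0]); apply.
  split=> [|c y z /eqP y0 /eqP z0] /=; first by rewrite linear0.
  by rewrite mlin_is_linear y0 z0 scaler0 addr0.
move=> _ [[c [v1 [v2 [u ->]]]]|[c [v [u1 [u2 ->]]]]] /=.
  by rewrite linearB /= mlin_is_linear !mlinU /= fl subrr.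
by rewrite linearB /= mlin_is_linear !mlinU /= fr subrr.
Qed.

Lemma tlift_tens v u : tlift f (tens v u) = f v u.
Proof. by rewrite tlift_pi mlinU. Qed.

Lemma tlift_is_linear : linear (tlift f).
Proof.
move=> c x y; rewrite -[x]lreprK -[y]lreprK -linearP !tlift_pi.
by rewrite linearP.
Qed.

End Lift.
End Tensor.

Definition tmap (F : fieldType) (V U V' U' : lmodType F)
    (f : V -> V') (g : U -> U') : tensor V U -> tensor V' U' :=
  tlift (fun v u => tens (f v) (g u)).

(** * Formal series of operators *)

(** [a : fseries V] is the two-sided series [\sum_e (a e) z^e]. Infinite sums of
    operators are taken pointwise; in every use below they are finite on each
    vector. *)
Notation fseries V := (int -> V -> V).

Section Series.
Variables (F : fieldType) (V : lmodType F).

Definition of_modes (A : int -> V -> V) : fseries V := fun e => A (- e - 1).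

Definition fmul (a b : fseries V) : fseries V :=
  fun e x => \sum_(i \in [set: int]) a i (b (e - i) x).

Definition fone : fseries V := fun e x => if e == 0 then x else 0.

Definition fexp (a : fseries V) : fseries V := fun e x =>
  \sum_(k \in [set: nat]) (k`!%:R : F)^-1 *: iter k (fmul a) fone e x.

Definition fder (a : fseries V) : fseries V :=
  fun e => (e + 1)%:~R *: a (e + 1).

(** The mode [a_(j)] is the coefficient of [z^(-j-1)], so that the modes with
    [j <= -1] are those of non-negative exponent. *)
Definition creation (a : fseries V) : fseries V :=
  fun e => if 0 <= e then a e else 0.
Definition annihilation (a : fseries V) : fseries V :=
  fun e => if e < 0 then a e else 0.

Definition nop (a b : fseries V) : fseries V :=
  fmul (creation a) b + fmul b (annihilation a).

End Series.

(** * The Lie algebra [D \ltimes K] *)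

(** [<< m >>] is the monomial [t_0^(m 0) ... t_N^(m N)]. *)
Notation expo N := {ffun 'I_N.+1 -> int}.
Notation Laurent F N := {malg F[expo N]}.

(** A family [f] stands for [\sum_a (f a) d_a], respectively
    [\sum_a (f a) k_a]. *)
Notation vfield F N := {ffun 'I_N.+1 -> Laurent F N}.
Notation oneform F N := {ffun 'I_N.+1 -> Laurent F N}.

Section ToroidalAlgebra.
Variables (F : fieldType) (N : nat).

Local Notation laurent := (Laurent F N).
Local Notation vfield := (vfield F N).
Local Notation oneform := (oneform F N).

Definition laurent_mul (f g : laurent) : laurent :=
  mlin (fun m : expo N => mlin (fun n : expo N => << m + n >>) g) f.

Definition laurent_der (a : 'I_N.+1) : laurent -> laurent :=
  mlin (fun m : expo N => (m a)%:~R *: << m >>).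

Definition laurent_inv : laurent -> laurent := mlin (fun m : expo N => << - m >>).

Definition dform (f : laurent) : oneform := [ffun a => laurent_der a f].

Definition exact_forms : set oneform := range dform.

Lemma dform_is_linear : linear dform.
Proof. by move=> c f g; apply/ffunP => a; rewrite !ffunE /laurent_der mlin_is_linear. Qed.

Lemma lspan_exact_formsP w : w \in lspan exact_forms -> exists f, w = dform f.
Proof.
rewrite unfold_in => /asboolP/(_ [set w | exists f, w = dform f]); apply.
  split=> [|c _ _ [f ->] [g ->]]; last by exists (c *: f + g); rewrite dform_is_linear.
  by exists 0; apply/ffunP => a; rewrite !ffunE /laurent_der linear0.
by move=> _ [f _ <-]; exists f.
Qed.

Definition Kspace : lmodType F := lquot exact_forms.

Definition DK : lmodType F := (vfield * Kspace)%type.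

Definition vfield_bracket (f g : vfield) : vfield :=
  [ffun b => \sum_a (laurent_mul (f a) (laurent_der a (g b))
                   - laurent_mul (g a) (laurent_der a (f b)))].

Definition Lie_der (f : vfield) (w : oneform) : oneform :=
  [ffun b => \sum_a laurent_mul (f a) (laurent_der a (w b))]
  + \sum_a [ffun b => laurent_mul (w a) (dform (f a) b)].

(** [Lie_der f] preserves exact forms, so the class does not depend on the
    representatives. *)
Definition DKbracket (x y : DK) : DK :=
  (vfield_bracket x.1 y.1,
   lpi exact_forms (Lie_der x.1 (lrepr y.2) - Lie_der y.1 (lrepr x.2))).

Definition sigma_form (w : oneform) : oneform := [ffun a => laurent_inv (w a)].

(** Independent of the representative, see [sigma_pi]. *)
Definition sigma (x : DK) : DK :=
  ([ffun a => laurent_inv (x.1 a)], lpi exact_forms (sigma_form (lrepr x.2))).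

Lemma laurent_der_inv a f :
  laurent_der a (laurent_inv f) = - laurent_inv (laurent_der a f).
Proof.
have [g gE] : exists g : seq (F * expo N), f = \sum_(x <- g) x.1 *: << x.2 >>.
  exists [seq (f@_m, m) | m <- msupp f]; rewrite big_map {1}[f]monalgE.
  by apply: eq_bigr => m _; apply/malgP => n; rewrite mcoeffZ !mcoeffU mulr_natr.
rewrite gE /laurent_inv /laurent_der; elim: g {f gE} => [|[c m] g IH].
  by rewrite big_nil !raddf0.
rewrite !big_cons !mlin_is_linear IH opprD; congr (_ + _).
by rewrite !mlinU /= [mlin _ (_ *: _)]linearZ /= mlinU ffunE mulrNz scaleNr scalerN.
Qed.

Lemma sigma_pi (f : vfield) (w : oneform) :
  sigma (f, lpi exact_forms w)
  = ([ffun a => laurent_inv (f a)], lpi exact_forms (sigma_form w)).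
Proof.
congr pair; apply/lpi_eq.
have [g gE] := lspan_exact_formsP (lpi_repr exact_forms w).
apply: sub_lspan; exists (laurent_inv g) => //; apply/ffunP => a.
have := congr1 (fun h : oneform => laurent_inv (h a)) gE.
rewrite !ffunE laurent_der_inv => <-.
by rewrite /laurent_inv linearB /= opprB.
Qed.

End ToroidalAlgebra.

(** * The Fock space *)

(** [inl (p, k)] is the variable [u_{p,k+1}], [inr (p, k)] is [v_{p,k+1}]. *)
Notation hvar N := (('I_N * nat) + ('I_N * nat))%type.
Notation qexpo N := {ffun 'I_N -> int}.

Section Fock.
Variables (F : fieldType) (N : nat).

Local Notation hvar := (hvar N).
Local Notation qexpo := (qexpo N).

Local Notation basis := (qexpo * {cmonom hvar})%type.

(** [<< (s, m) >>] is [q^(gamma + s)] times the monomial [m]; the space does not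
    depend on [gamma], only the action of [q_p d/dq_p] does. *)
Definition Fock : lmodType F := {malg F[basis]}.

Definition var_mul (x : hvar) : Fock -> Fock :=
  mlin (fun k : basis => << (k.1, mulcm (ucm x) k.2) >>).

Definition var_der (x : hvar) : Fock -> Fock :=
  mlin (fun k : basis => (k.2 x)%:R *: << (k.1, divcm k.2 (ucm x)) >>).

Definition q_mul (r : qexpo) : Fock -> Fock :=
  mlin (fun k : basis => << (r + k.1, k.2) >>).

Definition q_der (gamma : 'I_N -> F) (p : 'I_N) : Fock -> Fock :=
  mlin (fun k : basis => (gamma p + (k.1 p)%:~R) *: << k >>).

Definition u_mode (p : 'I_N) (j : int) : Fock -> Fock :=
  match j with
  | Negz k => k.+1%:R *: var_mul (inl (p, k))
  | Posz 0 => 0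
  | Posz k.+1 => var_der (inr (p, k))
  end.

Definition v_mode (gamma : 'I_N -> F) (p : 'I_N) (j : int) : Fock -> Fock :=
  match j with
  | Negz k => k.+1%:R *: var_mul (inr (p, k))
  | Posz 0 => q_der gamma p
  | Posz k.+1 => var_der (inl (p, k))
  end.

Definition u_field (p : 'I_N) : fseries Fock := of_modes (u_mode p).
Definition v_field gamma (p : 'I_N) : fseries Fock :=
  of_modes (v_mode gamma p).

Definition omega_hyp gamma : fseries Fock :=
  \sum_(p < N) nop (u_field p) (v_field gamma p).

Definition Y_plus (r : qexpo) : fseries Fock := fun e =>
  if 0 < e then \sum_(p < N) ((r p)%:~R / e%:~R) *: u_mode p (- e) else 0.

Definition Y_minus (r : qexpo) : fseries Fock := fun e =>
  if e < 0 then - \sum_(p < N) ((r p)%:~R / (- e)%:~R) *: u_mode p (- e) else 0.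

Definition Y_field (r : qexpo) : fseries Fock :=
  fun e => q_mul r \o fmul (fexp (Y_plus r)) (fexp (Y_minus r)) e.

End Fock.

(** * Modules over [gl_N] and its affinization *)

Record gl_module (F : fieldType) (N : nat) := GlModule {
  gl_space :> vectType F;
  gl_act : 'M[F]_N -> gl_space -> gl_space;
  gl_act_linear_l : forall w, linear (gl_act^~ w);
  gl_act_linear : forall X, linear (gl_act X);
  gl_act_comm : forall X Y w,
    gl_act X (gl_act Y w) - gl_act Y (gl_act X w) = gl_act (X *m Y - Y *m X) w }.

Definition gl_simple (F : fieldType) (N : nat) (W : gl_module F N) : Prop :=
  (exists w : W, w != 0) /\
  forall S : {vspace W},
    (forall X w, w \in S -> gl_act X w \in S) -> S = 0%VS \/ S = fullv.

Section GlDual.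
Variables (F : fieldType) (N : nat) (W : gl_module F N).

Definition gl_dual_space : vectType F := 'Hom(W, F^o).

(** [E^{ab}] acts by [- (E^{ab})^T + delta_ab], hence [X] acts by
    [- X^T + tr X]. *)
Definition gl_dual_fun (X : 'M[F]_N) (f : gl_dual_space) : W -> F^o :=
  fun w => \tr X * f w - f (gl_act X w).

Lemma gl_dual_fun_linear X f : linear (gl_dual_fun X f).
Proof.
move=> c w1 w2; rewrite /gl_dual_fun gl_act_linear !linearD !linearZ /=.
by rewrite /GRing.scale /=; ring.
Qed.

Definition gl_dual_act (X : 'M[F]_N) (f : gl_dual_space) : gl_dual_space :=
  linfun (gl_dual_fun X f).

Lemma gl_dual_actE X f w : gl_dual_act X f w = \tr X * f w - f (gl_act X w).
Proof.
pose G : {linear W -> F^o} := HB.pack (gl_dual_fun X f)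
  (GRing.isLinear.Build F W F^o _ (gl_dual_fun X f) (gl_dual_fun_linear X f)).
exact: (lfunE G w).
Qed.

Lemma gl_dual_act_linear_l f : linear (gl_dual_act^~ f).
Proof.
move=> c X Y; apply/lfunP => w; rewrite add_lfunE scale_lfunE !gl_dual_actE.
rewrite gl_act_linear_l !linearD !linearZ /=.
by rewrite /GRing.scale /=; ring.
Qed.

Lemma gl_dual_act_linear X : linear (gl_dual_act X).
Proof.
move=> c f g; apply/lfunP => w.
rewrite add_lfunE scale_lfunE !gl_dual_actE !add_lfunE !scale_lfunE.
by rewrite /GRing.scale /=; ring.
Qed.

Lemma gl_dual_act_comm X Y f :
  gl_dual_act X (gl_dual_act Y f) - gl_dual_act Y (gl_dual_act X f)
  = gl_dual_act (X *m Y - Y *m X) f.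
Proof.
apply/lfunP => w; rewrite add_lfunE opp_lfunE !gl_dual_actE.
rewrite -gl_act_comm !linearB /= (mxtrace_mulC Y) subrr mul0r.
by ring.
Qed.

Definition gl_dual : gl_module F N :=
  GlModule gl_dual_act_linear_l gl_dual_act_linear gl_dual_act_comm.

End GlDual.

(** [ghat_mode n X] is the action of [t^n (x) X], [ghat_center] that of [C]. *)
Record ghat_module (F : fieldType) (N : nat) := GhatModule {
  ghat_space :> lmodType F;
  ghat_mode : int -> 'M[F]_N -> ghat_space -> ghat_space;
  ghat_center : ghat_space -> ghat_space;
  ghat_mode_linear_l : forall n v, linear (fun X => ghat_mode n X v);
  ghat_mode_linear : forall n X, linear (ghat_mode n X);
  ghat_center_linear : linear ghat_center;
  ghat_mode_comm : forall n m X Y v,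
    ghat_mode n X (ghat_mode m Y v) - ghat_mode m Y (ghat_mode n X v)
    = ghat_mode (n + m) (X *m Y - Y *m X) v
      + (if n == - m then n%:~R * \tr (X *m Y) else 0) *: ghat_center v;
  ghat_center_comm : forall n X v,
    ghat_center (ghat_mode n X v) = ghat_mode n X (ghat_center v) }.

Section Affine.
Variables (F : fieldType) (N : nat).

Definition ghat_irreducible (V : ghat_module F N) : Prop :=
  (exists v : V, v != 0) /\
  forall S : set V, subspace S ->
    (forall n X v, S v -> S (ghat_mode n X v)) ->
    (forall v, S v -> S (ghat_center v)) ->
    S = [set 0] \/ S = [set: V].

Definition ghat_hom (V V' : ghat_module F N) (g : V -> V') : Prop :=
  [/\ linear g,
      forall n X v, g (ghat_mode n X v) = ghat_mode n X (g v)
    & forall v, g (ghat_center v) = ghat_center (g v)].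

(** Homomorphisms from [W] over the non-negative part of the affine algebra,
    where [t C[t] (x) gl_N] acts on [W] by 0 and [C] by 1. *)
Definition top_hom (W : gl_module F N) (V : ghat_module F N) (f : W -> V) : Prop :=
  [/\ linear f,
      forall X w, ghat_mode 0 X (f w) = f (gl_act X w),
      forall n X w, 0 < n -> ghat_mode n X (f w) = 0
    & forall w, ghat_center (f w) = f w].

(** The module induced from [W], by its universal property. *)
Definition is_induced (W : gl_module F N) (M : ghat_module F N) (j : W -> M) : Prop :=
  top_hom j /\
  forall (V : ghat_module F N) (f : W -> V), top_hom f ->
    exists! g : M -> V, ghat_hom g /\ g \o j = f.

(** [V] is (a model of) [L_{gl_N}(W)]. *)
Definition is_Lgl (W : gl_module F N) (V : ghat_module F N) : Prop :=
  ghat_irreducible V /\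
  exists (M : ghat_module F N) (j : W -> M) (g : M -> V),
    [/\ is_induced j, ghat_hom g & forall v, exists m, g m = v].

Variable V : ghat_module F N.

Definition E_field (i j : 'I_N) : fseries V :=
  of_modes (fun n => ghat_mode n (delta_mx i j)).

Definition I_field : fseries V := of_modes (fun n => ghat_mode n 1%:M).

Definition omega_gl : fseries V :=
  (2 * N.+1%:R)^-1 *: (\sum_(i < N) \sum_(j < N) nop (E_field i j) (E_field j i)
                       + nop I_field I_field)
  + 2^-1 *: fder I_field.

End Affine.

(** * Modules over the Virasoro algebra *)

Record vir_module (F : fieldType) := VirModule {
  vir_space :> lmodType F;
  vir_mode : int -> vir_space -> vir_space;
  vir_center : vir_space -> vir_space;
  vir_mode_linear : forall n, linear (vir_mode n);
  vir_center_linear : linear vir_center;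
  vir_mode_comm : forall n m v,
    vir_mode n (vir_mode m v) - vir_mode m (vir_mode n v)
    = (n - m)%:~R *: vir_mode (n + m) v
      + (if n == - m then (n ^+ 3 - n)%:~R / 12 else 0) *: vir_center v;
  vir_center_comm : forall n v,
    vir_center (vir_mode n v) = vir_mode n (vir_center v) }.

Section Virasoro.
Variables (F : fieldType).

Definition vir_irreducible (U : vir_module F) : Prop :=
  (exists v : U, v != 0) /\
  forall S : set U, subspace S ->
    (forall n v, S v -> S (vir_mode n v)) ->
    (forall v, S v -> S (vir_center v)) ->
    S = [set 0] \/ S = [set: U].

(** [U] is (a model of) [L_Vir(h)]. *)
Definition is_LVir (h : F) (U : vir_module F) : Prop :=
  [/\ vir_irreducible U,
      forall v : U, vir_center v = 0
    & exists v : U, [/\ v != 0, vir_mode 0 v = h *: v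
                      & forall n, 0 < n -> vir_mode n v = 0]].

Definition omega_vir (U : vir_module F) : fseries U :=
  fun e => vir_mode (- e - 2).

End Virasoro.

(** * The module [L(W, gamma, h)] *)

Section Lmodule.
Variables (F : fieldType) (N : nat) (gamma : 'I_N -> F).
Variables (V : ghat_module F N) (U : vir_module F).

Definition Lmod : lmodType F := tensor (Fock F N) (tensor V U).

Definition on_hyp (a : fseries (Fock F N)) : fseries Lmod :=
  fun e => tmap (a e) id.
Definition on_gl (a : fseries V) : fseries Lmod :=
  fun e => tmap id (tmap (a e) id).
Definition on_vir (a : fseries U) : fseries Lmod :=
  fun e => tmap id (tmap id (a e)).

Definition omega : fseries Lmod :=
  on_hyp (omega_hyp gamma) + on_gl (@omega_gl _ _ V) + on_vir (@omega_vir _ U).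

Let u p := on_hyp (u_field p).
Let v p := on_hyp (v_field gamma p).
Let E i j := on_gl (E_field i j).
Let Y r := on_hyp (Y_field r).

Definition k0_field (r : qexpo N) : fseries Lmod := Y r.

Definition k_field (a : 'I_N) (r : qexpo N) : fseries Lmod :=
  fmul (u a) (Y r).

Definition d_field (a : 'I_N) (r : qexpo N) : fseries Lmod :=
  nop (v a) (Y r) + \sum_(p < N) (r p)%:~R *: fmul (E p a) (Y r).

Definition d0_field (r : qexpo N) : fseries Lmod :=
  - nop omega (Y r)
  - \sum_(i < N) \sum_(j < N) (r i)%:~R *: fmul (u j) (fmul (E i j) (Y r))
  + \sum_(p < N) (r p)%:~R *: fmul (fder (u p)) (Y r).

Definition tail_expo (m : expo N) : qexpo N := [ffun p => m (lift ord0 p)].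

Definition k_op (a : 'I_N.+1) (m : expo N) : Lmod -> Lmod :=
  if unlift ord0 a is Some p then k_field p (tail_expo m) (- m ord0 - 1)
  else k0_field (tail_expo m) (- m ord0).

Definition d_op (a : 'I_N.+1) (m : expo N) : Lmod -> Lmod :=
  if unlift ord0 a is Some p then d_field p (tail_expo m) (- m ord0 - 1)
  else d0_field (tail_expo m) (- m ord0 - 2).

(** The operators of exact forms vanish, since [d/dz Y(q^r,z)] is
    [\sum_p r_p u^p(z) Y(q^r,z)]; hence the choice of [lrepr x.2] is immaterial. *)
Definition DKact (x : DK F N) (w : Lmod) : Lmod :=
  \sum_a mlin (fun m => d_op a m w) (x.1 a)
  + \sum_a mlin (fun m => k_op a m w) (lrepr x.2 a).

End Lmodule.

(** * Pairings *)

Section Pairings.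
Variables (F : fieldType) (M M' : lmodType F) (B : M -> M' -> F).

Definition bilinear_pairing : Prop :=
  (forall y (c : F) x1 x2, B (c *: x1 + x2) y = c * B x1 y + B x2 y) /\
  (forall x (c : F) y1 y2, B x (c *: y1 + y2) = c * B x y1 + B x y2).

Definition nondegenerate_pairing : Prop :=
  (forall x, (forall y, B x y = 0) -> x = 0) /\
  (forall y, (forall x, B x y = 0) -> y = 0).

End Pairings.

Definition contragredient_pairing (F : fieldType) (N : nat) (gamma : 'I_N -> F)
    (V V' : ghat_module F N) (U : vir_module F)
    (B : Lmod V U -> Lmod V' U -> F) : Prop :=
  forall (x : DK F N) (w : Lmod V U) (w' : Lmod V' U),
    B (DKact gamma x w) w' = B w (DKact gamma (sigma x) w').

(* Main.v *)
Require Import Defs.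
From HB Require Import structures.
From mathcomp Require Import all_boot all_order all_algebra ssrAC spectral.
From mathcomp Require Import finmap.
From mathcomp.multinomials Require Import monalg.
From mathcomp Require Import boolp classical_sets functions.
From mathcomp Require Import fsbigop reals complex ring zify.

(** The pairing of [L(W,gamma,h)] with its counterpart for the dual of [W] is a
    tensor product of three pairings: of the Fock space with itself, of the
    affine module of [W] with that of the dual of [W], and of the Virasoro module
    with itself. Nondegeneracy passes to tensor products ([tpair_nondegenerate]),
    and the contragredience is a computation of adjoints of fields.

    The affine and the Virasoro pairings are contragredient forms of irreducible
    highest weight modules. A grading operator (the zeroth Sugawara operator,
    respectively [L_0]) separates the top of the module from the rest, and so
    provides a projection onto the top that vanishes on the images of the
    lowering operators ([top_projection]). The matrix coefficients of words in
    the modes between tops can be computed on either side, by moving letters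
    across; hence every vector of the second module induces a functional on the
    first, and irreducibility makes it unique and the pairing nondegenerate
    ([contragredient_form]). On the Fock space the form is explicit: a monomial
    is paired with the monomial in which [u_(p,j)] and [v_(p,j)] are exchanged,
    up to a weight ([fock_contragredient]).

    Under these forms [u^p_(j)], [v^p_(j)] and [q^r] are adjoint to [u^p_(-j)],
    [v^p_(-j)] and [q^(-r)], while [E^(ij)_(n)] is adjoint to [- E^(ij)_(-n)] plus
    the scalar 1 when [i = j] and [n = 0]. For each of the three Virasoro fields
    [L_n] is adjoint to [L_(-n)]; in the affine case the derivative of [I(z)] in
    the field [omega] is what absorbs the scalar corrections ([fadj_omega_gl]).
    The vertex operator [Y(q^r,z)], being made of [q^r] and the [u^p_(j)], is adjoint
    to [Y(q^(-r),1/z)] ([fadj_hY]).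

    It remains to take adjoints of the generating fields of the toroidal algebra.
    Taking adjoints swaps the two halves of a normally ordered product, except
    for finitely many coefficients, whose commutators are left over ([fadj_nop]).
    For [d_a] this is the commutator of [v^a_(0)] with [Y(q^(-r),z)], and it cancels
    the scalar corrections of the fields [E^(pa)]. For [d_0] all corrections are
    multiples of [d/dz Y(q^(-r),z)], and they add up to zero: the coefficient is -3
    from the commutators of [L_(-1)], [L_0], [L_1] with the vertex operator, 1 from
    the fields [E^(ij)] and 2 from the derivatives of the [u^p] ([fadj_gen_d0]).
    Finally exact forms act by zero, because [d/dz Y(q^r,z)] is the sum of the
    [r_p u^p(z) Y(q^r,z)]; hence the adjoint of a class of one-forms can be computed
    on any representative ([toroidal_adj]). *)

Set Implicit Arguments.
Unset Strict Implicit.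
Unset Printing Implicit Defensive.

Import Order.TTheory GRing.Theory Num.Theory.

Local Open Scope classical_set_scope.
Local Open Scope ring_scope.

(** * Linear maps and finite sums over the integers *)

Section Linear.
Variables (F : fieldType) (V W : lmodType F) (f : V -> W).
Hypothesis fl : linear f.

Lemma lin_add x y : f (x + y) = f x + f y.
Proof. by have := fl 1 x y; rewrite !scale1r. Qed.

Lemma lin_zero : f 0 = 0.
Proof. by apply: (addrI (f 0)); rewrite -lin_add !addr0. Qed.

Lemma lin_scale c x : f (c *: x) = c *: f x.
Proof. by have := fl c x 0; rewrite !addr0 lin_zero addr0. Qed.

Lemma lin_opp x : f (- x) = - f x.
Proof. by rewrite -scaleN1r lin_scale scaleN1r. Qed.

Lemma lin_sub x y : f (x - y) = f x - f y.
Proof. by rewrite lin_add lin_opp. Qed.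

Lemma lin_sum I (r : seq I) (P : pred I) (g : I -> V) :
  f (\sum_(i <- r | P i) g i) = \sum_(i <- r | P i) f (g i).
Proof. exact: (big_morph f lin_add lin_zero). Qed.

End Linear.

Lemma lin_comp (F : fieldType) (V W X : lmodType F) (f : W -> X) (g : V -> W) :
  linear f -> linear g -> linear (f \o g).
Proof. by move=> fl gl c x y /=; rewrite gl fl. Qed.

Lemma lin_id (F : fieldType) (V : lmodType F) : linear (@id V).
Proof. by []. Qed.

Definition isum (V : zmodType) (g : int -> V) : V := \sum_(i \in [set: int]) g i.

Definition within (V : zmodType) (K : nat) (g : int -> V) : Prop :=
  forall i : int, (i < - K%:Z) || (K%:Z <= i) -> g i = 0.

Definition finsum (V : zmodType) (g : int -> V) : Prop := exists K, within K g.

Section IntegerSums.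
Variable V : zmodType.
Implicit Types (g f : int -> V).

Lemma within_le K K' g : (K <= K')%N -> within K g -> within K' g.
Proof. by move=> le h i hi; apply: h; lia. Qed.

Lemma isumE K g : within K g ->
  isum g = \sum_(0 <= n < K + K) g (n%:Z - K%:Z).
Proof.
move=> h; pose r := [seq n%:Z - K%:Z | n <- iota 0 (K + K)].
have ur : uniq r by rewrite map_inj_uniq ?iota_uniq // => m n; lia.
rewrite /isum; have -> : [set: int] = [set` predT] :> set int.
  by apply/seteqP; split.
rewrite -(@bigfs _ _ _ _ r) //; last first.
  move=> i _ ir; apply: h; apply: contraNT ir => ir; apply/mapP.
  by exists (absz (i + K%:Z)); [rewrite mem_iota; lia | lia].
by rewrite big_map /index_iota subn0.
Qed.

Lemma eq_isum f g : f =1 g -> isum f = isum g.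
Proof. by move=> fg; congr isum; apply/funext. Qed.

Lemma isum0 g : (forall i, g i = 0) -> isum g = 0.
Proof. by move=> h; rewrite (@isumE 0) ?big_geq // => i _. Qed.

Lemma finsum0 g : (forall i, g i = 0) -> finsum g.
Proof. by move=> h; exists 0%N. Qed.

Lemma isumD f g : finsum f -> finsum g -> isum (fun i => f i + g i) = isum f + isum g.
Proof.
move=> [K hK] [L hL]; have hf := within_le (leq_maxl K L) hK.
have hg := within_le (leq_maxr K L) hL.
rewrite (isumE hf) (isumE hg) -big_split /=; apply: isumE => i hi.
by rewrite hf // hg // addr0.
Qed.

Lemma finsumD f g : finsum f -> finsum g -> finsum (fun i => f i + g i).
Proof.
move=> [K hK] [L hL]; have hf := within_le (leq_maxl K L) hK.
have hg := within_le (leq_maxr K L) hL.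
by exists (maxn K L) => i hi; rewrite hf // hg // addr0.
Qed.

Lemma isum_delta k g : (forall i, i != k -> g i = 0) -> isum g = g k.
Proof.
move=> h; have hK : within `|k|.+1%N g.
  by move=> i hi; apply: h; apply/eqP => ik; lia.
have km : absz (k + `|k|.+1%:Z) \in index_iota 0 (`|k|.+1 + `|k|.+1).
  by rewrite mem_index_iota; lia.
rewrite (isumE hK) (bigD1_seq _ km (iota_uniq _ _)) /= big1 ?addr0; last first.
  by move=> i ne; apply: h; apply: contraNneq ne; lia.
by congr g; lia.
Qed.

Lemma isum_refl c g : isum (fun i => g (c - i)) = isum g.
Proof.
rewrite /isum [RHS](reindex_fsbigT (fun i => c - i)) //.
by exists (fun i => c - i) => i; lia.
Qed.

Lemma isum_shift c g : isum (fun i => g (i + c)) = isum g.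
Proof.
rewrite /isum [RHS](reindex_fsbigT (fun i => i + c)) //.
by exists (fun i => i - c) => i; lia.
Qed.

Lemma finsum_refl c g : finsum g -> finsum (fun i => g (c - i)).
Proof. by move=> [K h]; exists (K + `|c|).+1%N => i hi; apply: h; lia. Qed.

Lemma finsum_shift c g : finsum g -> finsum (fun i => g (i + c)).
Proof. by move=> [K h]; exists (K + `|c|).+1%N => i hi; apply: h; lia. Qed.

Lemma isum_split_sum (I : Type) (r : seq I) (P : pred I) (h : I -> int -> V) :
  (forall k, finsum (h k)) ->
  isum (fun i => \sum_(k <- r | P k) h k i) = \sum_(k <- r | P k) isum (h k).
Proof.
move=> hf; suff [] : isum (fun i => \sum_(k <- r | P k) h k i)
    = \sum_(k <- r | P k) isum (h k) /\ finsum (fun i => \sum_(k <- r | P k) h k i) by [].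
elim: r => [|k r [IH1 IH2]].
  rewrite big_nil; split; [apply: isum0 => i|apply: finsum0 => i]; exact: big_nil.
rewrite big_cons; case: ifP => Pk; last first.
  suff -> : (fun i => \sum_(k0 <- k :: r | P k0) h k0 i)
    = (fun i => \sum_(k0 <- r | P k0) h k0 i) by [].
  by apply/funext => i; rewrite big_cons Pk.
have -> : (fun i => \sum_(k0 <- k :: r | P k0) h k0 i)
    = (fun i => h k i + \sum_(k0 <- r | P k0) h k0 i).
  by apply/funext => i; rewrite big_cons Pk.
by rewrite isumD // IH1; split=> //; apply: finsumD.
Qed.

Lemma exchange_isum (h : int -> int -> V) K L :
    (forall i j, (i < - K%:Z) || (K%:Z <= i) -> h i j = 0) ->
    (forall i j, (j < - L%:Z) || (L%:Z <= j) -> h i j = 0) ->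
  isum (fun i => isum (h i)) = isum (fun j => isum (h ^~ j)).
Proof.
move=> hK hL; rewrite (@isumE K); last first.
  by move=> i hi; apply: isum0 => j; apply: hK.
rewrite [RHS](@isumE L); last by move=> j hj; apply: isum0 => i; apply: hL.
under eq_bigr => n _.
  rewrite (@isumE L) //; last by move=> j hj; apply: hL.
  over.
under [RHS]eq_bigr => n _.
  rewrite (@isumE K) //; last by move=> j hj; apply: hK.
  over.
exact: exchange_big.
Qed.

End IntegerSums.

Section LinearIntegerSums.
Variables (F : fieldType) (V W : lmodType F) (f : V -> W).
Hypothesis fl : linear f.

Lemma lin_isum g : finsum g -> f (isum g) = isum (fun i => f (g i)).
Proof.
move=> [K h]; rewrite (isumE h) (lin_sum fl) (@isumE _ K) // => i hi.
by rewrite h // (lin_zero fl).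
Qed.

Lemma lin_finsum g : finsum g -> finsum (fun i => f (g i)).
Proof. by move=> [K h]; exists K => i hi; rewrite h // (lin_zero fl). Qed.

End LinearIntegerSums.

Lemma scale_lin (F : fieldType) (V : lmodType F) (c : F) :
  linear (GRing.scale c : V -> V).
Proof. by move=> d u v; rewrite scalerDr !scalerA mulrC. Qed.

Lemma isum_linear (F : fieldType) (V : lmodType F) (c : F) (g g1 g2 : int -> V) :
  (forall i, g i = c *: g1 i + g2 i) -> finsum g1 -> finsum g2 ->
  isum g = c *: isum g1 + isum g2.
Proof.
move=> h f1 f2; rewrite (lin_isum (scale_lin c) f1) -isumD //.
  exact: eq_isum.
exact: (lin_finsum (scale_lin c)).
Qed.

Section Pairings.
Variables (F : fieldType) (M M' : lmodType F) (B : M -> M' -> F).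
Hypothesis Bb : bilinear_pairing B.

Lemma pair_linl y : linear (B^~ y : M -> F^o).
Proof. by move=> c u v; rewrite Bb.1. Qed.

Lemma pair_linr x : linear (B x : M' -> F^o).
Proof. by move=> c u v; rewrite Bb.2. Qed.

End Pairings.

Lemma lspan_ind (F : fieldType) (V : lmodType F) (A S : set V) :
  subspace S -> A `<=` S -> forall v, v \in lspan A -> S v.
Proof. by move=> sS AS v; rewrite unfold_in => /asboolP; apply. Qed.

Lemma malg_ind (F : fieldType) (K : choiceType) (S : set {malg F[K]}) :
  subspace S -> (forall k, S << k >>) -> forall x, S x.
Proof.
move=> sS Sk x; rewrite [x]monalgE; elim/big_rec: _ => [|k y _ Sy]; first exact: sS.1.
have -> : << x@_k *g k >> = x@_k *: << k >> :> {malg F[K]}.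
  by apply/malgP => n; rewrite mcoeffZ !mcoeffU mulr_natr.
exact: sS.2.
Qed.

Lemma mlin_ext (F : fieldType) (K : choiceType) (V : lmodType F)
    (f g : {malg F[K]} -> V) :
  linear f -> linear g -> (forall k, f << k >> = g << k >>) -> f =1 g.
Proof.
move=> fl gl fg; apply: malg_ind => //.
split=> [|c x y hx hy]; first by rewrite (lin_zero fl) (lin_zero gl).
by rewrite fl gl hx hy.
Qed.

Section Monomials.
Variable I : choiceType.
Implicit Types (m : {cmonom I}) (x : I).

Lemma ucm_mulK m x : divcm (mulcm (ucm x) m) (ucm x) = m.
Proof. by apply/eqP/cmP => z; rewrite divcmE mulcmE addKn. Qed.

Lemma ucm_divK m x : (0 < m x)%N -> mulcm (ucm x) (divcm m (ucm x)) = m.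
Proof.
move=> mx; apply/eqP/cmP => z; rewrite mulcmE divcmE !ucmE; case: eqP => [<-|_].
  by rewrite subnKC.
by rewrite add0n subn0.
Qed.

End Monomials.

(** * The projection onto the top of an irreducible graded module *)

(** Irreducibility as an induction principle: a property that cuts out a
    subspace and is preserved by the operators holds everywhere as soon as it
    holds for one nonzero vector. *)
Definition irr_ops (F : fieldType) (X : Type) (V : lmodType F)
    (A : int -> X -> V -> V) : Prop :=
  forall S : set V, subspace S -> (forall n x v, S v -> S (A n x v)) ->
    (exists2 v, S v & v <> 0) -> forall v, S v.

(** An irreducible module [V] over operators [A n x] of degree [- n], whose
    commutators are again such operators up to a scalar in degree 0; the top [W]
    is embedded by [f], and the operator [D] grades [V] with eigenvalue [c] on the
    top. The modes of the affine algebra and those of the Virasoro algebra are the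
    two instances. *)
Section TopProjection.
Variables (F : numFieldType) (X : Type) (V W : lmodType F).
Variables (A : int -> X -> V -> V) (br : int -> int -> X -> X -> X).
Variables (co : int -> int -> X -> X -> F).
Hypothesis Al : forall n x, linear (A n x).
Hypothesis AC : forall n m x y v,
  A n x (A m y v) - A m y (A n x v) = A (n + m) (br n m x y) v + co n m x y *: v.
Hypothesis co0 : forall n m x y, n + m != 0 -> co n m x y = 0.
Variables (f : W -> V) (rho : X -> W -> W).
Hypothesis fl : linear f.
Hypothesis fpos : forall n x w, 0 < n -> A n x (f w) = 0.
Hypothesis f0 : forall x w, A 0 x (f w) = f (rho x w).
Hypothesis finj : forall w, f w = 0 -> w = 0.
Hypothesis W0 : exists w : W, w <> 0.
Hypothesis irrA : irr_ops A.
Variables (D : V -> V) (c : F).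
Hypothesis Dl : linear D.
Hypothesis Dtop : forall w, D (f w) = c *: f w.
Hypothesis Dneg : forall n x v, n <= 0 ->
  D (A n x v) = A n x (D v) - n%:~R *: A n x v.

Lemma opsC n m x y v :
  A n x (A m y v) = A m y (A n x v) + A (n + m) (br n m x y) v + co n m x y *: v.
Proof. by rewrite -addrA -AC addrCA subrr addr0. Qed.

(** The depth is recorded along a derivation from the top by lowering operators,
    so that the effect of the other operators can be found by induction on the
    derivation. *)
Inductive depth : int -> V -> Prop :=
| depth_top w : depth 0 (f w)
| depth_lin d a u v : depth d u -> depth d v -> depth d (a *: u + v)
| depth_low d n x v : n < 0 -> depth d v -> depth (d - n) (A n x v).

Lemma depth_ge0 d v : depth d v -> 0 <= d.
Proof. by elim=> // {}d n x {}v n0 _ IH; lia. Qed.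

Lemma depth_zero d v : depth d v -> depth d 0.
Proof. by move=> h; have := depth_lin (-1) h h; rewrite scaleN1r addNr. Qed.

Lemma depth_add d u v : depth d u -> depth d v -> depth d (u + v).
Proof. by move=> hu hv; have := depth_lin 1 hu hv; rewrite scale1r. Qed.

Lemma depth_scale d a u : depth d u -> depth d (a *: u).
Proof. by move=> hu; have := depth_lin a hu (depth_zero hu); rewrite addr0. Qed.

(** A raising operator moved towards the top meets one lowering operator at a
    time; the commutators that arise have a smaller derivation to act on. *)
Lemma depth_raise d v : depth d v -> forall n x, 0 <= n ->
  (n <= d -> depth (d - n) (A n x v)) /\ (d < n -> A n x v = 0).
Proof.
elim=> [w|{}d a u {}v hu IHu hv IHv|{}d m y {}v m0 hv IH] n x n0.
- split=> h; last exact: fpos.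
  have -> : n = 0 by lia.
  by rewrite f0; apply: depth_top.
- have [u1 u2] := IHu n x n0; have [v1 v2] := IHv n x n0.
  rewrite Al; split=> h; first by apply: depth_lin; [apply: u1|apply: v1].
  by rewrite u2 // v2 // scaler0 addr0.
have d0 := depth_ge0 hv; rewrite opsC.
have t1 : (n <= d - m -> depth (d - m - n) (A m y (A n x v)))
       /\ (d - m < n -> A m y (A n x v) = 0).
  have [h1 h2] := IH n x n0.
  have [nd|nd] := leP n d.
    split=> h; last by lia.
    by have := @depth_low _ m y _ m0 (h1 nd); congr depth; lia.
  rewrite (h2 nd) (lin_zero (Al m y)); split=> // h.
  have := depth_zero (@depth_low _ (n + m - n) y _ _ (depth_scale 0 hv)).
  have -> : d - m - n = d - (n + m) by lia.
  have [nm|nm] := ltP (n + m) 0.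
    by move=> _; apply: depth_zero (@depth_low _ (n + m) y _ nm hv).
  by move=> _; apply: depth_zero ((IH (n + m) y nm).1 _); lia.
have t2 : (n <= d - m -> depth (d - m - n) (A (n + m) (br n m x y) v))
       /\ (d - m < n -> A (n + m) (br n m x y) v = 0).
  have -> : d - m - n = d - (n + m) by lia.
  have [nm|nm] := ltP (n + m) 0.
    by split=> h; [apply: depth_low|lia].
  have [h1 h2] := IH (n + m) (br n m x y) nm.
  by split=> h; [apply: h1; lia|apply: h2; lia].
have t3 : (n <= d - m -> depth (d - m - n) (co n m x y *: v))
       /\ (d - m < n -> co n m x y *: v = 0).
  have [nm|nm] := eqVneq (n + m) 0.
    split=> h; last by lia.
    by have := depth_scale (co n m x y) hv; congr depth; lia.
  rewrite co0 // scale0r; split=> // h; exact: depth_zero (t1.1 h).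
split=> h; last by rewrite t1.2 // t2.2 // t3.2 // !addr0.
by apply: depth_add; [apply: depth_add|]; [apply: t1.1|apply: t2.1|apply: t3.1].
Qed.

(** The span of the vectors that have a depth is a submodule. *)
Lemma depth_spans (S : set V) :
  subspace S -> (forall d v, depth d v -> S v) -> forall v, S v.
Proof.
move=> sS dS v; suff vd : v \in lspan [set v | exists d, depth d v].
  by apply: (lspan_ind sS _ vd) => u [d]; apply: dS.
set depth_span := lspan _.
have [w w0] := W0.
apply: (irrA (S := [set v | v \in depth_span])).
- split=> [|a x y hx hy] /=; first exact: rpred0.
  by apply: rpredD => //; apply: rpredZ.
- move=> n x; apply: (lspan_ind (S := [set u | A n x u \in depth_span])).
    split=> [|a y z hy hz] /=; first by rewrite (lin_zero (Al n x)) rpred0.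
    by rewrite Al; apply: rpredD => //; apply: rpredZ.
  move=> u [d hd] /=; have [n0|n0] := ltP n 0.
    by apply: sub_lspan; exists (d - n); apply: depth_low.
  have [h1 h2] := depth_raise hd x n0; have [nd|nd] := leP n d.
    by apply: sub_lspan; exists (d - n); apply: h1.
  by rewrite h2 // rpred0.
exists (f w); first by apply: sub_lspan; exists 0; apply: depth_top.
by move/finj.
Qed.

(** [kill k] is the product of the [D - c - d] for [1 <= d <= k]: it annihilates
    the depths [1..k] and is injective on the top. *)
Fixpoint kill (k : nat) (v : V) : V :=
  if k is k'.+1 then D (kill k' v) - (c + k%:R) *: kill k' v else v.

Lemma kill_lin k : linear (kill k).
Proof.
elim: k => [|k IH] // a u v /=; rewrite !IH Dl !scalerDr !scalerN !scalerA.
by rewrite [(c + _) * a]mulrC opprD addrACA.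
Qed.

Lemma kill_leq k k' v : (k <= k')%N -> kill k v = 0 -> kill k' v = 0.
Proof.
move=> /subnK <- h; elim: (k' - k)%N => //= m ->.
by rewrite (lin_zero Dl) scaler0 subrr.
Qed.

Lemma kill_eigen k v e : D v = e *: v ->
  kill k v = (\prod_(d < k) (e - c - d.+1%:R)) *: v.
Proof.
move=> h; elim: k => [|k IH]; first by rewrite big_ord0 scale1r.
rewrite /= IH (lin_scale Dl) h big_ord_recr /= !scalerA -scalerBl; congr (_ *: _).
by ring.
Qed.

Lemma depth_eigen d v : depth d v -> D v = (c + d%:~R) *: v.
Proof.
elim=> [w|{}d a u {}v hu IHu hv IHv|{}d m y {}v m0 hv IH].
- by rewrite Dtop addr0.
- by rewrite Dl IHu IHv scalerDr !scalerA mulrC.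
by rewrite Dneg ?(ltW m0) // IH (lin_scale (Al _ _)) -scalerBl intrB addrA.
Qed.

(** Vectors below the top are those annihilated by a product of shifts of [D]
    that is injective on the top; unlike a derivation, this condition is visibly
    preserved by the zero modes, which commute with [D]. *)
Definition below_top : set V := [set v | exists k, kill k v = 0].

Lemma below_top_subspace : subspace below_top.
Proof.
split=> [|a x y [k hk] [l hl]]; first by exists 0%N.
exists (maxn k l); rewrite kill_lin (kill_leq (leq_maxl k l) hk).
by rewrite (kill_leq (leq_maxr k l) hl) scaler0 addr0.
Qed.

Lemma depth_below_top d v : 0 < d -> depth d v -> below_top v.
Proof.
move=> d0 h; exists (absz d); rewrite (kill_eigen _ (depth_eigen h)).
case: d d0 {h} => [[|d]|d] // _; rewrite big_ord_recr /= [X in _ * X](_ : _ = 0).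
  by rewrite mulr0 scale0r.
by rewrite -[d.+1%:~R]/(d.+1%:R); ring.
Qed.

Lemma top_below_top w : below_top (f w) -> w = 0.
Proof.
move=> [k]; rewrite (kill_eigen _ (Dtop w)) => /eqP.
rewrite scaler_eq0 => /orP[|/eqP/finj //].
rewrite prodf_seq_eq0 => /hasP [d _ /=].
by rewrite subrr sub0r oppr_eq0 pnatr_eq0.
Qed.

Lemma depth0_top d v : depth d v -> d = 0 -> exists w, v = f w.
Proof.
elim=> [w|{}d a u {}v hu IHu hv IHv|{}d m y {}v m0 hv IH] d0.
- by exists w.
- have [w1 ->] := IHu d0; have [w2 ->] := IHv d0.
  by exists (a *: w1 + w2); rewrite fl.
by have := depth_ge0 hv; lia.
Qed.

Lemma top_decomposition v : exists w, below_top (v - f w).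
Proof.
have [b0 bl] := below_top_subspace.
apply: (depth_spans (S := [set v | exists w, below_top (v - f w)])) => [|d u hd].
  split=> [|a x y [w1 h1] [w2 h2]] /=.
    by exists 0; rewrite (lin_zero fl) subr0.
  exists (a *: w1 + w2); rewrite fl.
  have -> : a *: x + y - (a *: f w1 + f w2) = a *: (x - f w1) + (y - f w2).
    by rewrite scalerBr opprD addrACA.
  exact: bl.
have [d0|d0] := eqVneq d 0.
  by have [w ->] := depth0_top hd d0; exists w; rewrite subrr.
exists 0; rewrite (lin_zero fl) subr0; apply: (depth_below_top _ hd).
by have := depth_ge0 hd; lia.
Qed.

Lemma below_top_low n x v : n < 0 -> below_top (A n x v).
Proof.
move=> n0; have [b0 bl] := below_top_subspace.
apply: (depth_spans (S := [set v | below_top (A n x v)])) => [|d u hd].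
  split=> [|a y z hy hz] /=; first by rewrite (lin_zero (Al n x)).
  by rewrite Al; apply: bl.
by apply: (@depth_below_top (d - n)); [have := depth_ge0 hd; lia|apply: depth_low].
Qed.

Lemma kill_zero_mode k x v : kill k (A 0 x v) = A 0 x (kill k v).
Proof.
elim: k v => //= k IH v; rewrite IH Dneg // scale0r subr0.
by rewrite (lin_sub (Al 0 x)) (lin_scale (Al 0 x)).
Qed.

(** The projection along [below_top], a complement of the top because the depths
    span [V]. *)
Theorem top_projection : exists pi : V -> W,
  [/\ linear pi, forall w, pi (f w) = w,
      forall n x v, n < 0 -> pi (A n x v) = 0
    & forall x v, pi (A 0 x v) = rho x (pi v)].
Proof.
have [pi piP] := choice top_decomposition.
have [b0 bl] := below_top_subspace.
have piE v w : below_top (v - f w) -> pi v = w.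
  move=> h; apply/eqP; rewrite -subr_eq0; apply/eqP/top_below_top.
  have := bl (-1) _ _ (piP v) h; rewrite (lin_sub fl) scaleN1r.
  by rewrite opprB addrA subrK.
exists pi; split.
- move=> a u v; apply: piE; rewrite fl.
  have -> : a *: u + v - (a *: f (pi u) + f (pi v))
    = a *: (u - f (pi u)) + (v - f (pi v)) by rewrite scalerBr opprD addrACA.
  exact: bl.
- by move=> w; apply: piE; rewrite subrr.
- move=> n x v n0; apply: piE; rewrite (lin_zero fl) subr0; exact: below_top_low.
move=> x v; apply: piE; have [k hk] := piP v; exists k.
by rewrite -f0 -(lin_sub (Al 0 x)) kill_zero_mode hk (lin_zero (Al 0 x)).
Qed.

End TopProjection.

(** * Contragredient forms *)

(** The operator [A' n x] on [V'] is the prospective adjoint of [A n x]. Adjoints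
    reverse products, which is why the relations between the [A' n x] are those of
    the [A n x] with the factors exchanged, and why raising operators on one side
    correspond to lowering operators on the other. *)
Section ContragredientForm.
Variables (F : fieldType) (X : Type) (V V' W W' : lmodType F).
Variables (A : int -> X -> V -> V) (A' : int -> X -> V' -> V').
Variables (br : int -> int -> X -> X -> X) (co : int -> int -> X -> X -> F).
Hypothesis Al : forall n x, linear (A n x).
Hypothesis A'l : forall n x, linear (A' n x).
Hypothesis AC : forall n m x y v,
  A n x (A m y v) - A m y (A n x v) = A (n + m) (br n m x y) v + co n m x y *: v.
Hypothesis A'C : forall n m x y v,
  A' m y (A' n x v) - A' n x (A' m y v) = A' (n + m) (br n m x y) v + co n m x y *: v.
Variables (f : W -> V) (f' : W' -> V') (rho : X -> W -> W) (rho' : X -> W' -> W').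
Hypothesis fpos : forall n x w, 0 < n -> A n x (f w) = 0.
Hypothesis f'neg : forall n x w, n < 0 -> A' n x (f' w) = 0.
Hypothesis f'0 : forall x w, A' 0 x (f' w) = f' (rho' x w).
Hypothesis irrA : irr_ops A.
Hypothesis irrA' : irr_ops A'.
Variables (pi : V -> W) (pi' : V' -> W').
Hypotheses (pil : linear pi) (pi'l : linear pi').
Hypotheses (pif : forall w, pi (f w) = w) (pi'f : forall w, pi' (f' w) = w).
Hypothesis pineg : forall n x v, n < 0 -> pi (A n x v) = 0.
Hypothesis pi'pos : forall n x v, 0 < n -> pi' (A' n x v) = 0.
Hypothesis pi0 : forall x v, pi (A 0 x v) = rho x (pi v).
Variable p : W -> W' -> F.
Hypothesis pb : bilinear_pairing p.
Hypothesis p_rho : forall x w w', p (rho x w) w' = p w (rho' x w').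
Hypothesis p_neq0 : exists w w', p w w' <> 0.

Local Notation word := (seq (int * X)).

Definition act (a : word) (v : V) : V := foldr (fun l => A l.1 l.2) v a.
Definition coact (a : word) (v : V') : V' := foldl (fun u l => A' l.1 l.2 u) v a.

Let actl a : linear (act a).
Proof.
elim: a => [|[n x] a IH] // c u v.
by rewrite -[LHS]/(A n x (act a _)) IH Al.
Qed.

Let coactl a : linear (coact a).
Proof.
elim: a => [|[n x] a IH] // c u v.
by rewrite -[LHS]/(coact a (A' n x _)) A'l IH.
Qed.

Let act_cat a b v : act (a ++ b) v = act a (act b v).
Proof. exact: foldr_cat. Qed.

Let act_cons n x a v : act ((n, x) :: a) v = A n x (act a v).
Proof. by []. Qed.

Let coact_cat a b v : coact (a ++ b) v = coact b (coact a v).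
Proof. exact: foldl_cat. Qed.

Let coact_cons n x a v : coact ((n, x) :: a) v = coact a (A' n x v).
Proof. by []. Qed.

Let pll w' := pair_linl pb w'.
Let plr w := pair_linr pb w.

Let lhs a w w' := p (pi (act a (f w))) w'.
Let rhs a w w' := p w (pi' (coact a (f' w'))).

(** Exchanging two letters changes both sides by the same combination of words. *)
Let word_C (a b : word) n x m y w w' :
    lhs (a ++ (n, x) :: (m, y) :: b) w w'
    = lhs (a ++ (m, y) :: (n, x) :: b) w w'
      + lhs (a ++ (n + m, br n m x y) :: b) w w' + co n m x y * lhs (a ++ b) w w'
 /\ rhs (a ++ (n, x) :: (m, y) :: b) w w'
    = rhs (a ++ (m, y) :: (n, x) :: b) w w'
      + rhs (a ++ (n + m, br n m x y) :: b) w w' + co n m x y * rhs (a ++ b) w w'.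
Proof.
rewrite /lhs /rhs !act_cat !coact_cat !act_cons !coact_cons.
split.
  rewrite -[A n x _](subrK (A m y (A n x (act b (f w))))) AC.
  rewrite !(lin_add (actl _), lin_scale (actl _), lin_add pil, lin_scale pil).
  rewrite !(lin_add (pll _), lin_scale (pll _)) /GRing.scale /=; ring.
rewrite -[A' m y _](subrK (A' n x (A' m y (coact a (f' w'))))) A'C.
rewrite !(lin_add (coactl _), lin_scale (coactl _), lin_add pi'l, lin_scale pi'l).
rewrite !(lin_add (plr _), lin_scale (plr _)) /GRing.scale /=; ring.
Qed.

(** By induction on the length of the word. A raising letter can be moved to the
    right, modulo shorter words, until it kills the top; if the first letter
    is a lowering one, both sides vanish; a first letter of degree 0 is carried over
    by the pairing [p] of the tops. *)
Lemma word_symmetry a w w' :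
  p (pi (act a (f w))) w' = p w (pi' (coact a (f' w'))).
Proof.
rewrite -/(lhs a w w') -/(rhs a w w').
have [k] := ubnP (size a); elim: k a w w' => // k IH a w w'.
have move_right b (c : word) n x : 0 < n -> (size b + size c < k)%N ->
    lhs (b ++ (n, x) :: c) w w' = rhs (b ++ (n, x) :: c) w w'.
  move=> n0; elim: c b => [|[m y] c IHc] b /= sz.
    rewrite /lhs /rhs act_cat coact_cat act_cons coact_cons fpos //.
    by rewrite (lin_zero (actl _)) (lin_zero pil) pi'pos // (lin_zero (pll _))
       (lin_zero (plr _)).
  have [-> ->] := word_C b c n x m y w w'.
  congr (_ + _ + _ * _).
  - by rewrite -cat_rcons; apply: IHc; rewrite size_rcons addSnnS.
  - by apply: IH; rewrite size_cat /=; move: sz; rewrite ?addnS; lia.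
  - by apply: IH; rewrite size_cat /=; move: sz; rewrite ?addnS; lia.
case: a => [|[n x] a] /= sz; first by rewrite /lhs /rhs /= pif pi'f.
have [n0|n0|n0] := ltgtP n 0.
- rewrite /lhs /rhs act_cons coact_cons pineg // f'neg // (lin_zero (coactl _)) (lin_zero pi'l).
  by rewrite (lin_zero (pll _)) (lin_zero (plr _)).
- by apply: (move_right [::] a).
rewrite n0 /lhs /rhs act_cons coact_cons pi0 f'0 p_rho.
by rewrite -/(lhs a w (rho' x w')) IH.
Qed.

(** The values prescribed here are those that a contragredient pairing with [v']
    extending [p] is bound to take on words applied to the top. *)
Definition transpose (phi : V -> F^o) (v' : V') : Prop :=
  linear phi /\ forall a w, phi (act a (f w)) = p w (pi' (coact a v')).

(** The vectors that induce a functional form a submodule, which contains the top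
    by [word_symmetry]. *)
Lemma transpose_ex v' : exists phi, transpose phi v'.
Proof.
have [w [w' pw]] := p_neq0.
have tf u' : transpose (fun v => p (pi v) u') (f' u').
  by split=> [c u v|a u]; [rewrite pil pll|exact: word_symmetry].
apply: (irrA' (S := [set v' | exists phi, transpose phi v'])).
- split=> [|c x y [phi [phil h]] [psi [psil h']]] /=.
    exists (fun=> 0); split=> [c u v|a u]; first by rewrite scaler0 addr0.
    by rewrite (lin_zero (coactl _)) (lin_zero pi'l) (lin_zero (plr _)).
  exists (fun v => c *: phi v + psi v); split=> [e u v|a u].
    rewrite phil psil !scalerDr !scalerA [c * e]mulrC addrACA //.
  by rewrite h h' coactl pi'l plr.
- move=> n x u' [phi [phil h]]; exists (fun v => phi (A n x v)); split.
    by move=> c u v; rewrite Al phil.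
  by move=> a u; rewrite (h ((n, x) :: a)).
exists (f' w'); first by exists (fun v => p (pi v) w').
move=> f'w'; apply: pw; rewrite -[w']pi'f f'w' (lin_zero pi'l).
exact: lin_zero (plr _).
Qed.

(** The span is a submodule, and it contains the top. *)
Lemma words_span v : v \in lspan [set act a (f w) | a in setT & w in setT].
Proof.
have [w [w' pw]] := p_neq0.
set S := lspan _; apply: (irrA (S := [set v | v \in S])).
- split=> [|c x y hx hy] /=; first exact: rpred0.
  by apply: rpredD => //; apply: rpredZ.
- move=> n x; apply: (lspan_ind (S := [set u | A n x u \in S])).
    split=> [|a y z hy hz] /=; first by rewrite (lin_zero (Al n x)) rpred0.
    by rewrite Al; apply: rpredD => //; apply: rpredZ.
  move=> _ [a _ [u' _ <-]] /=; apply: sub_lspan.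
  by exists ((n, x) :: a) => //; exists u'.
exists (f w); first by apply: sub_lspan; exists [::] => //; exists w.
move=> fw; apply: pw; rewrite -[w]pif fw (lin_zero pil); exact: (lin_zero (pll _)).
Qed.

Lemma transpose_unique phi psi v' : transpose phi v' -> transpose psi v' -> phi = psi.
Proof.
move=> [phil h] [psil h']; apply/funext => v.
apply: (lspan_ind (S := [set v | phi v = psi v]) _ _ (words_span v)).
  2: by move=> _ [a _ [w _ <-]] /=; rewrite h h'.
split=> [|c x y hx hy] /=; first by rewrite (lin_zero phil) (lin_zero psil).
by rewrite phil psil hx hy.
Qed.

(** Since the words span [V], the induced functional is unique, hence linear in
    the vector that induces it. The two kernels of the resulting pairing are
    submodules that do not contain the top. *)
Theorem contragredient_form : exists B : V -> V' -> F,
  [/\ bilinear_pairing B, nondegenerate_pairing B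
    & forall n x v v', B (A n x v) v' = B v (A' n x v')].
Proof.
have [phi phiP] := choice transpose_ex.
have Bb : bilinear_pairing (fun v v' => phi v' v).
  split=> [v' c x y|v c x y]; first by have [l _] := phiP v'; rewrite l.
  have [l h] := phiP x; have [l' h'] := phiP y.
  rewrite (@transpose_unique (phi (c *: x + y)) (fun v => c *: phi x v + phi y v)
             (c *: x + y)) //; split.
    by move=> e u u'; rewrite l l' !scalerDr !scalerA [c * e]mulrC addrACA.
  by move=> a u; rewrite h h' coactl pi'l plr.
have BA n x v v' : phi v' (A n x v) = phi (A' n x v') v.
  have [l h] := phiP v'.
  rewrite (@transpose_unique (phi (A' n x v')) (fun v => phi v' (A n x v))
             (A' n x v')) //; split; first by move=> c u u'; rewrite Al l.
  by move=> a u; rewrite (h ((n, x) :: a)).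
have Btop w w' : phi (f' w') (f w) = p w w'.
  by have [l h] := phiP (f' w'); rewrite (h [::]) /= pi'f.
have [w [w' pw]] := p_neq0.
exists (fun v v' => phi v' v); split=> //; split.
  move=> v hv; apply: contrapT => v0; apply: pw; rewrite -Btop.
  apply: (irrA (S := [set v | forall v', phi v' v = 0])); last by exists v.
  - split=> [v'|c y z hy hz v']; last by rewrite Bb.1 hy hz mulr0 addr0.
    exact: lin_zero (phiP v').1.
  - by move=> n x u hu v'; rewrite BA hu.
move=> v hv; apply: contrapT => v0; apply: pw; rewrite -Btop.
apply: (irrA' (S := [set v' | forall v, phi v' v = 0])); last by exists v.
- split=> [u|c y z hy hz u]; last by rewrite Bb.2 hy hz mulr0 addr0.
  by have := Bb.2 u (-1) 0 0; rewrite scaler0 addr0 mulN1r addNr.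
- by move=> n x u hu u'; rewrite -BA hu.
Qed.

End ContragredientForm.

(** * Calculus of formal fields *)

Section FieldValues.
Variables (F : fieldType) (V : lmodType F).
Implicit Types a b : fseries V.

Lemma fserD a b e x : (a + b) e x = a e x + b e x. Proof. by []. Qed.
Lemma fserN a e x : (- a) e x = - a e x. Proof. by []. Qed.
Lemma fserZ c a e x : (c *: a) e x = c *: a e x. Proof. by []. Qed.
Lemma fser_sum I (r : seq I) (P : pred I) (a : I -> fseries V) e x :
  (\sum_(i <- r | P i) a i) e x = \sum_(i <- r | P i) a i e x.
Proof. by rewrite !fct_sumE. Qed.
Lemma nopE a b e x : nop a b e x =
  isum (fun i => creation a i (b (e - i) x)) + isum (fun i => b i (annihilation a (e - i) x)).
Proof. by []. Qed.
Lemma fmulE a b e x : fmul a b e x = isum (fun i => a i (b (e - i) x)).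
Proof. by []. Qed.
Lemma fderE a e x : fder a e x = (e + 1)%:~R *: a (e + 1) x. Proof. by []. Qed.
Lemma creationE a e x : creation a e x = if 0 <= e then a e x else 0.
Proof. by rewrite /creation; case: ifP. Qed.
Lemma annihilationE a e x : annihilation a e x = if e < 0 then a e x else 0.
Proof. by rewrite /annihilation; case: ifP. Qed.
End FieldValues.

(** Only finitely many negative powers of [z] act non-trivially on a given
    vector; this makes the sums of a normally ordered product finite. *)
Definition lower (F : fieldType) (V : lmodType F) (a : fseries V) : Prop :=
  forall x, exists K : nat, forall e : int, e < - K%:Z -> a e x = 0.

Definition is_field (F : fieldType) (V : lmodType F) (a : fseries V) : Prop :=
  (forall e, linear (a e)) /\ lower a.

Definition fcomm (F : fieldType) (V : lmodType F) (a b : fseries V) : Prop :=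
  forall i j x, a i (b j x) = b j (a i x).

Lemma lower_common (F : fieldType) (V : lmodType F) (a b : fseries V) x y :
  lower a -> lower b ->
  exists K : nat, forall e : int, e < - K%:Z -> a e x = 0 /\ b e y = 0.
Proof.
move=> la lb; have [K hK] := la x; have [L hL] := lb y.
by exists (maxn K L) => e he; rewrite hK ?hL //; lia.
Qed.

(** In a normally ordered product, one factor is applied to the finitely many
    nonzero vectors that the annihilation part of the other one produces. *)
Lemma lower_range (F : fieldType) (V : lmodType F) (a : fseries V) (x : int -> V) m :
  lower a -> exists K : nat, forall i e : int,
    - m%:Z <= i -> i < m%:Z -> e < - K%:Z -> a e (x i) = 0.
Proof.
move=> la; elim: m => [|m [K hK]]; first by exists 0%N => i e; lia.
have [L hL] := lower_common (x m%:Z) (x (- m.+1%:Z)) la la.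
exists (maxn K L) => i e h1 h2 he.
have [->|n1] := eqVneq i m%:Z; first by apply: (hL e _).1; lia.
have [->|n2] := eqVneq i (- m.+1%:Z); first by apply: (hL e _).2; lia.
by apply: hK; lia.
Qed.

Section FieldCalculus.
Variables (F : fieldType) (V : lmodType F).
Implicit Types a b : fseries V.

Lemma field0 a e : is_field a -> a e 0 = 0.
Proof. by move=> fa; exact: (lin_zero (fa.1 e)). Qed.

Lemma finsum_creation a b e x : is_field a -> is_field b ->
  finsum (fun i => creation a i (b (e - i) x)).
Proof.
move=> fa fb; have [K hK] := fb.2 x; exists (K + absz e).+1 => i hi.
rewrite creationE; case: ifP => // i0.
by rewrite hK ?(field0 _ fa) //; lia.
Qed.

Lemma finsum_annihilation a b e x : is_field a -> is_field b ->
  finsum (fun i => b i (annihilation a (e - i) x)).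
Proof.
move=> fa fb; have [K hK] := fa.2 x; exists (K + absz e).+1 => i hi.
rewrite annihilationE; case: ifP => [i0|_]; last exact: field0.
by rewrite hK ?(field0 _ fb) //; lia.
Qed.

Lemma is_field_nop a b : is_field a -> is_field b -> is_field (nop a b).
Proof.
move=> fa fb; split=> [e c x y|x].
  rewrite !nopE scalerDr addrACA; congr (_ + _); apply: isum_linear => [i||];
    try exact: finsum_creation; try exact: finsum_annihilation.
    rewrite !creationE (fb.1 (e - i)); case: ifP => _; first by rewrite (fa.1 i).
    by rewrite scaler0 addr0.
  rewrite !annihilationE; case: ifP => _; first by rewrite (fa.1 (e - i)) (fb.1 i).
  by rewrite !(field0 _ fb) scaler0 addr0.
have [K hK] := fb.2 x; have [L hL] := fa.2 x.
have [M hM] := lower_range (fun i => a i x) L.+1 fb.2.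
exists (K + L + M).+1 => e he; rewrite nopE !isum0 ?addr0 // => i.
  rewrite annihilationE; case: ifP => [ei|_]; last exact: field0.
  have [eL|eL] := ltP (e - i) (- L%:Z); first by rewrite hL ?(field0 _ fb).
  by apply: hM; lia.
by rewrite creationE; case: ifP => // i0; rewrite hK ?(field0 _ fa) //; lia.
Qed.

Lemma finsum_comm a b e x : is_field a -> is_field b -> fcomm a b ->
  finsum (fun i => a i (b (e - i) x)).
Proof.
move=> fa fb ab; have [K hK] := lower_common x x fa.2 fb.2.
exists (K + absz e).+1 => i hi; have [iK|iK] := ltP i (- K%:Z).
  by rewrite ab (hK i iK).1 (field0 _ fb).
by rewrite (hK (e - i) _).2 ?(field0 _ fa) //; lia.
Qed.

(** Hence facts on normally ordered products apply to products of commuting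
    fields. *)
Lemma fmul_nop a b : is_field a -> is_field b -> fcomm a b -> fmul a b = nop a b.
Proof.
move=> fa fb ab; apply/funext => e; apply/funext => x.
rewrite fmulE nopE -[X in _ = _ + X](isum_refl e) -isumD.
- apply: eq_isum => i; rewrite creationE annihilationE subKr.
  by case: ltP => _; rewrite ?addr0 // ?(field0 _ fb) ?add0r ?addr0 // ab.
- exact: finsum_creation.
- exact: (@finsum_refl _ e (fun i => b i (annihilation a (e - i) x))
    (finsum_annihilation e x fa fb)).
Qed.

Lemma fcomm_sym a b : fcomm a b -> fcomm b a.
Proof. by move=> ab i j x; rewrite ab. Qed.

Lemma fmulC a b : fcomm a b -> fmul a b = fmul b a.
Proof.
move=> ab; apply/funext => e; apply/funext => x; rewrite !fmulE -(isum_refl e).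
by apply: eq_isum => i; rewrite subKr ab.
Qed.

Lemma is_field_fmul a b : is_field a -> is_field b -> fcomm a b -> is_field (fmul a b).
Proof. by move=> fa fb ab; rewrite fmul_nop //; apply: is_field_nop. Qed.

Lemma fcomm_nop a b c : is_field a -> is_field b -> is_field c ->
  fcomm c a -> fcomm c b -> fcomm c (nop a b).
Proof.
move=> fa fb fc ca cb i e x; rewrite !nopE (lin_add (fc.1 i)).
rewrite !(lin_isum (fc.1 i)); last 2 first.
- exact: finsum_annihilation.
- exact: finsum_creation.
congr (_ + _); apply: eq_isum => j.
  rewrite !creationE; case: ifP => _; last exact: field0.
  by rewrite ca cb.
by rewrite !annihilationE cb; case: ifP => _; rewrite ?ca // !(field0 _ fc).
Qed.

Lemma fcomm_fmul a b c : is_field a -> is_field b -> is_field c -> fcomm a b ->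
  fcomm c a -> fcomm c b -> fcomm c (fmul a b).
Proof. by move=> fa fb fc ab ca cb; rewrite fmul_nop //; apply: fcomm_nop. Qed.

Lemma is_fieldD a b : is_field a -> is_field b -> is_field (a + b).
Proof.
move=> fa fb; split=> [e c x y|x].
  by rewrite !fserD (fa.1 e) (fb.1 e) scalerDr addrACA.
have [K hK] := lower_common x x fa.2 fb.2.
by exists K => e he; rewrite fserD (hK e he).1 (hK e he).2 addr0.
Qed.

Lemma is_fieldZ c a : is_field a -> is_field (c *: a).
Proof.
move=> fa; split=> [e d x y|x].
  by rewrite !fserZ (fa.1 e) scalerDr !scalerA mulrC.
have [K hK] := fa.2 x.
by exists K => e he; rewrite fserZ hK // scaler0.
Qed.

Lemma is_fieldN a : is_field a -> is_field (- a).
Proof. by move=> fa; rewrite -scaleN1r; apply: is_fieldZ. Qed.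

Lemma is_field0 : is_field (0 : fseries V).
Proof. by split=> [e c x y|x]; [rewrite /= scaler0 addr0|exists 0%N]. Qed.

Lemma is_field_sum I (r : seq I) (P : pred I) (a : I -> fseries V) :
  (forall i, is_field (a i)) -> is_field (\sum_(i <- r | P i) a i).
Proof.
move=> fa; elim/big_rec: _ => [|i b _ fb]; first exact: is_field0.
exact: is_fieldD.
Qed.

Lemma is_field_fder a : is_field a -> is_field (fder a).
Proof.
move=> fa; split=> [e c x y|x].
  by rewrite !fderE (fa.1 (e + 1)) scalerDr !scalerA mulrC.
have [K hK] := fa.2 x; exists K.+1 => e he.
by rewrite fderE hK ?scaler0 //; lia.
Qed.

Lemma fcommDl a b c : is_field c -> fcomm a c -> fcomm b c -> fcomm (a + b) c.
Proof. by move=> fc ac bc i j x; rewrite !fserD ac bc (lin_add (fc.1 j)). Qed.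

Lemma fcommZl d a c : is_field c -> fcomm a c -> fcomm (d *: a) c.
Proof. by move=> fc ac i j x; rewrite !fserZ ac (lin_scale (fc.1 j)). Qed.

Lemma fcommNl a c : is_field c -> fcomm a c -> fcomm (- a) c.
Proof. by move=> fc ac i j x; rewrite !fserN ac (lin_opp (fc.1 j)). Qed.

Lemma fcomm_der a c : is_field c -> fcomm a c -> fcomm (fder a) c.
Proof. by move=> fc ac i j x; rewrite !fderE ac (lin_scale (fc.1 j)). Qed.

Lemma nopDl a b c e x : is_field a -> is_field b -> is_field c ->
  nop (a + b) c e x = nop a c e x + nop b c e x.
Proof.
move=> fa fb fc; rewrite !nopE addrACA; congr (_ + _); rewrite -isumD;
  try exact: finsum_annihilation; try exact: finsum_creation;
  apply: eq_isum => i.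
  by rewrite !creationE; case: ifP => _; rewrite ?addr0.
rewrite !annihilationE; case: ifP => _; first by rewrite -(lin_add (fc.1 i)).
by rewrite (field0 _ fc) addr0.
Qed.

Lemma nopZl d a c e x : is_field a -> is_field c ->
  nop (d *: a) c e x = d *: nop a c e x.
Proof.
move=> fa fc; have sl := @scale_lin _ V d.
rewrite !nopE scalerDr !(lin_isum sl); try exact: finsum_annihilation;
  try exact: finsum_creation.
congr (_ + _); apply: eq_isum => i.
  by rewrite !creationE; case: ifP => _; rewrite ?scaler0.
rewrite !annihilationE; case: ifP => _; first by rewrite fserZ (lin_scale (fc.1 i)).
by rewrite (field0 _ fc) scaler0.
Qed.

Lemma nopDr a b c e x : is_field a -> is_field b -> is_field c ->
  nop c (a + b) e x = nop c a e x + nop c b e x.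
Proof.
move=> fa fb fc; rewrite !nopE addrACA; congr (_ + _); rewrite -isumD;
  try exact: finsum_annihilation; try exact: finsum_creation;
  apply: eq_isum => i; last by rewrite fserD.
rewrite !creationE; case: ifP => _; last by rewrite addr0.
by rewrite fserD (lin_add (fc.1 i)).
Qed.

Lemma nopZr d a c e x : is_field a -> is_field c ->
  nop c (d *: a) e x = d *: nop c a e x.
Proof.
move=> fa fc; have sl := @scale_lin _ V d.
rewrite !nopE scalerDr !(lin_isum sl); try exact: finsum_annihilation;
  try exact: finsum_creation.
congr (_ + _); apply: eq_isum => i.
rewrite !creationE; case: ifP => _; last by rewrite scaler0.
by rewrite fserZ (lin_scale (fc.1 i)).
Qed.

Lemma nopNl a c e x : is_field a -> is_field c -> nop (- a) c e x = - nop a c e x.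
Proof. by move=> fa fc; rewrite -[- a]scaleN1r nopZl // scaleN1r. Qed.

Lemma nopNr a c e x : is_field a -> is_field c -> nop c (- a) e x = - nop c a e x.
Proof. by move=> fa fc; rewrite -[- a]scaleN1r nopZr // scaleN1r. Qed.

(** The series [c z^(-1)]. *)
Definition pole (c : F) : fseries V := fun e x => if e == -1 then c *: x else 0.

Lemma poleE c e x : pole c e x = if e == -1 then c *: x else 0.
Proof. by []. Qed.

Lemma is_field_pole c : is_field (pole c).
Proof.
split=> [e d x y|x]; rewrite /pole.
  by case: ifP => _; rewrite ?scaler0 ?addr0 // scalerDr !scalerA mulrC.
by exists 1%N => e he; rewrite ifF //; lia.
Qed.

Lemma fcomm_pole c a : is_field a -> fcomm (pole c) a.
Proof.
move=> fa i j x; rewrite !poleE; case: ifP => _; last by rewrite field0.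
by rewrite (lin_scale (fa.1 j)).
Qed.

Lemma fmul_pole c a e x : fmul (pole c) a e x = c *: a (e + 1) x.
Proof.
rewrite fmulE (@isum_delta _ (-1)) => [|i /negPf hi]; last by rewrite poleE hi.
by rewrite poleE eqxx opprK.
Qed.

Lemma nop_polel c a e x : is_field a -> nop (pole c) a e x = c *: a (e + 1) x.
Proof.
by move=> fa; rewrite -(fmul_nop (is_field_pole c) fa (fcomm_pole c fa)) fmul_pole.
Qed.

Lemma nop_poler c a e x : is_field a -> nop a (pole c) e x = c *: a (e + 1) x.
Proof.
move=> fa; have ap := fcomm_sym (fcomm_pole c fa).
by rewrite -(fmul_nop fa (is_field_pole c) ap) (fmulC ap) fmul_pole.
Qed.

(** The series [z^(-1) a(z)]. *)
Definition fshift a : fseries V := fun e => a (e + 1).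

Lemma is_field_shift a : is_field a -> is_field (fshift a).
Proof.
move=> fa; split=> [e|x]; first exact: fa.1.
by have [K hK] := fa.2 x; exists K.+1 => e he; apply: hK; lia.
Qed.

Lemma fmul_shift a b e x : fmul (fshift a) b e x = fmul a b (e + 1) x.
Proof.
rewrite !fmulE -[RHS](isum_shift 1); apply: eq_isum => i.
by rewrite /fshift; congr (a _ (b _ _)); lia.
Qed.

Lemma fmulDl a b c e x : is_field a -> is_field b -> is_field c ->
  fcomm a c -> fcomm b c -> fmul (a + b) c e x = fmul a c e x + fmul b c e x.
Proof.
move=> fa fb fc ac bc; rewrite !fmul_nop ?nopDl //; first exact: is_fieldD.
exact: fcommDl.
Qed.

Lemma fmulZl d a c e x : is_field a -> is_field c -> fcomm a c ->
  fmul (d *: a) c e x = d *: fmul a c e x.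
Proof.
move=> fa fc ac; rewrite !fmul_nop ?nopZl //; first exact: is_fieldZ.
exact: fcommZl.
Qed.

End FieldCalculus.

(** * Adjoints of fields *)

Definition adj (F : fieldType) (M M' : lmodType F) (B : M -> M' -> F)
  (T : M -> M) (T' : M' -> M') : Prop := forall x y, B (T x) y = B x (T' y).

(** In terms of generating series: the adjoint of [a(z)] is [z^s a'(1/z)]. *)
Definition fadj (F : fieldType) (M M' : lmodType F) (B : M -> M' -> F) (s : int)
  (a : fseries M) (a' : fseries M') : Prop := forall k, adj B (a k) (a' (s - k)).

Lemma isum_neg_range (V : zmodType) (g : int -> V) m :
  isum (fun k => if (- m%:Z <= k) && (k < 0) then g k else 0)
  = \sum_(i < m) g (- i.+1%:Z)
  /\ finsum (fun k => if (- m%:Z <= k) && (k < 0) then g k else 0).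
Proof.
split; last by exists m => k hk; rewrite ifF //; lia.
elim: m => [|m IH]; first by rewrite big_ord0 isum0 // => k; rewrite ifF //; lia.
have hd : isum (fun k => if k == - m.+1%:Z then g k else 0) = g (- m.+1%:Z).
  by rewrite (@isum_delta _ (- m.+1%:Z)) ?eqxx // => i /negPf ->.
rewrite big_ord_recr /= -IH -hd -isumD.
- apply: eq_isum => k; have [->|ne] := eqVneq k (- m.+1%:Z).
    by rewrite ifT ?ifF ?add0r //; lia.
  by rewrite addr0; congr (if _ then _ else _); lia.
- by exists m => k hk; rewrite ifF //; lia.
by exists m.+1 => k hk; rewrite ifF //; lia.
Qed.

Section Adjoints.
Variables (F : fieldType) (M M' : lmodType F) (B : M -> M' -> F).
Hypothesis Bb : bilinear_pairing B.

Local Notation fadj := (fadj B).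
Local Notation Bl y := (pair_linl Bb y).
Local Notation Br x := (pair_linr Bb x).

Lemma fadjD s a b a' b' : fadj s a a' -> fadj s b b' -> fadj s (a + b) (a' + b').
Proof.
move=> aa bb k x y; rewrite !fserD.
rewrite (lin_add (Bl y)) (lin_add (Br x)).
by congr (_ + _); [exact: aa|exact: bb].
Qed.

Lemma fadj_sum s I (r : seq I) (P : pred I) a a' : (forall i, fadj s (a i) (a' i)) ->
  fadj s (\sum_(i <- r | P i) a i) (\sum_(i <- r | P i) a' i).
Proof.
move=> h; elim/big_rec2: _ => [|i b b' _ hb]; last exact: fadjD.
by move=> k x y; rewrite (lin_zero (Bl y)) (lin_zero (Br x)).
Qed.

Lemma fadj_isum (g : int -> M) (g' : int -> M') x y c :
  (forall i, B (g i) y = B x (g' (c - i))) -> finsum g -> finsum g' ->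
  B (isum g) y = B x (isum g').
Proof.
move=> h fg fg'; rewrite (lin_isum (Bl y) fg) (lin_isum (Br x) fg').
rewrite -[RHS](isum_refl c); exact: eq_isum.
Qed.

Lemma fadj_fmul s t a b a' b' :
  is_field a -> is_field b -> fcomm a b ->
  is_field a' -> is_field b' -> fcomm a' b' ->
  fadj s a a' -> fadj t b b' -> fadj (s + t) (fmul a b) (fmul a' b').
Proof.
move=> fa fb ab fa' fb' ab' aa bb e x y; rewrite !fmulE.
apply: (@fadj_isum (fun i => a i (b (e - i) x))
  (fun i => a' i (b' (s + t - e - i) y)) x y s) => [i||]; last 2 first.
- exact: (finsum_comm _ _ fa fb ab).
- exact: (finsum_comm _ _ fa' fb' ab').
rewrite aa bb ab'; congr (B x (b' _ _)); lia.
Qed.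

(** Taking adjoints exchanges the two halves of a normally ordered product,
    except for the coefficients of [a'] with index [- m <= k < 0], which move to
    the other side of [b']. *)
Lemma fadj_nop (m : nat) t a b a' b' :
  is_field a -> is_field b -> is_field a' -> is_field b' ->
  fadj (- m.+1%:Z) a a' -> fadj t b b' ->
  forall e x y, B (nop a b e x) y
    = B x (nop a' b' (- m.+1%:Z + t - e) y
           + \sum_(i < m) (a' (- i.+1%:Z) (b' (- m.+1%:Z + t - e + i.+1%:Z) y)
                    - b' (- m.+1%:Z + t - e + i.+1%:Z) (a' (- i.+1%:Z) y))).
Proof.
move=> fa fb fa' fb' aa bb e x y; set s := - _; set e' := s + t - e.
pose P k := a' k (b' (e' - k) y); pose Q k := b' (e' - k) (a' k y).
have [Ka hKa] := fa'.2 y; have [Kb hKb] := fb'.2 y.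
have fQ : finsum (fun k => if k <= s then Q k else 0).
  exists (Ka + m).+2 => k hk; case: ifP => // ks.
  by rewrite /Q hKa ?(field0 _ fb') //; rewrite /s in ks; lia.
have fP : finsum (fun k => if s < k then P k else 0).
  exists (Kb + absz e' + m).+2 => k hk; case: ifP => // ks.
  by rewrite /P hKb ?(field0 _ fa') //; rewrite /s in ks *; lia.
rewrite nopE (lin_add (Bl y)).
rewrite (@fadj_isum _ (fun k => if k <= s then Q k else 0) x y s) //; last 2 first.
- move=> i; rewrite creationE; have -> : (s - i <= s) = (0 <= i) by lia.
  case: ifP => _; last first.
    by rewrite (lin_zero (Bl y)) (lin_zero (Br x)).
  by rewrite aa bb; congr (B x (b' _ _)); rewrite /e'; lia.
- exact: finsum_creation.
rewrite -(isum_refl e (fun i => b i (annihilation a (e - i) x))).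
rewrite (@fadj_isum _ (fun k => if s < k then P k else 0) x y s) //;
  last 2 first.
- move=> i; rewrite annihilationE; have -> : (s < s - i) = (i < 0) by lia.
  rewrite subKr; case: ifP => _; last first.
    by rewrite (field0 _ fb) (lin_zero (Bl y)) (lin_zero (Br x)).
  by rewrite bb aa; congr (B x (a' _ (b' _ _))); rewrite /e'; lia.
- exact: (@finsum_refl _ e (fun i => b i (annihilation a (e - i) x))
    (finsum_annihilation e x fa fb)).
rewrite -(lin_add (Br x)); congr (B x _).
have [<- fR] := isum_neg_range (fun k => P k - Q k) m.
rewrite nopE.
rewrite -(isum_refl e' (fun i => b' i (annihilation a' (e' - i) y))) -!isumD //.
- apply: eq_isum => k; rewrite creationE annihilationE subKr.
  have -> : (- m%:Z <= k) && (k < 0) = (s < k) && (k < 0) by rewrite /s; lia.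
  case: ltP => ks; case: ltP => k0 /=.
  + by rewrite !add0r addrC subrK.
  + by rewrite (field0 _ fb') add0r !addr0.
  + by rewrite add0r !addr0.
  + by rewrite /s in ks; lia.
- apply: finsumD; first exact: finsum_creation.
  exact: (@finsum_refl _ e' (fun i => b' i (annihilation a' (e' - i) y))
    (finsum_annihilation e' y fa' fb')).
- exact: finsum_creation.
- exact: (@finsum_refl _ e' (fun i => b' i (annihilation a' (e' - i) y))
    (finsum_annihilation e' y fa' fb')).
Qed.
End Adjoints.

(** * The Virasoro module *)

Section VirasoroForm.
Variables (F : numFieldType) (h : F) (U : vir_module F).
Hypothesis hU : is_LVir h U.

(* The scalar [x] absorbs the structure constants [n - m]. *)
Let A (n : int) (x : F) (v : U) : U := x *: vir_mode n v.

Let vc v : vir_center v = 0 :> U.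
Proof. by case: hU. Qed.

Let vl n : linear (@vir_mode F U n) := vir_mode_linear n.

Let Al n x : linear (A n x).
Proof. by move=> c u v; rewrite /A vl scalerDr !scalerA mulrC. Qed.

Let virC n m (v : U) : vir_mode n (vir_mode m v) =
  vir_mode m (vir_mode n v) + (n - m)%:~R *: vir_mode (n + m) v.
Proof.
have := vir_mode_comm n m v; rewrite vc scaler0 addr0 => <-.
by rewrite addrC subrK.
Qed.

Let irrA : irr_ops A.
Proof.
have [[_ irr] _ _] := hU; move=> S sS SA [v Sv v0] u.
have [||E|-> //] := irr S sS.
- by move=> n w Sw; have := SA n 1 w Sw; rewrite /A scale1r.
- by move=> w _; rewrite vc; exact: sS.1.
by move: Sv; rewrite E.
Qed.

(** The vectors killed by all modes of large degree form a submodule. *)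
Lemma vir_smooth : is_field (@omega_vir F U).
Proof.
split=> [e|v]; first exact: vl.
suff [K hK] : exists K : nat, forall n : int, K%:Z <= n -> vir_mode n v = 0.
  by exists (K + 2)%N => e he; apply: hK; lia.
have [_ _ [v0 [v00 _ pos]]] := hU.
apply: (irrA (S := [set v | exists K : nat, forall n : int, K%:Z <= n ->
                                vir_mode n v = 0])).
- split=> [|c x y [K hK] [L hL]]; first by exists 0%N => n _; exact: lin_zero (vl n).
  by exists (maxn K L) => n hn; rewrite vl hK ?hL ?scaler0 ?addr0 //; lia.
- move=> m x u [K hK]; exists (K + absz m)%N => n hn.
  rewrite /A (lin_scale (vl n)) virC !hK ?(lin_zero (vl m)) ?scaler0 ?addr0 ?scaler0 //; lia.
by exists v0; [exists 1%N => n hn; apply: pos; lia|exact/eqP].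
Qed.

(** The top is the line of the highest weight vector, graded by [L_0]. *)
Lemma vir_contragredient : exists B : U -> U -> F,
  [/\ bilinear_pairing B, nondegenerate_pairing B
    & forall n u v, B (vir_mode n u) v = B u (vir_mode (- n) v)].
Proof.
have [_ _ [v0 [/eqP v00 hv0 pos]]] := hU.
pose f (c : F^o) : U := c *: v0.
pose br (n m : int) (x y : F) : F := (n - m)%:~R * x * y.
pose co (n m : int) (x y : F) : F := 0.
pose rho (x : F) (c : F^o) : F^o := x * h * c.
have fl : linear f by move=> c x y; rewrite /f scalerDl scalerA.
have fpos n x w : 0 < n -> A n x (f w) = 0.
  by move=> n0; rewrite /A /f (lin_scale (vl n)) pos // !scaler0.
have f0 x w : A 0 x (f w) = f (rho x w).
  by rewrite /A /f /rho (lin_scale (vl 0)) hv0 !scalerA; congr (_ *: _); ring.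
have AC n m x y v :
    A n x (A m y v) - A m y (A n x v) = A (n + m) (br n m x y) v + co n m x y *: v.
  rewrite /A /co /br (lin_scale (vl n)) (lin_scale (vl m)) virC.
  rewrite !scalerA (mulrC y x) scalerDr addrC addrA addNr add0r scale0r addr0 scalerA.
  by congr (_ *: _); ring.
have finj w : f w = 0 -> w = 0.
  by move/eqP; rewrite scaler_eq0 => /orP[/eqP //|/eqP].
have [pi [pil pif pineg pi0]] : exists pi : U -> F^o,
    [/\ linear pi, forall w, pi (f w) = w,
      forall n x v, n < 0 -> pi (A n x v) = 0
    & forall x v, pi (A 0 x v) = rho x (pi v)].
  apply: (@top_projection F F U F^o A br co Al AC _ f rho fl fpos f0 finj _ irrA
    (@vir_mode F U 0) h) => //.
  - by exists 1; apply/eqP/oner_neq0.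
  - by move=> w; rewrite /f (lin_scale (vl 0)) hv0 !scalerA mulrC.
  move=> n x v _; rewrite /A (lin_scale (vl 0)) virC scalerDr scalerA.
  by rewrite sub0r add0r scalerA mulrC intrN mulNr scaleNr.
pose A' n x v := A (- n) x v.
have [||||||||B [Bb Bn BA]] := @contragredient_form F F U U F^o F^o A A' br co Al
  (fun n => Al (- n)) AC _ f f rho rho fpos _ _ irrA _ pi pi pil pil pif pif pineg _ pi0
  (fun x y => x * y).
- move=> n m x y v; rewrite /A' AC; congr (_ + _); rewrite /A /br; congr (_ *: vir_mode _ _).
    by rewrite !intrD !intrN; ring.
  by lia.
- by move=> n x w n0; apply: fpos; lia.
- by move=> x w; rewrite /A' oppr0 f0.
- move=> S sS SA; apply: irrA => // n x v Sv.
  by have := SA (- n) x v Sv; rewrite /A' opprK.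
- by move=> n x v n0; apply: pineg; lia.
- by split=> x c y z; rewrite -[c *: y]/(c * y); ring.
- by move=> x w w'; rewrite /rho; ring.
- by exists 1, 1; rewrite mulr1; apply/eqP/oner_neq0.
exists B; split=> // n u v; have := BA n 1 u v.
by rewrite /A' /A !scale1r.
Qed.

End VirasoroForm.

(** * Simple modules over the matrices, their duals, and the Casimir tensor *)

(** A detachable subspace of maximal dimension among those contained in [S] is
    all of [S]. *)
Lemma subspace_vspace (F : fieldType) (W : vectType F) (S : set W) :
  subspace S -> exists T : {vspace W}, forall w, w \in T <-> S w.
Proof.
move=> [S0 Sl].
pose P n := `[< exists2 T : {vspace W}, \dim T = n & forall w, w \in T -> S w >].
have exP : exists n, P n.
  by exists 0%N; apply/asboolP; exists 0%VS; rewrite ?dimv0 // => w; rewrite memv0 => /eqP ->.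
have ubP n : P n -> (n <= \dim {:W})%N.
  by move=> /asboolP [T <- _]; apply/dimvS/subvf.
case: (ex_maxnP exP ubP) => n /asboolP [T dT TS] nmax.
exists T => w; split=> [|Sw]; first exact: TS.
apply: contrapT => wT; suff : (\dim T < n)%N by rewrite dT ltnn.
have : P (\dim (T + <[w]>)%VS).
  apply/asboolP; exists (T + <[w]>)%VS => // u /memv_addP [t tT [_ /vlineP [c ->] ->]].
  by rewrite addrC; apply: Sl => //; apply: TS.
move/nmax; apply: leq_trans; rewrite ltn_neqAle dimvS ?addvSl // andbT.
apply: contra_notN wT => /eqP h.
have <- : (T + <[w]>)%VS = T.
  by apply/esym/eqP; rewrite eqEdim addvSl h /=.
by rewrite memvE addvSr.
Qed.

Section GlModules.
Variables (F : fieldType) (N : nat).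

Lemma gl_simple_ind (W : gl_module F N) : gl_simple W ->
  forall S : set W, subspace S -> (forall X w, S w -> S (gl_act X w)) ->
  (exists2 w, S w & w <> 0) -> forall w, S w.
Proof.
move=> [_ simp] S sS SA [w0 Sw0 nw0] w; have [T hT] := subspace_vspace sS.
apply/hT; have [|T0|->] := simp T; last exact: memvf.
  by move=> X u /hT Su; apply/hT/SA.
by case: nw0; apply/eqP; rewrite -memv0 -T0; apply/hT.
Qed.

Lemma functional_separates (W : vectType F) (w : W) :
  (forall phi : 'Hom(W, F^o), phi w = 0) -> w = 0.
Proof.
move=> h; pose e := vbasis {:W}; rewrite (coord_vbasis (memvf w)) big1 // => i _.
pose g : {linear W -> F^o} := coord e i.
by have := h (linfun g); rewrite lfunE /= => ->; rewrite scale0r.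
Qed.

(** Let [S] be a submodule of the dual. If a nonzero vector of [W] is annihilated
    by [S], then all of [W] is, and [S] is zero. Otherwise [W] embeds into the dual of
    [S] by evaluation, so that [S] has full dimension. *)
Lemma gl_dual_simple (W : gl_module F N) : gl_simple W -> gl_simple (gl_dual W).
Proof.
move=> hW; have [[w0 nw0] _] := hW; split.
  have [phi phi0] : exists phi : 'Hom(W, F^o), phi w0 <> 0.
    apply: contrapT => h; move/eqP: nw0; apply; apply: functional_separates => phi.
    by apply: contrapT => phi0; apply: h; exists phi.
  by exists (phi : gl_dual W); apply/eqP => h; apply: phi0; rewrite h lfunE.
move=> S SA; have [ann|ann] := pselect (exists2 w : W, w <> 0 &
    forall phi : gl_dual W, phi \in S -> (phi : 'Hom(W, F^o)) w = 0).
  left; have [w nw wS] := ann; apply/eqP; rewrite -subv0; apply/subvP => phi phiS.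
  rewrite memv0; apply/eqP/lfunP => u; rewrite lfunE /=.
  have := @gl_simple_ind W hW [set u : W | forall phi : gl_dual W,
    phi \in S -> (phi : 'Hom(W, F^o)) u = 0].
  apply => //; last by exists w.
    split=> [psi _|c x y hx hy psi psiS]; first exact: linear0.
    by rewrite linearP /= hx // hy // scaler0 addr0.
  move=> X {}u hu psi psiS; have := hu _ (SA X _ psiS).
  by rewrite /= gl_dual_actE hu // mulr0 sub0r => /eqP; rewrite oppr_eq0 => /eqP.
right; apply/eqP; rewrite eqEdim subvf /=.
pose k := \dim S; pose b := vbasis S.
pose ev (w : W) : 'rV[F]_k := \row_i (b`_i : 'Hom(W, F^o)) w.
have evl : linear ev.
  by move=> c x y; apply/rowP => i; rewrite !mxE linearP.
pose evL : {linear W -> 'rV[F]_k} := HB.pack ev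
  (GRing.isLinear.Build F W 'rV[F]_k _ ev evl).
have ker0 : lker (linfun evL) = 0%VS.
  apply/eqP; rewrite -subv0; apply/subvP => w; rewrite memv_ker lfunE /= memv0 => /eqP ew.
  apply: contrapT => /negP/eqP nw; apply: ann; exists w => // phi phiS.
  rewrite (coord_vbasis phiS) sum_lfunE big1 // => i _; rewrite scale_lfunE.
  by have /rowP/(_ i) := ew; rewrite !mxE => ->; rewrite scaler0.
have := limg_ker_dim (linfun evL) fullv; rewrite capfv ker0 dimv0 add0n => dimg.
have dW : (\dim {:W} <= k)%N.
  rewrite -dimg; apply: leq_trans (dimvS (subvf _)) _.
  by rewrite dimvf /dim /= mul1n.
by apply: leq_trans dW; rewrite !dimvf /dim /= muln1.
Qed.

Local Notation E := (@delta_mx F N N).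

(** The index set and the two factors of the summands of the invariant tensor that
    underlies the Sugawara vector: one summand for each pair of indices and one
    for the identity. *)
Definition casimir_index : finType := ('I_N * 'I_N + 'I_1)%type.
Definition casimir_l (t : casimir_index) : 'M[F]_N :=
  if t is inl ij then E ij.1 ij.2 else 1%:M.
Definition casimir_r (t : casimir_index) : 'M[F]_N :=
  if t is inl ij then E ij.2 ij.1 else 1%:M.

Lemma casimir_sum (V : nmodType) (g : 'M[F]_N -> 'M[F]_N -> V) :
  \sum_t g (casimir_l t) (casimir_r t)
  = \sum_i \sum_j g (E i j) (E j i) + g 1%:M 1%:M.
Proof. by rewrite big_sumType /= big_ord1 pair_big. Qed.

Lemma casimir_sumC (V : nmodType) (g : 'M[F]_N -> 'M[F]_N -> V) :
  \sum_t g (casimir_l t) (casimir_r t) = \sum_t g (casimir_r t) (casimir_l t).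
Proof.
rewrite (casimir_sum g) (casimir_sum (fun x y => g y x)) exchange_big.
by [].
Qed.

Lemma delta_mulmx (Z : 'M[F]_N) i j : E i j *m Z = \sum_l Z j l *: E i l.
Proof.
apply/matrixP => a b; rewrite !mxE summxE (bigD1 j) //= mxE.
rewrite big1 => [|k kj]; last by rewrite mxE (negPf kj) andbF mul0r.
rewrite (bigD1 b) //= !mxE big1 => [|k kb]; last first.
  by rewrite !mxE [b == k]eq_sym (negPf kb) andbF mulr0.
by rewrite !eqxx !andbT !addr0 mulrC.
Qed.

Lemma mulmx_delta (Z : 'M[F]_N) i j : Z *m E i j = \sum_k Z k i *: E k j.
Proof.
apply: trmx_inj; rewrite trmx_mul trmx_delta delta_mulmx.
rewrite linear_sum /=; apply: eq_bigr => k _.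
by rewrite linearZ /= trmx_delta mxE.
Qed.

Section Invariance.
Variables (V : lmodType F) (g : 'M[F]_N -> 'M[F]_N -> V).
Hypotheses (gl : forall Y, linear (g^~ Y)) (gr : forall X, linear (g X)).

(** The families [E i j] and [E j i] are dual for the trace form, so that the
    tensor they define is invariant; the identity is central. *)
Lemma casimir_invariant Z :
  \sum_t (g (casimir_l t *m Z - Z *m casimir_l t) (casimir_r t)
          + g (casimir_l t) (casimir_r t *m Z - Z *m casimir_r t)) = 0.
Proof.
pose c (X : 'M[F]_N) := X *m Z - Z *m X.
rewrite (casimir_sum (fun X Y => g (c X) Y + g X (c Y))).
rewrite /c mul1mx mulmx1 subrr (lin_zero (gl _)) (lin_zero (gr _)) !addr0.
have E1 : \sum_i \sum_j g (E i j *m Z) (E j i) = \sum_i \sum_j g (E i j) (Z *m E j i).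
  under eq_bigr => i _ do under eq_bigr => j _ do
    rewrite delta_mulmx (lin_sum (gl _)).
  under [RHS]eq_bigr => i _ do under eq_bigr => j _ do
    rewrite mulmx_delta (lin_sum (gr _)).
  apply: eq_bigr => i _; rewrite exchange_big; apply: eq_bigr => j _.
  by apply: eq_bigr => l _; rewrite (lin_scale (gl _)) (lin_scale (gr _)).
have E2 : \sum_i \sum_j g (Z *m E i j) (E j i) = \sum_i \sum_j g (E i j) (E j i *m Z).
  under eq_bigr => i _ do under eq_bigr => j _ do
    rewrite mulmx_delta (lin_sum (gl _)).
  under [RHS]eq_bigr => i _ do under eq_bigr => j _ do
    rewrite delta_mulmx (lin_sum (gr _)).
  rewrite exchange_big [RHS]exchange_big; apply: eq_bigr => j _.
  rewrite exchange_big; apply: eq_bigr => i _.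
  by apply: eq_bigr => l _; rewrite (lin_scale (gl _)) (lin_scale (gr _)).
under eq_bigr => i _ do under eq_bigr => j _ do
  rewrite (lin_sub (gl _)) (lin_sub (gr _)) addrACA -opprD.
under eq_bigr => i _ do rewrite sumrB !big_split /=.
rewrite sumrB !big_split /= E1 E2 [X in _ - X]addrC subrr //.
Qed.

End Invariance.

Lemma sum_delta_sandwich (Z : 'M[F]_N) :
  \sum_i \sum_j E i j *m Z *m E j i = (\tr Z)%:M.
Proof.
apply/matrixP => a b; rewrite mxE summxE.
under eq_bigr => i _.
  rewrite summxE (eq_bigr (fun j => Z j j *+ ((i == a) && (i == b)))); last first.
    move=> j _; rewrite delta_mulmx mulmx_suml summxE (bigD1 j) //= big1 => [|l lj].
      rewrite -scalemxAl mul_delta_mx !mxE addr0.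
      by rewrite ![_ == i]eq_sym mulr_natr.
    by rewrite -scalemxAl mul_delta_mx_0 // scaler0 mxE.
  rewrite sumrMnl -/(\tr Z).
  over.
rewrite (bigD1 a) //= eqxx big1 ?addr0 // => i /negPf ->.
by rewrite mulr0n.
Qed.

(** The action of the Casimir tensor on the adjoint representation, and below its
    contraction with the trace form, are the two sources of the factor [N + 1] in
    the commutator of the Sugawara operator with the modes. *)
Lemma casimir_ad (Z : 'M[F]_N) (c := fun X Y : 'M[F]_N => X *m Y - Y *m X) :
  \sum_t c (casimir_l t) (c (casimir_r t) Z)
  = (2 * N%:R) *: Z - (2 * \tr Z)%:M.
Proof.
rewrite (casimir_sum (fun X Y => c X (c Y Z))).
have -> : c 1%:M (c 1%:M Z) = 0.
  by rewrite /c !mul1mx !mulmx1 !subrr.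
have S1 : \sum_i \sum_j E i j *m E j i = N%:R%:M.
  have := sum_delta_sandwich 1%:M; rewrite mxtrace1 => <-.
  by apply: eq_bigr => i _; apply: eq_bigr => j _; rewrite mulmx1.
have S2 : \sum_i \sum_j E j i *m Z *m E i j = (\tr Z)%:M.
  by rewrite exchange_big sum_delta_sandwich.
rewrite addr0 (eq_bigr (fun i => \sum_j (E i j *m E j i *m Z - E i j *m Z *m E j i
    - (E j i *m Z *m E i j - Z *m (E j i *m E i j))))); last first.
  by move=> i _; apply: eq_bigr => j _; rewrite /c mulmxBr mulmxBl !mulmxA.
under eq_bigr => i _ do rewrite !sumrB -mulmx_suml -mulmx_sumr.
rewrite !sumrB -mulmx_suml -mulmx_sumr sum_delta_sandwich S2 S1.
rewrite [X in Z *m X]exchange_big S1 mul_scalar_mx mul_mx_scalar opprB addrACA.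
have -> : (2 * \tr Z)%:M = (\tr Z)%:M + (\tr Z)%:M :> 'M[F]_N.
  by rewrite mulr_natl mulr2n raddfD.
by rewrite -scalerDl -opprD mulr_natl mulr2n.
Qed.

Lemma trace_delta i j : \tr (E i j) = (i == j)%:R.
Proof.
rewrite /mxtrace (bigD1 i) //= mxE eqxx big1 ?addr0 // => k ki.
by rewrite mxE (negPf ki).
Qed.

Lemma casimir_trace (Z : 'M[F]_N) :
  \sum_t \tr (casimir_l t *m Z) *: casimir_r t = Z + (\tr Z)%:M.
Proof.
rewrite (casimir_sum (fun X Y => \tr (X *m Z) *: Y)) mul1mx scalemx1; congr (_ + _).
rewrite [RHS]matrix_sum_delta exchange_big; apply: eq_bigr => j _.
apply: eq_bigr => i _; congr (_ *: _); rewrite delta_mulmx raddf_sum /=.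
rewrite (bigD1 i) //= linearZ /= big1 => [|k ki].
  by rewrite trace_delta eqxx mulr1 addr0.
by rewrite linearZ /= trace_delta eq_sym (negPf ki) mulr0.
Qed.

End GlModules.

Import VectorInternalTheory.

(** An eigenspace of [T] is a submodule. *)
Lemma schur (F : numClosedFieldType) (N : nat) (W : gl_module F N) (T : W -> W) :
  gl_simple W -> linear T -> (forall X w, T (gl_act X w) = gl_act X (T w)) ->
  exists c, forall w, T w = c *: w.
Proof.
move=> hW Tl TX; have [[w0 nw0] _] := hW.
pose A := lin1_mx (fun r : 'rV[F]_(dim W) => v2r (T (r2v r))).
have dW : (0 < dim W)%N.
  rewrite lt0n; apply: contraNN nw0 => /eqP d0; rewrite -[w0]v2rK.
  by rewrite (_ : v2r w0 = 0) ?linear0 //; apply/rowP => -[i hi]; exfalso; rewrite d0 in hi.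
have [c /eigenvalueP [r rA r0]] := eigenvalue_closed A dW.
exists c; apply: (gl_simple_ind hW (S := [set w | T w = c *: w])).
- split=> [|a x y hx hy] /=; first by rewrite (lin_zero Tl) scaler0.
  by rewrite Tl hx hy scalerDr !scalerA mulrC.
- by move=> X w hw; rewrite /= TX hw (lin_scale (gl_act_linear X)).
exists (r2v r) => /=; last first.
  by move=> h; case/eqP: r0; rewrite -[r]r2vK h linear0.
apply: (can_inj v2rK); rewrite linearZ /= r2vK -rA.
pose TL : {linear 'rV[F]_(dim W) -> 'rV[F]_(dim W)} :=
  HB.pack (fun r : 'rV[F]_(dim W) => v2r (T (r2v r)))
  (GRing.isLinear.Build F _ _ _ (fun r : 'rV[F]_(dim W) => v2r (T (r2v r)))
     (fun a x y => etrans (congr1 (fun u => v2r (T u)) (linearP r2v a x y))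
        (etrans (congr1 v2r (Tl a _ _)) (linearP v2r a _ _)))).
exact/esym/(mul_rV_lin1 TL).
Qed.

(** * The affine module and its Sugawara grading *)

Section SmoothAffine.
Variables (F : numClosedFieldType) (N : nat) (W : gl_module F N) (V : ghat_module F N).
Hypotheses (hW : gl_simple W) (hV : is_Lgl W V).

Local Notation X_ := (@ghat_mode F N V).

Let Xl n X : linear (X_ n X) := ghat_mode_linear n X.
Let XL n v : linear (fun X => X_ n X v) := ghat_mode_linear_l n v.

(** If [W] were mapped to zero, the surjection from the induced module and the zero
    map would extend the same map of [W], so that [V] would be zero. The kernel of
    the map from [W] is a submodule of the simple module [W]. *)
Lemma Lgl_top : exists f : W -> V, top_hom f /\ forall w, f w = 0 -> w = 0.
Proof.
have [[[v0 nv0] _] [M [j [g [[[jl j0 jpos jc] ind] [gl gX gc] gsurj]]]]] := hV.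
have ft : top_hom (g \o j).
  split=> [|X w|n X w n0|w] /=; first exact: lin_comp.
  - by rewrite -gX j0.
  - by rewrite -gX jpos // (lin_zero gl).
  - by rewrite -gc jc.
have fnz : exists w, g (j w) <> 0.
  apply: contrapT => h; move/eqP: nv0; apply.
  have zt : top_hom ((fun=> 0) : W -> V).
    split=> [c x y|X w|n X w _|w]; first by rewrite scaler0 addr0.
    - exact: lin_zero (Xl _ _).
    - exact: lin_zero (Xl _ _).
    - exact: lin_zero (@ghat_center_linear F N V).
  have [g' [_ uni]] := ind V _ zt.
  have e1 : g' = g.
    apply: uni; split=> //; apply/funext => w /=; apply: contrapT => hw.
    by apply: h; exists w.
  have e2 : g' = (fun=> 0).
    apply: uni; split=> //; split=> [c x y|n X v|v].
    - by rewrite scaler0 addr0.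
    - by rewrite (lin_zero (Xl _ _)).
    - by rewrite (lin_zero (@ghat_center_linear F N V)).
  by have [m <-] := gsurj v0; rewrite -e1 e2.
have [fl f0 fpos fc] := ft.
exists (g \o j); split=> // w fw; apply: contrapT => nw.
have [w1 /= nw1] := fnz; apply: nw1.
apply: (gl_simple_ind hW (S := [set w | (g \o j) w = 0])); last by exists w.
  split=> [|c x y hx hy] /=; first exact: lin_zero fl.
  by have /= -> := fl c x y; move: hx hy => /= -> ->; rewrite scaler0 addr0.
by move=> X u /= hu; have /= <- := f0 X u; rewrite hu (lin_zero (Xl _ _)).
Qed.

Let irr : forall S : set V, subspace S ->
    (forall n X v, S v -> S (X_ n X v)) ->
    (forall v, S v -> S (ghat_center v)) ->
    (exists2 v, S v & v <> 0) -> forall v, S v.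
Proof.
have [[_ ir] _] := hV => S sS SX SC [v Sv v0] u.
have [E|-> //] := ir S sS SX SC.
by move: Sv; rewrite E.
Qed.

Let topnz (f : W -> V) : (forall w, f w = 0 -> w = 0) -> exists w, f w <> 0.
Proof.
by move=> fi; have [[w0 nw0] _] := hW; exists w0 => /fi h; rewrite h eqxx in nw0.
Qed.

Lemma center1 (v : V) : ghat_center v = v.
Proof.
have [f [[fl f0 fpos fc] /topnz [w nfw]]] := Lgl_top.
apply: (irr (S := [set v | ghat_center v = v])).
- split=> [|c x y hx hy] /=; first exact: lin_zero (@ghat_center_linear F N V).
  by rewrite ghat_center_linear hx hy.
- by move=> n X u /= hu; rewrite ghat_center_comm hu.
- by move=> u /= hu; rewrite hu.
by exists (f w) => //=.
Qed.

Lemma ghat_comm n m X Y (v : V) : X_ n X (X_ m Y v) =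
  X_ m Y (X_ n X v) + X_ (n + m) (X *m Y - Y *m X) v
   + (if n == - m then n%:~R * \tr (X *m Y) else 0) *: v.
Proof.
by rewrite -addrA -[in X in _ + _ *: X](center1 v) -ghat_mode_comm addrC subrK.
Qed.

Lemma ghat_irr : irr_ops X_.
Proof. by move=> S sS SX; apply: irr => // v Sv; rewrite center1. Qed.

(** The vectors killed by all modes of large degree form a submodule. *)
Lemma ghat_smooth (v : V) : exists K : nat, forall (n : int) X, K%:Z <= n -> X_ n X v = 0.
Proof.
have [f [[fl f0 fpos fc] /topnz [w nfw]]] := Lgl_top.
apply: (ghat_irr (S := [set v | exists K : nat, forall (n : int) X, K%:Z <= n ->
                                X_ n X v = 0])).
- split=> [|c x y [K hK] [L hL]].
    by exists 0%N => n X _; exact: lin_zero (Xl n X).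
  by exists (maxn K L) => n X hn; rewrite Xl hK ?hL ?scaler0 ?addr0 //; lia.
- move=> m Y u [K hK]; exists (K + absz m).+1 => n X hn.
  rewrite ghat_comm !hK ?(lin_zero (Xl _ _)); [|lia|lia].
  by rewrite ifF ?scale0r ?addr0 //; lia.
by exists (f w) => //; exists 1%N => n X hn; apply: fpos; lia.
Qed.

Lemma is_field_mode X : is_field (of_modes (fun n => X_ n X)).
Proof.
split=> [e|v]; first exact: Xl.
by have [K hK] := ghat_smooth v; exists K.+1 => e he; apply: hK; lia.
Qed.

(** The coefficients of the zeroth Sugawara operator, written as a sum over
    all integers: a product [X(k) Y(-k)] is kept, with multiplicity 2, when its
    right factor is an annihilation operator. *)
Definition sugawara_weight (k : int) : int := if k < 0 then 2 else if k == 0 then 1 else 0.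

Local Notation wt := sugawara_weight.
Local Notation cl := (@casimir_l F N).
Local Notation cr := (@casimir_r F N).

Definition sugawara_term k (v : V) : V :=
  (wt k)%:~R *: \sum_t X_ k (cl t) (X_ (- k) (cr t) v).

Definition sugawara (v : V) : V := isum (fun k => sugawara_term k v).

Lemma finsum_sugawara v : finsum (fun k => sugawara_term k v).
Proof.
have [K hK] := ghat_smooth v; exists K.+1 => k hk; rewrite /sugawara_term.
have [k0|k0] := ltP 0 k.
  by rewrite /wt ifF ?ifF ?scale0r //; lia.
rewrite big1 ?scaler0 // => t _.
by rewrite hK ?(lin_zero (Xl _ _)) //; lia.
Qed.

Lemma sugawara_lin : linear sugawara.
Proof.
move=> c u v; apply: isum_linear => [k||]; try exact: finsum_sugawara.
rewrite /sugawara_term scalerA mulrC -scalerA -scalerDr; congr (_ *: _).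
rewrite scaler_sumr -big_split /=.
by apply: eq_bigr => t _; rewrite Xl Xl.
Qed.

(** The weights telescope; this is where the factor [n] in the commutator with
    the modes of degree [n] comes from. *)
Lemma weight_shift (x : V) (m : nat) :
  isum (fun k => (wt k - wt (k + m%:Z))%:~R *: x) = (m%:Z * 2)%:~R *: x
  /\ finsum (fun k => (wt k - wt (k + m%:Z))%:~R *: x).
Proof.
split; last first.
  exists m.+1 => k hk; rewrite (_ : wt k - _ = 0) ?scale0r //.
  by rewrite /wt; do ?[case: ifP]; lia.
elim: m => [|m IH]; first by rewrite isum0 ?scale0r // => k; rewrite addr0 subrr scale0r.
pose d k := (wt k - wt (k + 1))%:~R *: x.
have dK : within 1 d.
  move=> k hk; rewrite /d (_ : wt k - _ = 0) ?scale0r //.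
  by rewrite /wt; do ?[case: ifP]; lia.
have dE : isum d = 2%:~R *: x.
  by rewrite (isumE dK) unlock /= /d /wt /= addr0 -scalerDl -intrD.
have -> : (m.+1%:Z * 2)%:~R *: x = (m%:Z * 2)%:~R *: x + 2%:~R *: x.
  by rewrite -scalerDl -intrD; congr (_%:~R *: _); lia.
rewrite -IH -dE -(isum_shift m%:Z d) -isumD.
- apply: eq_isum => k; rewrite /d -scalerDl -intrD; congr (_%:~R *: _).
  by rewrite addrA subrK; congr (_ - wt _); lia.
- exists m.+1 => k hk; rewrite (_ : wt k - _ = 0) ?scale0r //.
  by rewrite /wt; do ?[case: ifP]; lia.
by apply: finsum_shift; exists 1%N.
Qed.

Section Commutator.
Variables (n : int) (Z : 'M[F]_N) (v : V).

Let c (X Y : 'M[F]_N) : 'M[F]_N := X *m Y - Y *m X.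
Let cc X Y : c X Y = X *m Y - Y *m X. Proof. by []. Qed.

(** [ad_term a b] is the invariant tensor with the bracket with [Z] applied to
    its right factor, acting in degrees [a] and [b]. *)
Let ad_term a b : V := \sum_t X_ a (cl t) (X_ b (c (cr t) Z) v).

Let casimir_z : V := \sum_t X_ n (c (cl t) (c (cr t) Z)) v.
Let trace_z : V := X_ n (Z + (\tr Z)%:M) v.

Let finsum_ad_term (w : int -> int) b k0 : (forall k, b < k -> w k = 0) ->
  finsum (fun k => (w k)%:~R *: ad_term k (k0 - k)).
Proof.
move=> w0; have [K hK] := ghat_smooth v; exists (K + absz k0 + absz b).+1 => k hk.
have [kp|kp] := ltP b k; first by rewrite w0 // scale0r.
rewrite /ad_term big1 ?scaler0 // => t _.
by rewrite hK ?(lin_zero (Xl _ _)) //; lia.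
Qed.

(** Invariance of the Casimir tensor. *)
Let ad_term_left a b :
  \sum_t X_ a (c (cl t) Z) (X_ b (cr t) v) = - ad_term a b.
Proof.
apply/eqP; rewrite -addr_eq0 /ad_term -big_split /=.
rewrite (casimir_invariant (g := fun X Y => X_ a X (X_ b Y v))) //.
by move=> X e Y Y'; rewrite XL Xl.
Qed.

Let ad_term_swap a b : a + b = n -> ad_term a b + ad_term b a =
  casimir_z + (if a == - b then a%:~R * \sum_t \tr (cl t *m c (cr t) Z) else 0) *: v.
Proof.
move=> ab; rewrite -[ad_term b a]opprK -ad_term_left.
rewrite (casimir_sumC (fun X Y => X_ b (c X Z) (X_ a Y v))) /ad_term -sumrB.
rewrite (eq_bigr (fun t => X_ n (c (cl t) (c (cr t) Z)) v
   + (if a == - b then a%:~R * \tr (cl t *m c (cr t) Z) else 0) *: v)); last first.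
  move=> t _; rewrite [X in X - _]ghat_comm ab -cc.
  by rewrite -!addrA addrC -!addrA addNr addr0.
rewrite big_split /= -scaler_suml; congr (_ + _ *: _).
by case: ifP => _; rewrite ?mulr_sumr // big1.
Qed.

Let trace_c0 : \sum_t \tr (cl t *m c (cr t) Z) = 0.
Proof.
have : \sum_t (\tr (c (cl t) Z *m cr t) + \tr (cl t *m c (cr t) Z)) = 0.
  apply: (@casimir_invariant F N F^o (fun X Y => \tr (X *m Y))) => [Y a x y|X a x y].
    by rewrite mulmxDl mxtraceD -scalemxAl mxtraceZ.
  by rewrite mulmxDr mxtraceD -scalemxAr mxtraceZ.
rewrite big_split /= (casimir_sumC (fun X Y => \tr (c X Z *m Y))).
rewrite (eq_bigr (fun t => \tr (cl t *m c (cr t) Z))) => [|t _].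
  by rewrite -mulr2n => /eqP; rewrite mulrn_eq0 /= => /eqP.
exact: mxtrace_mulC.
Qed.

(** Symmetrising an [ad_term] removes its dependence on the individual degrees. *)
Let ad_term_sym a b : a + b = n -> ad_term a b + ad_term b a = casimir_z.
Proof. by move=> ab; rewrite ad_term_swap // trace_c0 mulr0 if_same scale0r addr0. Qed.

Let sugawara_termC k :
  sugawara_term k (X_ n Z v) = X_ n Z (sugawara_term k v)
  + (wt k)%:~R *: (ad_term k (n - k) - ad_term (k + n) (- k))
  + (wt k * (if k == n then - n else 0) + wt k * (if k == - n then - n else 0))%:~R *: trace_z.
Proof.
have tr1 : \sum_t \tr (cl t *m Z) *: X_ n (cr t) v = trace_z.
  rewrite /trace_z -casimir_trace (lin_sum (XL n v)).
  by apply: eq_bigr => t _; rewrite (lin_scale (XL n v)).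
have tr2 : \sum_t \tr (cr t *m Z) *: X_ n (cl t) v = trace_z.
  by rewrite -tr1 (casimir_sumC (fun X Y => \tr (X *m Z) *: X_ n Y v)).
rewrite /sugawara_term (lin_scale (Xl n Z)) (lin_sum (Xl n Z)).
rewrite intrD !intrM -mulrDr -scalerA -!scalerDr; congr (_ *: _).
rewrite -[- ad_term _ _]ad_term_left /ad_term.
rewrite -!big_split /=.
have -> : ((if k == n then - n else 0)%:~R + (if k == - n then - n else 0)%:~R) *: trace_z
  = \sum_t (((if k == n then - n else 0)%:~R * \tr (cr t *m Z)) *: X_ k (cl t) v
     + (if k == - n then - n else 0)%:~R * \tr (cl t *m Z) *: X_ (- k) (cr t) v).
  rewrite scalerDl big_split /=; congr (_ + _).
    case: eqP => [->|_]; last by rewrite scale0r big1 // => t _; rewrite mul0r scale0r.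
    by rewrite -tr2 scaler_sumr; apply: eq_bigr => t _; rewrite scalerA.
  case: eqP => [->|_]; last by rewrite scale0r big1 // => t _; rewrite mul0r scale0r.
  by rewrite opprK -tr1 scaler_sumr; apply: eq_bigr => t _; rewrite scalerA.
rewrite -big_split /=; apply: eq_bigr => t _.
rewrite [X_ (- k) _ (X_ n Z _)]ghat_comm !(lin_add (Xl k _)) (lin_scale (Xl k _)).
rewrite [X_ k (cl t) (X_ n Z _)]ghat_comm -!cc.
have -> : n - k = - k + n by rewrite addrC.
have -> : (if - k == - n then (- k)%:~R * \tr (cr t *m Z) else 0)
  = (if k == n then - n else 0)%:~R * \tr (cr t *m Z).
  by rewrite eqr_opp; case: eqP => [->|_] //; rewrite mul0r.
have -> : (if k == - n then k%:~R * \tr (cl t *m Z) else 0)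
  = (if k == - n then - n else 0)%:~R * \tr (cl t *m Z).
  by case: eqP => [->|_] //; rewrite mul0r.
rewrite -!addrA; congr (_ + _); rewrite [RHS]addrCA; congr (_ + _).
by rewrite [LHS]addrCA; congr (_ + _); rewrite addrC.
Qed.

Let wtd (k : int) : int := wt k - wt (k - n).

Let wtd_sym k : wtd (n - k) = wtd k.
Proof. by rewrite /wtd /wt; do ?[case: ifP]; lia. Qed.

Let isum_wtd (x : V) : isum (fun k => (wtd k)%:~R *: x) = (- n * 2)%:~R *: x.
Proof.
have [nm|nm] := leP n 0.
  have [E _] := weight_shift x (absz n).
  have -> : - n * 2 = (absz n)%:Z * 2 by lia.
  rewrite -E; apply: eq_isum => k; rewrite /wtd; congr ((_ - wt _)%:~R *: _).
  by lia.
have [E fs] := weight_shift x (absz n).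
have -> : (- n * 2)%:~R *: x = - ((absz n)%:Z * 2)%:~R *: x.
  by rewrite -intrN; congr (_%:~R *: _); lia.
rewrite scaleNr -E -[LHS](isum_shift n) -scaleN1r (lin_isum (scale_lin _) fs).
apply: eq_isum => k; rewrite scaleN1r -scaleNr -intrN /wtd.
by congr (_%:~R *: _); rewrite addrK opprB; congr (wt _ - _); lia.
Qed.

(** The brackets of [Z] with the two factors of [X(k) Y(-k)] shift the degree of one
    or of the other, and by invariance they cancel up to the differences of weights.
    These are symmetric under [k -> n - k], so that [ad_term_sym] applies
    and leaves [casimir_z]; the central terms leave [trace_z]. The multiples of the
    identity in the two cancel. *)
Lemma sugawara_comm :
  sugawara (X_ n Z v) = X_ n Z (sugawara v) - (2 * N.+1%:R * n%:~R) *: X_ n Z v.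
Proof.
have wt0 k : 0 < k -> wt k = 0 by rewrite /wt; do ?[case: ifP]; lia.
pose G k := ad_term k (n - k).
have fG1 : finsum (fun k => (wt k)%:~R *: G k) by apply: finsum_ad_term wt0.
have fG2 : finsum (fun k => (wt (k - n))%:~R *: G k).
  by apply: (@finsum_ad_term (fun k => wt (k - n)) n) => k hk; apply: wt0; lia.
have fNG2 : finsum (fun k => - ((wt (k - n))%:~R *: G k)).
  by have [K hK] := fG2; exists K => k hk; rewrite hK ?oppr0.
have fG : finsum (fun k => (wtd k)%:~R *: G k).
  have [K hK] := finsumD fG1 fNG2; exists K => k /hK <-.
  by rewrite /wtd intrB scalerBl.
have EG : isum (fun k => (wtd k)%:~R *: G k) =
    isum (fun k => (wt k)%:~R *: (ad_term k (n - k) - ad_term (k + n) (- k))).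
  under eq_isum => k do rewrite /wtd intrB scalerBl.
  rewrite (isumD fG1 fNG2) -(isum_shift n (fun k => - _)) -isumD //.
    apply: eq_isum => k; rewrite scalerBr /G; congr (_ - _ *: ad_term _ _).
      by rewrite addrK.
    by lia.
  exact: (finsum_shift n fNG2).
have fB : finsum (fun k => (wt k)%:~R *: (ad_term k (n - k) - ad_term (k + n) (- k))).
  have [K hK] := finsumD fG1 (finsum_shift n fNG2); exists K => k /hK <-.
  rewrite scalerBr /G; congr (_ - _ *: ad_term _ _); first by rewrite addrK.
  by lia.
pose cw k := wt k * (if k == n then - n else 0) + wt k * (if k == - n then - n else 0).
have fcen : finsum (fun k => (cw k)%:~R *: trace_z).
  exists (absz n).+1 => k hk; rewrite /cw !ifF ?mulr0 ?scale0r //; lia.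
have E1 : sugawara (X_ n Z v) = X_ n Z (sugawara v)
   + isum (fun k => (wtd k)%:~R *: G k) + isum (fun k => (cw k)%:~R *: trace_z).
  have fS := lin_finsum (Xl n Z) (finsum_sugawara v).
  rewrite EG (lin_isum (Xl n Z) (finsum_sugawara v)) -!isumD //; last exact: finsumD.
  by apply: eq_isum => k; rewrite sugawara_termC.
have E2 : isum (fun k => (cw k)%:~R *: trace_z) = (- n * 2)%:~R *: trace_z.
  have f1 e : finsum (fun k => (wt k * (if k == e then - n else 0))%:~R *: trace_z).
    by exists (absz e).+1 => k hk; rewrite ifF ?mulr0 ?scale0r //; lia.
  have i1 e : isum (fun k => (wt k * (if k == e then - n else 0))%:~R *: trace_z)
      = (wt e * - n)%:~R *: trace_z.
    rewrite (@isum_delta _ e) ?eqxx // => k /negPf ->.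
    by rewrite mulr0 scale0r.
  under eq_isum => k do rewrite /cw intrD scalerDl.
  rewrite isumD // !i1 -scalerDl -intrD; congr (_%:~R *: _).
  by rewrite /wt; do ?[case: ifP]; lia.
have E3 : 2 *: isum (fun k => (wtd k)%:~R *: G k) = (- n * 2)%:~R *: casimir_z.
  rewrite -isum_wtd scaler_nat mulr2n -{2}(isum_refl n) -isumD //.
    apply: eq_isum => k; rewrite wtd_sym -scalerDr /G subKr ad_term_sym //.
    by rewrite addrC subrK.
  exact: (finsum_refl n fG).
have two0 : (2 : F) != 0 by rewrite pnatr_eq0.
apply: (scalerI two0); rewrite E1 E2 -addrA !scalerDr E3; congr (_ + _).
rewrite /casimir_z /trace_z -(lin_sum (XL n v)) casimir_ad.
rewrite scalerN !scalerA -scaleNr -!(lin_scale (XL n v)) -(lin_add (XL n v)).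
congr (X_ n _ v); apply/matrixP => i j; rewrite !mxE.
rewrite !intrM !intrN -[N.+1]addn1 natrD.
by ring.
Qed.

End Commutator.

Let br (n m : int) (X Y : 'M[F]_N) : 'M[F]_N := X *m Y - Y *m X.
Let co (n m : int) (X Y : 'M[F]_N) : F :=
  if n == - m then n%:~R * \tr (X *m Y) else 0.

Lemma ghat_modeC n m X Y (v : V) :
  X_ n X (X_ m Y v) - X_ m Y (X_ n X v) = X_ (n + m) (br n m X Y) v + co n m X Y *: v.
Proof. by rewrite ghat_mode_comm center1. Qed.

(** On the top the Sugawara operator is the Casimir operator, a scalar by Schur's
    lemma; suitably normalised it is a grading operator by [sugawara_comm]. *)
Lemma gl_top_projection (f : W -> V) : top_hom f -> (forall w, f w = 0 -> w = 0) ->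
  exists pi : V -> W,
    [/\ linear pi, forall w, pi (f w) = w,
      forall n X v, n < 0 -> pi (X_ n X v) = 0
    & forall X v, pi (X_ 0 X v) = gl_act X (pi v)].
Proof.
move=> [fl f0 fpos fc] finj.
have d0 : 2 * N.+1%:R != 0 :> F by rewrite mulf_neq0 // pnatr_eq0.
set d := 2 * N.+1%:R in d0.
pose D v := d^-1 *: sugawara v.
pose Cas w : W := d^-1 *: \sum_t gl_act (cl t) (gl_act (cr t) w).
have Wl X : linear (@gl_act F N W X) := gl_act_linear X.
have WL w : linear (fun X => @gl_act F N W X w) := gl_act_linear_l w.
have gl_comm X Y w : @gl_act F N W X (gl_act Y w)
    = gl_act Y (gl_act X w) + gl_act (X *m Y - Y *m X) w.
  by rewrite -gl_act_comm addrC subrK.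
have Casl : linear Cas.
  move=> c x y; rewrite /Cas scalerA mulrC -scalerA -scalerDr; congr (_ *: _).
  by rewrite scaler_sumr -big_split /=; apply: eq_bigr => t _; rewrite Wl Wl.
have CasX X w : Cas (gl_act X w) = gl_act X (Cas w).
  rewrite /Cas (lin_scale (Wl X)) (lin_sum (Wl X)); congr (_ *: _).
  apply/eqP; rewrite -subr_eq0 -sumrB.
  rewrite (eq_bigr (fun t => gl_act (cl t *m X - X *m cl t) (gl_act (cr t) w)
     + gl_act (cl t) (gl_act (cr t *m X - X *m cr t) w))); last first.
    move=> t _; rewrite [gl_act (cr t) (gl_act X w)]gl_comm (lin_add (Wl _)).
    by rewrite gl_comm -!addrA addrC -!addrA addNr addr0.
  rewrite (casimir_invariant (g := fun X Y => gl_act X (gl_act Y w))) //.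
  by move=> Y c x y; rewrite WL Wl.
have [c cE] := schur hW Casl CasX.
have [w0 nw0] := hW.1.
apply: (@top_projection F _ V W X_ br co Xl ghat_modeC _ f _ fl fpos f0 finj _ ghat_irr D c).
- by move=> n m X Y nm; rewrite /co ifF //; lia.
- by exists w0; apply/eqP.
- by move=> a x y; rewrite /D sugawara_lin scalerDr !scalerA mulrC.
- move=> w; rewrite -(lin_scale fl) -cE /D /Cas (lin_scale fl) (lin_sum fl).
  congr (_ *: _); rewrite /sugawara (@isum_delta _ 0) => [|k k0].
    rewrite /sugawara_term scale1r; apply: eq_bigr => t _.
    by rewrite oppr0 !f0.
  rewrite /sugawara_term /wt (negPf k0); case: ifP => k0'; last by rewrite scale0r.
  rewrite big1 ?scaler0 // => t _; rewrite fpos ?(lin_zero (Xl _ _)) //; lia.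
move=> n X v _; rewrite /D sugawara_comm (lin_scale (Xl n X)) scalerBr !scalerA mulrA.
by rewrite mulVf // mul1r.
Qed.

End SmoothAffine.

(** The trace in the adjoint of the zero modes reflects the action on the dual of
    [W], which is twisted by the trace. *)
Theorem gl_contragredient (F : numClosedFieldType) (N : nat) (W : gl_module F N)
    (V V' : ghat_module F N) :
  gl_simple W -> is_Lgl W V -> is_Lgl (gl_dual W) V' ->
  exists B : V -> V' -> F, [/\ bilinear_pairing B, nondegenerate_pairing B
    & forall n X v v', B (ghat_mode n X v) v'
        = B v ((if n == 0 then \tr X else 0) *: v' - ghat_mode (- n) X v')].
Proof.
move=> hW hV hV'; have hW' := gl_dual_simple hW.
have [f [ft finj]] := Lgl_top hW hV; have [f' [ft' finj']] := Lgl_top hW' hV'.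
have [pi [pil pif pineg pi0]] := gl_top_projection hW hV ft finj.
have [pi' [pil' pif' pineg' pi0']] := gl_top_projection hW' hV' ft' finj'.
have [fl f0 fpos _] := ft; have [fl' f0' fpos' _] := ft'.
pose A' (n : int) (X : 'M[F]_N) (v : V') : V' :=
  (if n == 0 then \tr X else 0) *: v - ghat_mode (- n) X v.
have Xl' n X : linear (@ghat_mode F N V' n X) := ghat_mode_linear n X.
have XL' n v : linear (fun X => @ghat_mode F N V' n X v) := ghat_mode_linear_l n v.
have A'l n X : linear (A' n X).
  move=> c u v; rewrite /A' Xl' scalerDr !scalerBr !scalerA [_ * c]mulrC.
  by rewrite opprD addrACA.
pose rho' (X : 'M[F]_N) (w : gl_dual W) : gl_dual W := \tr X *: w - gl_act X w.
apply: (@contragredient_form F _ V V' W (gl_dual W) (@ghat_mode F N V) A' _ _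
  (fun n X => ghat_mode_linear n X) A'l (ghat_modeC hW hV) _ f f' _ rho'
  fpos _ _ (ghat_irr hW hV) _ pi pi' pil pil' pif pif' pineg _ pi0
  (fun w (phi : 'Hom(W, F^o)) => phi w)).
- move=> n m X Y v; rewrite /A' !scalerBr !(lin_sub (Xl' _ _)) !(lin_scale (Xl' _ _)).
  have := ghat_modeC hW' hV' (- m) (- n) Y X v.
  set a := ghat_mode (- m) Y _; set b := ghat_mode (- n) X _ => abE.
  have four (p q r a' b' : V') : p - q - (r - a') - (p - r - (q - b')) = a' - b'.
    have sub3 x y z t : x - y - (z - t) = x - y - z + t :> V'.
      by rewrite opprB addrA addrAC.
    by rewrite (sub3 p q r) (sub3 p r q) opprD addrACA [p - r - q]addrAC subrr add0r.
  rewrite !scalerA [_ * (if n == 0 then _ else _)]mulrC four abE; congr (_ + _ *: _).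
    have -> : - m - n = - (n + m) by rewrite opprD addrC.
    case: ifP => _; rewrite ?raddfB /= ?[\tr (Y *m X)]mxtrace_mulC ?subrr scale0r sub0r;
      by rewrite -(lin_opp (XL' _ _)) opprB.
  rewrite opprK [n == _]eq_sym; case: eqP => // <-.
  by rewrite mxtrace_mulC.
- move=> n X w n0; rewrite /A' ifF ?scale0r ?fpos' ?subrr //; lia.
- move=> X w; rewrite /A' eqxx oppr0 f0' /rho' (lin_sub fl') (lin_scale fl') //.
- move=> S sS SA; apply: (ghat_irr hW' hV') => // n X v Sv.
  have := SA (- n) X v Sv; rewrite /A' opprK => SAv.
  have := sS.2 (-1) _ _ SAv (sS.2 (if - n == 0 then \tr X else 0) _ _ Sv sS.1).
  by rewrite addr0 scaleN1r opprB subrK.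
- move=> n X v n0; rewrite /A' ifF ?scale0r ?sub0r ?(lin_opp pil') ?pineg' ?oppr0 //; lia.
- split=> [phi c x y|w c phi psi]; first by rewrite linearP.
  by rewrite add_lfunE scale_lfunE.
- move=> X w phi; rewrite /rho' add_lfunE opp_lfunE scale_lfunE gl_dual_actE.
  by rewrite opprB addrC subrK.
have [[w nw] _] := hW; apply: contrapT => h; move/eqP: nw; apply.
apply: functional_separates => phi; apply: contrapT => phiw; apply: h.
by exists w, phi.
Qed.

(** * The adjoint of the Sugawara field *)

Definition mode_field (F : fieldType) (N : nat) (V : ghat_module F N) (X : 'M[F]_N) :
  fseries V := of_modes (fun n => ghat_mode n X).

Arguments mode_field {F N} V X _ _.

Lemma omega_glE (F : fieldType) (N : nat) (V : ghat_module F N) :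
  @omega_gl F N V = (2 * N.+1%:R)^-1 *:
     \sum_t nop (mode_field V (@casimir_l F N t)) (mode_field V (@casimir_r F N t))
  + 2^-1 *: fder (mode_field V 1%:M).
Proof.
by rewrite (casimir_sum (fun X Y => nop (mode_field V X) (mode_field V Y))).
Qed.

Section SugawaraAdjoint.
Variables (F : numFieldType) (N : nat) (V V' : ghat_module F N) (B : V -> V' -> F).
Hypotheses (fV : forall X, is_field (mode_field V X)).
Hypotheses (fV' : forall X, is_field (mode_field V' X)).
Hypothesis center1' : forall v : V', ghat_center v = v.
Hypothesis Bb : bilinear_pairing B.
Hypothesis BX : forall n X v v', B (ghat_mode n X v) v'
  = B v ((if n == 0 then \tr X else 0) *: v' - ghat_mode (- n) X v').

Local Notation cl := (@casimir_l F N).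
Local Notation cr := (@casimir_r F N).

Lemma is_field_omega_gl : is_field (@omega_gl F N V).
Proof.
rewrite omega_glE; apply: is_fieldD; apply: is_fieldZ.
  by apply: is_field_sum => t; apply: is_field_nop.
exact: is_field_fder.
Qed.

Lemma fadj_mode X :
  fadj B (- 2) (mode_field V X) (pole (\tr X) - mode_field V' X).
Proof.
move=> k v v'; rewrite /mode_field /of_modes BX; congr (B v _).
rewrite fserD fserN poleE; congr (_ - ghat_mode _ _ _); last by lia.
have -> : (- k - 1 == 0) = (- 2 - k == -1) by lia.
by case: ifP; rewrite ?scale0r.
Qed.

Let quad (W : ghat_module F N) : fseries W :=
  \sum_t nop (mode_field W (cl t)) (mode_field W (cr t)).

Arguments quad : clear implicits.

(** The corrections come from the scalar [tr X] in the adjoint of [X(z)] and from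
    the coefficient that changes sides in the normal ordering. The commutators of
    the latter add up to zero over the Casimir tensor. *)
Lemma quad_adjoint e v v' : B (quad V e v) v'
  = B v (quad V' (- 4 - e) v' - (2 * N.+1%:R) *: mode_field V' 1%:M (- 3 - e) v'
         + (if e == -2 then N%:R * N.+1%:R else 0) *: v').
Proof.
have lin_mode e' X : linear (mode_field V' X e') by exact: (fV' X).1.
have XL e' w : linear (fun X => mode_field V' X e' w).
  by move=> c X Y; rewrite /mode_field /of_modes ghat_mode_linear_l.
have fa X : is_field (pole (\tr X) - mode_field V' X).
  by apply: is_fieldD; [exact: is_field_pole|exact: is_fieldN].
rewrite /quad fser_sum (lin_sum (pair_linl Bb v')).
transitivity (\sum_t B v (nop (mode_field V' (cl t)) (mode_field V' (cr t)) (- 4 - e) v'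
    - mode_field V' (\tr (cl t) *: cr t) (- 3 - e) v'
    - mode_field V' (\tr (cr t) *: cl t) (- 3 - e) v'
    + (if e == -2 then \tr (cl t) * \tr (cr t) else 0) *: v'
    + mode_field V' (cl t *m cr t - cr t *m cl t) (- 3 - e) v')).
  apply: eq_bigr => t _.
  rewrite (fadj_nop Bb (m := 1) (t := - 2) (fV _) (fV _) (fa _) (fa _)
    (fadj_mode _) (fadj_mode _)); congr (B v _).
  rewrite big_ord1 -[nat_of_ord ord0]/0%N -[(0.+1)%N%:Z]/(1 : int); set e' := - 2 - 2 - e.
  have -> : - 3 - e = e' + 1 by rewrite /e'; lia.
  have -> : (e == -2) = (e' + 1 == -1) by rewrite /e'; lia.
  set X := cl t; set Y := cr t; congr (_ + _).
    rewrite nopDl ?nop_polel; [|exact: fa|exact: is_field_pole|exact: is_fieldN|exact: fa].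
    rewrite nopNl // nopDr ?nopNr ?nop_poler //;
      [|exact: is_field_pole|exact: is_fieldN].
    rewrite fserD poleE fserN scalerDr scalerN opprD opprK.
    rewrite !(lin_scale (XL _ _)).
    have -> : \tr X *: (if e' + 1 == -1 then \tr Y *: v' else 0)
      = (if e' + 1 == -1 then \tr X * \tr Y else 0) *: v'.
      by case: ifP; rewrite ?scalerA ?scaler0 ?scale0r.
    by rewrite [LHS](AC (2*2) (4*2*3*1)).
  have poleY u : pole (\tr Y) (e' + 1) u = (if e' + 1 == -1 then \tr Y else 0) *: u.
    by rewrite poleE; case: ifP; rewrite ?scale0r.
  have poleX u : (pole (\tr X) - mode_field V' X) (- 1) u
    = \tr X *: u - mode_field V' X (- 1) u by rewrite fserD fserN poleE eqxx.
  rewrite !poleX (lin_sub ((fa Y).1 _)) (lin_scale ((fa Y).1 _)) opprB.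
  rewrite [LHS](AC (2*2) ((1*4)*(3*2))) /= subrr add0r !fserD !fserN !poleY.
  rewrite (lin_sub (lin_mode _ _)) (lin_scale (lin_mode _ _)) opprB.
  rewrite [LHS](AC (2*2) ((1*4)*(3*2))) /= subrr add0r /mode_field /of_modes.
  have := ghat_mode_comm (- (- 1) - 1) (- (e' + 1) - 1) X Y v'.
  rewrite center1' => ->.
  rewrite (_ : - (- 1) - 1 = 0 :> int) // mul0r if_same scale0r addr0.
  by congr (ghat_mode _ _ _); lia.
rewrite -(lin_sum (pair_linr Bb v)); congr (B v _).
do 4!rewrite big_split /=; rewrite !sumrN -!(lin_sum (XL _ _)).
rewrite (fser_sum _ _ (fun t => nop (mode_field V' (cl t)) (mode_field V' (cr t)))).
rewrite -!addrA; congr (_ + _).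
have tr1 : \sum_t \tr (cl t) *: cr t = N.+1%:R *: 1%:M.
  have := casimir_trace (1%:M : 'M[F]_N); rewrite mxtrace1.
  under eq_bigr do rewrite mulmx1.
  move=> ->; rewrite -(scalemx1 N N%:R) -[X in X + _]scale1r -scalerDl.
  by rewrite -[N.+1]add1n natrD.
have tr2 : \sum_t \tr (cr t) *: cl t = N.+1%:R *: 1%:M.
  by rewrite -tr1 (casimir_sumC (fun X Y => \tr X *: Y)).
have tr3 : \sum_t \tr (cl t) * \tr (cr t) = N%:R * N.+1%:R :> F.
  have := congr1 mxtrace tr1; rewrite raddf_sum /= mxtraceZ mxtrace1 mulrC => <-.
  by apply: eq_bigr => t _; rewrite mxtraceZ.
have com0 : \sum_t (cl t *m cr t - cr t *m cl t) = 0.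
  by rewrite sumrB (casimir_sumC (fun X Y => X *m Y)) subrr.
rewrite tr1 tr2 com0 (lin_zero (XL _ _)) addr0 -scaler_suml addrA; congr (_ + _ *: _).
  by rewrite (lin_scale (XL _ _)) -opprD -scalerDl [2 * _]mulr_natl mulr2n.
by case: ifP => _; rewrite ?tr3 // big1.
Qed.

(** The terms in [I] and the scalars that [quad_adjoint] leaves are cancelled by
    those that arise from the derivative of [I(z)]. *)
Lemma fadj_omega_gl : fadj B (- 4) (@omega_gl F N V) (@omega_gl F N V').
Proof.
move=> e v v'; rewrite !omega_glE !fserD !fserZ !fderE -!/(quad _).
rewrite !(lin_add (pair_linl Bb _), lin_scale (pair_linl Bb _)) quad_adjoint fadj_mode.
rewrite -!(lin_scale (pair_linr Bb v), lin_add (pair_linr Bb v)); congr (B v _).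
have n0 : N.+1%:R != 0 :> F by rewrite pnatr_eq0.
have t0 : (2 : F) != 0 by rewrite pnatr_eq0.
rewrite !scalerDr -!addrA; congr (_ + _).
rewrite fserN poleE mxtrace1.
have -> : - 2 - (e + 1) = - 3 - e by lia.
have -> : - 4 + (- e + 1) = - 3 - e by lia.
have -> : (- 3 - e == -1) = (e == -2) by lia.
set x := mode_field _ _ _ _.
have -> : (if e == -2 then N%:R *: v' else 0) = (if e == -2 then N%:R else 0) *: v'.
  by case: ifP; rewrite ?scale0r.
rewrite !scalerN !scalerA mulVf ?mulf_neq0 // scale1r.
rewrite [LHS](AC (1*(1*2)) ((2*3)*(1*4))) /= -scalerDl.
have -> : (2 * N.+1%:R)^-1 * (if e == -2 then N%:R * N.+1%:R else 0)
    + 2^-1 * (e + 1)%:~R * (if e == -2 then N%:R else 0) = 0 :> F.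
  case: eqP => [->|_]; last by rewrite !mulr0 addr0.
  by field; rewrite addrC natr1.
rewrite scale0r add0r -[- x]scaleN1r -scaleNr -scalerDl; congr (_ *: _).
have -> : - 3 - e = - (e + 1) - 2 by lia.
rewrite [RHS]mulrC intrB intrN.
by field.
Qed.

End SugawaraAdjoint.

(** * Exponentials of formal series *)

Definition nonneg (F : fieldType) (V : lmodType F) (a : fseries V) : Prop :=
  forall e x, e < 0 -> a e x = 0.

(** The Euler operator [z d/dz]. *)
Definition theta (F : fieldType) (V : lmodType F) (a : fseries V) : fseries V :=
  fun e x => e%:~R *: a e x.

Section NonnegProducts.
Variables (F : fieldType) (V : lmodType F).
Implicit Types a b X : fseries V.

Lemma finsum_nonneg a b e x : (forall i, linear (a i)) -> nonneg a -> nonneg b ->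
  finsum (fun i => a i (b (e - i) x)).
Proof.
move=> al ap bp; exists (absz e).+1 => i hi; have [i0|i0] := ltP i 0; first exact: ap.
by rewrite bp ?(lin_zero (al _)) //; lia.
Qed.

Lemma nonneg_fmul a b : (forall i, linear (a i)) -> nonneg a -> nonneg b ->
  nonneg (fmul a b).
Proof.
move=> al ap bp e x e0; rewrite fmulE isum0 // => i.
have [i0|i0] := ltP i 0; first exact: ap.
by rewrite bp ?(lin_zero (al _)) //; lia.
Qed.

Lemma fmul_lin a b : (forall i, linear (a i)) -> (forall i, linear (b i)) ->
  nonneg a -> nonneg b -> forall e, linear (fmul a b e).
Proof.
move=> al bl ap bp e c x y; rewrite !fmulE.
rewrite -(@isum_linear _ _ c (fun i => a i (b (e - i) (c *: x + y)))) //.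
- by move=> i; rewrite bl al.
- exact: (finsum_nonneg e x al ap bp).
exact: (finsum_nonneg e y al ap bp).
Qed.

Lemma theta_fmul a b e x : (forall i, linear (a i)) -> nonneg a -> nonneg b ->
  theta (fmul a b) e x = fmul (theta a) b e x + fmul a (theta b) e x.
Proof.
move=> al ap bp; have fab := finsum_nonneg e x al ap bp.
rewrite !fmulE /theta fmulE (lin_isum (scale_lin _) fab) -isumD.
- apply: eq_isum => i; rewrite (lin_scale (al i)) -scalerDl -intrD.
  by rewrite [i + _]addrC subrK.
- by have [K hK] := fab; exists K => i hi; rewrite hK ?scaler0.
by have [K hK] := fab; exists K => i hi; rewrite (lin_scale (al i)) hK ?scaler0.
Qed.

Lemma fmul_swap a b X e x :
  (forall i, linear (a i)) -> (forall i, linear (b i)) -> nonneg a -> nonneg b ->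
  nonneg X -> fcomm a b -> fmul a (fmul b X) e x = fmul b (fmul a X) e x.
Proof.
move=> al bl ap bp Xp ab.
have out i j : (i < - (absz e).+1%:Z) || ((absz e).+1%:Z <= i)
    \/ (j < - (absz e).+1%:Z) || ((absz e).+1%:Z <= j) -> a i (b j (X (e - i - j) x)) = 0.
  move=> h; have [i0|i0] := ltP i 0; first exact: ap.
  have [j0|j0] := ltP j 0; first by rewrite bp ?(lin_zero (al _)).
  by rewrite Xp ?(lin_zero (bl _)) ?(lin_zero (al _)) //; lia.
transitivity (isum (fun i => isum (fun j => a i (b j (X (e - i - j) x))))).
  apply: eq_isum => i; rewrite fmulE (lin_isum (al i)) //.
  exact: (finsum_nonneg (e - i) x bl bp Xp).
rewrite (@exchange_isum _ _ (absz e).+1 (absz e).+1) => [|i j h|i j h].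
- apply: eq_isum => j; rewrite fmulE (lin_isum (bl j)); last exact: (finsum_nonneg (e - j) x al ap Xp).
  by apply: eq_isum => i; rewrite ab addrAC.
- by apply: out; left.
by apply: out; right.
Qed.

End NonnegProducts.

Section Exponential.
Variables (F : numFieldType) (V : lmodType F) (a : fseries V).
Hypothesis al : forall i, linear (a i).
Hypothesis apos : forall i x, i <= 0 -> a i x = 0.
Hypothesis aC : fcomm a a.

Let ap : nonneg a. Proof. by move=> e x e0; apply: apos; exact: ltW. Qed.

Let P k : fseries V := iter k (fmul a) (@fone F V).

Let PS k : P k.+1 = fmul a (P k). Proof. by []. Qed.

Let Pl k e : linear (P k e).
Proof.
suff [] : (forall e, linear (P k e)) /\ nonneg (P k) by [].
elim: k => [|k [IH1 IH2]]; last first.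
  by rewrite PS; split; [exact: fmul_lin|exact: nonneg_fmul].
split=> [{}e c x y|{}e x e0]; rewrite /P /= /fone; last by rewrite ifF //; lia.
by case: ifP; rewrite ?scaler0 ?addr0.
Qed.

Let P_small k e x : e < k%:Z -> P k e x = 0.
Proof.
elim: k e x => [|k IH] e x ek; first by rewrite /P /= /fone ifF //; lia.
rewrite PS fmulE isum0 // => i; have [i0|i0] := leP i 0; first exact: apos.
by rewrite IH ?(lin_zero (al _)) //; lia.
Qed.

Let Pp k : nonneg (P k).
Proof. by move=> e x e0; apply: P_small; lia. Qed.

Let tl i : linear (theta a i).
Proof. by move=> c x y; rewrite /theta al scalerDr !scalerA mulrC. Qed.

Let tp : nonneg (theta a).
Proof. by move=> e x e0; rewrite /theta ap // scaler0. Qed.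

Let P_euler k e x : theta (P k.+1) e x = k.+1%:R *: fmul (theta a) (P k) e x.
Proof.
elim: k e x => [|k IH] e x.
  rewrite PS theta_fmul // -[RHS]scale1r scalerA mulr1 scale1r.
  rewrite [X in _ + X](_ : _ = 0) ?addr0 // fmulE isum0 // => i.
  rewrite /theta /P /= /fone; case: eqP => [->|_]; last by rewrite scaler0 (lin_zero (al _)).
  by rewrite scale0r (lin_zero (al _)).
rewrite PS theta_fmul // [in X in _ + X]fmulE.
under [X in _ + X]eq_isum => i do rewrite IH (lin_scale (al i)).
rewrite -(lin_isum (scale_lin _)); last first.
  by apply: finsum_nonneg => //; exact: nonneg_fmul.
rewrite -[isum _]/(fmul a (fmul (theta a) (P k)) e x) fmul_swap //; last first.
  by move=> i j y; rewrite /theta (lin_scale (al i)) aC.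
by rewrite -PS -{1}[fmul _ _ e x]scale1r -scalerDl -(natrD _ 1%N) add1n.
Qed.

Let E : fseries V := fexp a.

Let E_big K e x : e < K%:Z -> E e x = \sum_(0 <= k < K) (k`!%:R : F)^-1 *: P k e x.
Proof.
move=> eK; rewrite /E /fexp big_mkord (fsbig_ord _ _ (fun k => (k`!%:R : F)^-1 *: P k e x)).
apply/esym/fsbig_widen => // k [_ /= /negP kK].
by rewrite /= -/(P k) P_small ?scaler0 //; lia.
Qed.

Lemma fexp_lin e : linear (E e).
Proof.
move=> c x y; have eK : e < (absz e).+1%:Z by lia.
rewrite !(E_big _ eK) scaler_sumr -big_split /=; apply: eq_bigr => k _.
by rewrite Pl scalerDr !scalerA mulrC.
Qed.

Lemma fexp_neg : nonneg E.
Proof. by move=> e x e0; rewrite (@E_big 0) ?big_geq //; lia. Qed.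

Lemma fexp0 x : E 0 x = x.
Proof. by rewrite (@E_big 1) // big_nat1 /P /= /fone eqxx invr1 scale1r. Qed.

(** The Euler operator multiplies an exponential by that of its exponent. This
    determines the coefficients recursively, and everything else on exponentials
    follows from it by induction. *)
Lemma fexp_recursion e x : e%:~R *: E e x = isum (fun i => i%:~R *: a i (E (e - i) x)).
Proof.
have eK : e < (absz e).+2%:Z by lia.
rewrite (E_big _ eK) scaler_sumr big_nat_recl //.
rewrite [X in X + _](_ : _ = 0) ?add0r; last first.
  by rewrite /P /= /fone; case: eqP => [->|_]; rewrite ?scale0r ?scaler0.
transitivity (\sum_(0 <= k < (absz e).+1) (k`!%:R : F)^-1 *: fmul (theta a) (P k) e x).
  apply: eq_bigr => k _; rewrite scalerA mulrC -scalerA.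
  rewrite -[_ *: P k.+1 e x]/(theta (P k.+1) e x) P_euler scalerA factS natrM invfM.
  by rewrite mulrAC mulVf ?mul1r // pnatr_eq0.
have fk k : finsum (fun i => (k`!%:R : F)^-1 *: theta a i (P k (e - i) x)).
  apply: (lin_finsum (scale_lin _)).
  by apply: finsum_nonneg.
transitivity (\sum_(0 <= k < (absz e).+1)
    isum (fun i => (k`!%:R : F)^-1 *: theta a i (P k (e - i) x))).
  apply: eq_bigr => k _; rewrite fmulE (lin_isum (scale_lin _)) //.
  exact: (finsum_nonneg e x tl tp (@Pp k)).
rewrite -isum_split_sum //; apply: eq_isum => i; have [i0|i0] := leP i 0.
  rewrite apos // scaler0 big1 // => k _; rewrite /theta apos // !scaler0 //.
rewrite (@E_big (absz e).+1) ?(lin_sum (al i)) ?scaler_sumr; last by lia.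
apply: eq_bigr => k _; rewrite (lin_scale (al i)) /theta !scalerA mulrC //.
Qed.

Lemma fexp_finsum e x : finsum (fun i => i%:~R *: a i (E (e - i) x)).
Proof. by apply: (finsum_nonneg (a := theta a)) => //; exact: fexp_neg. Qed.

Lemma fexp_ind (Q : int -> Prop) :
  (forall e, e <= 0 -> Q e) ->
  (forall e, 0 < e -> (forall i, 0 < i -> Q (e - i)) -> Q e) -> forall e, Q e.
Proof.
move=> Q0 QS e; have [n en] := ubnP (absz e); elim: n e en => // n IH e en.
have [e0|e0] := leP e 0; first exact: Q0.
apply: QS => // i i0; have [ei|ei] := leP (e - i) 0; first exact: Q0.
by apply: IH; lia.
Qed.

Lemma fexp_comm (T : V -> V) : linear T -> (forall i x, T (a i x) = a i (T x)) ->
  forall e x, T (E e x) = E e (T x).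
Proof.
move=> Tl Ta; apply: fexp_ind => [e e0|e e0 IH] x.
  have [->|ne] := eqVneq e 0; first by rewrite !fexp0.
  by rewrite !fexp_neg ?(lin_zero Tl) //; lia.
have en : e%:~R != 0 :> F by rewrite intr_eq0; lia.
apply: (scalerI en); rewrite -(lin_scale Tl) !fexp_recursion (lin_isum Tl (fexp_finsum _ _)).
apply: eq_isum => i; have [i0|i0] := leP i 0.
  by rewrite !apos ?scaler0 ?(lin_zero Tl).
by rewrite (lin_scale Tl) Ta IH.
Qed.

(** A derivation acts on an exponential through its exponent: here the commutator
    of [T] with the exponent is [r z^j]. *)
Lemma fexp_der (T : V -> V) (j : int) (r : F) : 0 < j -> linear T ->
  (forall i x, T (a i x) = a i (T x) + (if i == j then r else 0) *: x) ->
  forall e x, T (E e x) = E e (T x) + r *: E (e - j) x.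
Proof.
move=> j0 Tl Ta; apply: fexp_ind => [e e0|e e0 IH] x.
  rewrite [E (e - j) x]fexp_neg ?scaler0 ?addr0; last by lia.
  have [->|ne] := eqVneq e 0; first by rewrite !fexp0.
  by rewrite !fexp_neg ?(lin_zero Tl) //; lia.
have en : e%:~R != 0 :> F by rewrite intr_eq0; lia.
have f1 := fexp_finsum e (T x).
have f2 : finsum (fun i => r *: (i%:~R *: a i (E (e - j - i) x))).
  exact: (lin_finsum (scale_lin r) (fexp_finsum (e - j) x)).
have d0 i : i != j -> (i%:~R * (if i == j then r else 0)) *: E (e - i) x = 0.
  by move/negPf => ->; rewrite mulr0 scale0r.
have f3 : finsum (fun i => (i%:~R * (if i == j then r else 0)) *: E (e - i) x).
  by exists (absz j).+1 => i hi; apply: d0; lia.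
apply: (scalerI en); rewrite -(lin_scale Tl) fexp_recursion (lin_isum Tl (fexp_finsum _ _)).
transitivity (isum (fun i => i%:~R *: a i (E (e - i) (T x))
    + r *: (i%:~R *: a i (E (e - j - i) x))
    + (i%:~R * (if i == j then r else 0)) *: E (e - i) x)).
  apply: eq_isum => i; have [i0|i0] := leP i 0.
    rewrite !apos // !scaler0 (lin_zero Tl) !add0r d0 //; lia.
  rewrite (lin_scale Tl) Ta IH // (lin_add (al i)) (lin_scale (al i)) !scalerDr !scalerA.
  by rewrite [r * _]mulrC [e - i - j]addrAC.
rewrite isumD // ?isumD //; last exact: finsumD.
rewrite (isum_delta d0) eqxx -(lin_isum (scale_lin r) (fexp_finsum _ _)).
rewrite -!fexp_recursion scalerDr -addrA; congr (_ + _).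
rewrite !scalerA -scalerDl intrB; congr (_ *: _); ring.
Qed.

End Exponential.

Lemma fexp_adj (F : numFieldType) (M M' : lmodType F) (B : M -> M' -> F)
    (a : fseries M) (a' : fseries M') : bilinear_pairing B ->
  (forall i, linear (a i)) -> (forall i x, i <= 0 -> a i x = 0) -> fcomm a a ->
  (forall i, linear (a' i)) -> (forall i x, i <= 0 -> a' i x = 0) -> fcomm a' a' ->
  (forall i, adj B (a i) (a' i)) -> forall e, adj B (fexp a e) (fexp a' e).
Proof.
move=> Bb al ap aC al' ap' aC' aa; apply: fexp_ind => [e e0|e e0 IH] x y.
  have [->|ne] := eqVneq e 0; first by rewrite !fexp0.
  have el : e < 0 by lia.
  by rewrite !fexp_neg ?(lin_zero (pair_linl Bb _)) ?(lin_zero (pair_linr Bb _)).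
have en : e%:~R != 0 :> F by rewrite intr_eq0; lia.
apply: (mulfI en).
rewrite -[LHS](lin_scale (pair_linl Bb y)) -[RHS](lin_scale (pair_linr Bb x)).
rewrite !fexp_recursion // (lin_isum (pair_linl Bb y)); last exact: fexp_finsum.
rewrite (lin_isum (pair_linr Bb x)); last exact: fexp_finsum.
apply: eq_isum => i; have [i0|i0] := leP i 0.
  by rewrite ap // ap' // !scaler0 (lin_zero (pair_linl Bb _)) (lin_zero (pair_linr Bb _)).
rewrite (lin_scale (pair_linl Bb _)) (lin_scale (pair_linr Bb _)).
apply: (congr1 ( *%R i%:~R)).
by rewrite aa IH //; congr (B x _); apply/esym/fexp_comm.
Qed.

(** The series [a(1/z)]. *)
Definition fflip (F : fieldType) (V : lmodType F) (a : fseries V) : fseries V :=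
  fun e => a (- e).

Lemma fexp_flip (F : fieldType) (V : lmodType F) (a : fseries V) e x :
  fexp (fflip a) e x = fexp a (- e) x.
Proof.
suff h k : iter k (fmul (fflip a)) (@fone F V) = fflip (iter k (fmul a) (@fone F V)).
  by rewrite /fexp; apply: eq_fsbigr => k _; rewrite h.
elim: k => [|k IH] /=.
  by apply/funext => i; apply/funext => y; rewrite /fflip /fone oppr_eq0.
rewrite IH; apply/funext => i; apply/funext => y.
rewrite /fflip !fmulE -[LHS](isum_refl 0); apply: eq_isum => j.
by rewrite sub0r opprK; congr (a _ (iter _ _ _ _ _)); lia.
Qed.

(** * Heisenberg modules and the Fock space *)

(** What the calculus of vertex operators uses of the Fock space. The induction
    principle [h_ind] starts from the vectors killed by the [u^p_(i)], [i > 0], since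
    on these the annihilating half of a vertex operator is trivial. *)
Record heisenberg_module (F : numFieldType) (N : nat) := HeisenbergModule {
  hs :> lmodType F;
  hu : 'I_N -> int -> hs -> hs;
  hv : 'I_N -> int -> hs -> hs;
  hq : qexpo N -> hs -> hs;
  hu_lin : forall p i, linear (hu p i);
  hv_lin : forall p i, linear (hv p i);
  hq_lin : forall r, linear (hq r);
  hu0 : forall p x, hu p 0 x = 0;
  huC : forall p q i j x, hu p i (hu q j x) = hu q j (hu p i x);
  hvu : forall p q i j x, hv p i (hu q j x)
    = hu q j (hv p i x) + (if (i == - j) && (p == q) then i%:~R else 0) *: x;
  huq : forall p i r x, hu p i (hq r x) = hq r (hu p i x);
  hvq : forall p i r x, hv p i (hq r x)
    = hq r (hv p i x) + (if i == 0 then (r p)%:~R else 0) *: hq r x;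
  h_ind : forall S : set hs, subspace S ->
    (forall x, (forall p k, hu p k.+1%:Z x = 0) -> S x) ->
    (forall p k x, S x -> S (hu p (Negz k) x)) ->
    (forall p k x, S x -> S (hv p (Negz k) x)) -> forall x, S x;
  h_smooth : forall x, exists K : nat, forall j : int, K%:Z <= j ->
    forall p, hu p j x = 0 /\ hv p j x = 0 }.

Section Heisenberg.
Variables (F : numFieldType) (N : nat) (H : lmodType F).

Local Notation hvar := (hvar N).
Local Notation qexpo := (qexpo N).

(** The Fock space enters through its basis, the products of [q^s] and a monomial
    [m], on which multiplications and derivations have a simple form. *)
Variables (bas : qexpo -> {cmonom hvar} -> H).
Variables (vmul vder : hvar -> H -> H) (qmul : qexpo -> H -> H) (qder : 'I_N -> H -> H).
Hypotheses (vmul_lin : forall x, linear (vmul x)) (vder_lin : forall x, linear (vder x)).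
Hypotheses (qmul_lin : forall r, linear (qmul r)) (qder_lin : forall p, linear (qder p)).
Variable gamma : 'I_N -> F.
Hypothesis vmulE : forall x s m, vmul x (bas s m) = bas s (mulcm (ucm x) m).
Hypothesis vderE : forall x s m,
  vder x (bas s m) = (m x)%:R *: bas s (divcm m (ucm x)).
Hypothesis qmulE : forall r s m, qmul r (bas s m) = bas (r + s) m.
Hypothesis qderE : forall p s m,
  qder p (bas s m) = (gamma p + (s p)%:~R) *: bas s m.
Hypothesis bas_span : forall S : set H, subspace S -> (forall s m, S (bas s m)) ->
  forall x, S x.

Let ext (f g : H -> H) : linear f -> linear g ->
  (forall s m, f (bas s m) = g (bas s m)) -> forall x, f x = g x.
Proof.
move=> fl gl fg; apply: (bas_span (S := [set x | f x = g x])) => //.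
split=> [|c x y hx hy] /=; first by rewrite (lin_zero fl) (lin_zero gl).
by rewrite fl gl hx hy.
Qed.

Let basD s (m m' : {cmonom hvar}) : (forall z, m z = m' z) -> bas s m = bas s m'.
Proof. by move=> h; congr bas; apply/eqP/cmP. Qed.

Let umode (p : 'I_N) (j : int) : H -> H :=
  match j with
  | Negz k => k.+1%:R *: vmul (inl (p, k))
  | Posz 0 => 0
  | Posz k.+1 => vder (inr (p, k))
  end.

Let vmode (p : 'I_N) (j : int) : H -> H :=
  match j with
  | Negz k => k.+1%:R *: vmul (inr (p, k))
  | Posz 0 => qder p
  | Posz k.+1 => vder (inl (p, k))
  end.

Let umodeN p k x : umode p (Negz k) x = k.+1%:R *: vmul (inl (p, k)) x.
Proof. by []. Qed.
Let umode0 p x : umode p 0 x = 0. Proof. by []. Qed.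
Let umodeP p k : umode p k.+1%:Z = vder (inr (p, k)). Proof. by []. Qed.
Let vmodeN p k x : vmode p (Negz k) x = k.+1%:R *: vmul (inr (p, k)) x.
Proof. by []. Qed.
Let vmode0 p : vmode p 0 = qder p. Proof. by []. Qed.
Let vmodeP p k : vmode p k.+1%:Z = vder (inl (p, k)). Proof. by []. Qed.

Let umode_lin p i : linear (umode p i).
Proof.
case: i => [[|k]|k]; first by move=> c x y; rewrite !umode0 scaler0 addr0.
  exact: vder_lin.
by move=> c x y; rewrite !umodeN vmul_lin scalerDr !scalerA mulrC.
Qed.

Let vmode_lin p i : linear (vmode p i).
Proof.
case: i => [[|k]|k]; [exact: qder_lin|exact: vder_lin|].
by move=> c x y; rewrite !vmodeN vmul_lin scalerDr !scalerA mulrC.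
Qed.

Let vmulC x y a : vmul x (vmul y a) = vmul y (vmul x a).
Proof.
move: a; apply: (ext (f := vmul x \o vmul y) (g := vmul y \o vmul x)).
- by apply: lin_comp; apply: vmul_lin.
- by apply: lin_comp; apply: vmul_lin.
move=> s m /=.
rewrite !vmulE.
by apply: basD => z; rewrite !mulcmE addnCA.
Qed.

Let vderC x y a : vder x (vder y a) = vder y (vder x a).
Proof.
move: a; apply: (ext (f := vder x \o vder y) (g := vder y \o vder x)).
- by apply: lin_comp; apply: vder_lin.
- by apply: lin_comp; apply: vder_lin.
move=> s m /=; rewrite !vderE !(lin_scale (vder_lin _)) !vderE !scalerA.
rewrite -!natrM !divcmE !ucmE; congr (_ %:R *: _); last first.
  by apply: basD => z; rewrite !divcmE subnAC.
have [->|xy] := eqVneq x y; first by [].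
by rewrite !subn0 mulnC.
Qed.

Let vder_vmul x y a : vder x (vmul y a) = vmul y (vder x a) + (x == y)%:R *: a.
Proof.
move: a; apply: (ext (f := vder x \o vmul y) (g := fun a => vmul y (vder x a) + (x == y)%:R *: a)).
- exact: lin_comp (vder_lin x) (vmul_lin y).
- move=> c u w; rewrite vder_lin vmul_lin !scalerDr !scalerA [_ * c]mulrC.
  by rewrite addrACA.
move=> s m /=; rewrite vmulE !vderE (lin_scale (vmul_lin _)) vmulE mulcmE ucmE.
have [->|xy] := eqVneq x y.
  rewrite add1n scale1r.
  rewrite ucm_mulK; case: (posnP (m y)) => [->|my].
    by rewrite scale0r add0r scale1r.
  by rewrite (ucm_divK my) -[m y]/(m y : nat) -natr1 scalerDl scale1r.
rewrite add0n scale0r addr0; congr (_ *: _).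
apply: basD => z; rewrite divcmE !mulcmE divcmE !ucmE.
have [<-|xz] := eqVneq x z; last by rewrite !subn0.
by rewrite eq_sym (negPf xy).
Qed.

Let qmul_vmul r x a : vmul x (qmul r a) = qmul r (vmul x a).
Proof.
move: a; apply: (ext (f := vmul x \o qmul r) (g := qmul r \o vmul x)).
- exact: lin_comp (vmul_lin x) (qmul_lin r).
- exact: lin_comp (qmul_lin r) (vmul_lin x).
by move=> s m /=; rewrite vmulE !qmulE vmulE.
Qed.

Let qmul_vder r x a : vder x (qmul r a) = qmul r (vder x a).
Proof.
move: a; apply: (ext (f := vder x \o qmul r) (g := qmul r \o vder x)).
- exact: lin_comp (vder_lin x) (qmul_lin r).
- exact: lin_comp (qmul_lin r) (vder_lin x).
by move=> s m /=; rewrite vderE qmulE (lin_scale (qmul_lin _)) vderE qmulE.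
Qed.

Let qder_vmul p x a : qder p (vmul x a) = vmul x (qder p a).
Proof.
move: a; apply: (ext (f := qder p \o vmul x) (g := vmul x \o qder p)).
- exact: lin_comp (qder_lin p) (vmul_lin x).
- exact: lin_comp (vmul_lin x) (qder_lin p).
by move=> s m /=; rewrite vmulE !qderE (lin_scale (vmul_lin _)) vmulE.
Qed.

Let qder_vder p x a : qder p (vder x a) = vder x (qder p a).
Proof.
move: a; apply: (ext (f := qder p \o vder x) (g := vder x \o qder p)).
- exact: lin_comp (qder_lin p) (vder_lin x).
- exact: lin_comp (vder_lin x) (qder_lin p).
move=> s m /=; rewrite vderE !qderE (lin_scale (vder_lin _)) (lin_scale (qder_lin _)).
by rewrite vderE qderE !scalerA mulrC.
Qed.

Let qder_qmul p r a :
  qder p (qmul r a) = qmul r (qder p a) + (r p)%:~R *: qmul r a.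
Proof.
move: a; apply: (ext (f := qder p \o qmul r)
  (g := fun a => qmul r (qder p a) + (r p)%:~R *: qmul r a)).
- exact: lin_comp (qder_lin p) (qmul_lin r).
- move=> c u w; rewrite qder_lin !qmul_lin !scalerDr !scalerA [_ * c]mulrC.
  by rewrite addrACA.
move=> s m /=; rewrite qmulE !qderE (lin_scale (qmul_lin _)) qmulE -scalerDl ffunE.
by congr (_ *: _); rewrite intrD; ring.
Qed.

Let umodeC p q i j a : umode p i (umode q j a) = umode q j (umode p i a).
Proof.
case: i => [[|k]|k]; rewrite ?umode0 ?(lin_zero (umode_lin _ _)) //.
  case: j => [[|l]|l]; rewrite ?umode0 ?(lin_zero (umode_lin _ _)) //.
    exact: vderC.
  by rewrite !umodeN !umodeP (lin_scale (vder_lin _)) vder_vmul scale0r addr0.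
case: j => [[|l]|l]; rewrite ?umode0 ?(lin_zero (umode_lin _ _)) //.
  by rewrite !umodeN !umodeP (lin_scale (vder_lin _)) vder_vmul scale0r addr0.
by rewrite !umodeN !(lin_scale (vmul_lin _)) !scalerA mulrC vmulC.
Qed.

Let vmode_umode p q i j a : vmode p i (umode q j a)
  = umode q j (vmode p i a) + (if (i == - j) && (p == q) then i%:~R else 0) *: a.
Proof.
case: j => [[|l]|l].
- rewrite !umode0 (lin_zero (vmode_lin _ _)) oppr0 add0r.
  by case: (eqVneq i 0) => [->|_]; rewrite ?if_same ?scale0r.
- case: i => [[|k]|k].
  + by rewrite vmode0 umodeP qder_vder /= scale0r addr0.
  + by rewrite vmodeP umodeP vderC /= scale0r addr0.
  rewrite !vmodeN !umodeP (lin_scale (vder_lin _)) vder_vmul scalerDr -addrA.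
  rewrite [X in _ + X](_ : _ = 0) ?addr0 // scalerA -scalerDl.
  rewrite (_ : (inr (q, l) == inr (p, k) :> hvar) = (Negz k == - l.+1%:Z) && (p == q)).
    case: ifP => _; last by rewrite mulr0 addr0 scale0r.
    by rewrite mulr1 NegzE mulrNz addrN scale0r.
  rewrite -[LHS]/((q, l) == (p, k)) xpair_eqE NegzE eqr_opp [q == p]eq_sym andbC.
  by rewrite [l == k]eq_sym.
case: i => [[|k]|k].
- by rewrite vmode0 umodeN (lin_scale (qder_lin _)) qder_vmul /= scale0r addr0.
- rewrite vmodeP !umodeN (lin_scale (vder_lin _)) vder_vmul scalerDr scalerA.
  congr (_ + _ *: _).
  rewrite (_ : (inl (p, k) == inl (q, l) :> hvar) = (k.+1%:Z == - Negz l) && (p == q)).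
    case: eqP => [->|_] /=; last by rewrite mulr0.
    by rewrite NegzE opprK; case: ifP => _; rewrite ?mulr1 ?mulr0.
  rewrite -[LHS]/((p, k) == (q, l)) xpair_eqE NegzE opprK andbC.
  by [].
rewrite !vmodeN !umodeN !(lin_scale (vmul_lin _)) vmulC !scalerA mulrC /=.
by rewrite scale0r addr0.
Qed.

Let umode_qmul p i r a : umode p i (qmul r a) = qmul r (umode p i a).
Proof.
case: i => [[|k]|k].
- by rewrite !umode0 (lin_zero (qmul_lin _)).
- exact: qmul_vder.
by rewrite !umodeN qmul_vmul (lin_scale (qmul_lin _)).
Qed.

Let vmode_qmul p i r a : vmode p i (qmul r a)
  = qmul r (vmode p i a) + (if i == 0 then (r p)%:~R else 0) *: qmul r a.
Proof.
case: i => [[|k]|k]; rewrite ?scale0r ?addr0.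
- exact: qder_qmul.
- exact: qmul_vder.
by rewrite !vmodeN qmul_vmul (lin_scale (qmul_lin _)).
Qed.

Let fock_induction (S : set H) : subspace S ->
  (forall s, S (bas s (onecm hvar))) ->
  (forall p k x, S x -> S (umode p (Negz k) x)) ->
  (forall p k x, S x -> S (vmode p (Negz k) x)) -> forall x, S x.
Proof.
move=> sS S1 Su Sv.
have SZ c x : S x -> S (c *: x) by move=> Sx; rewrite -[_ *: _]addr0; apply: sS.2 => //; exact: sS.1.
have Sb s m : S (bas s m).
  have [n] := ubnP (mdeg m); elim: n s m => // n IH s m mn.
  have [->|m1] := eqVneq m (onecm hvar); first exact: S1.
  have [y my] : exists y, (0 < m y)%N.
    apply: contrapT => h; move/eqP: m1; apply; apply/eqP/cmP => y; rewrite onecmE.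
    by apply/eqP; rewrite -leqn0 leqNgt; apply/negP => my; apply: h; exists y.
  have mE := esym (ucm_divK my).
  have Sm : S (bas s (divcm m (ucm y))).
    have dm : mdeg m = (mdeg (ucm y) + mdeg (divcm m (ucm y)))%N.
      by rewrite {1}mE; exact: mdegM.
    by apply: IH; rewrite dm (mdegU y) in mn.
  rewrite mE -vmulE; case: y {my mE} Sm => -[p k] Sm.
    have := SZ (k.+1%:R)^-1 _ (Su p k _ Sm).
    by rewrite umodeN scalerA mulVf ?scale1r // pnatr_eq0.
  have := SZ (k.+1%:R)^-1 _ (Sv p k _ Sm).
  by rewrite vmodeN scalerA mulVf ?scale1r // pnatr_eq0.
exact: bas_span.
Qed.

Let vder_onecm x s : vder x (bas s (onecm hvar)) = 0.
Proof. by rewrite vderE onecmE scale0r. Qed.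

Let uv_smooth x : exists K : nat, forall j : int, K%:Z <= j ->
  forall q, umode q j x = 0 /\ vmode q j x = 0.
Proof.
move: x; apply: (fock_induction (S := [set x | exists K : nat, forall j : int, K%:Z <= j ->
    forall q, umode q j x = 0 /\ vmode q j x = 0])).
- split=> [|c u v [K hK] [L hL]].
    by exists 0%N => j _ q; rewrite (lin_zero (umode_lin _ _)) (lin_zero (vmode_lin _ _)).
  exists (maxn K L) => j hj q; rewrite umode_lin vmode_lin.
  have [-> ->] := hK j ltac:(lia) q; have [-> ->] := hL j ltac:(lia) q.
  by rewrite scaler0 addr0.
- move=> s; exists 1%N => -[[|j]|j] // _ q; split; exact: vder_onecm.
- move=> q k x [K hK]; exists (K + k).+2 => j hj q'.
  have [h1 h2] := hK j ltac:(lia) q'.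
  rewrite umodeC vmode_umode h1 h2 (lin_zero (umode_lin _ _)) ifF ?scale0r ?addr0 //.
  by apply/negP => /andP [/eqP jk _]; lia.
move=> q k x [K hK]; exists (K + k).+2 => j hj q'.
have [h1 h2] := hK j ltac:(lia) q'.
have := vmode_umode q q' (Negz k) j x; rewrite h1 (lin_zero (vmode_lin _ _)).
rewrite ifF; last by apply/negP => /andP [/eqP jk _]; lia.
rewrite scale0r addr0 => <-; split=> //.
rewrite vmodeN; case: j hj h2 {h1} => [[|j]|j] // hj h2.
rewrite vmodeP (lin_scale (vder_lin _)) vder_vmul scale0r addr0.
by rewrite -vmodeP h2 (lin_zero (vmul_lin _)) scaler0.
Qed.

Let vacuum_induction (S : set H) : subspace S ->
  (forall x, (forall p k, umode p k.+1%:Z x = 0) -> S x) ->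
  (forall p k x, S x -> S (umode p (Negz k) x)) ->
  (forall p k x, S x -> S (vmode p (Negz k) x)) -> forall x, S x.
Proof.
move=> sS S0 Su Sv; apply: fock_induction => // s; apply: S0 => p k.
exact: vder_onecm.
Qed.

Definition heisenberg_of_basis : heisenberg_module F N :=
  @HeisenbergModule F N H umode vmode qmul umode_lin vmode_lin qmul_lin umode0
    umodeC vmode_umode umode_qmul vmode_qmul vacuum_induction uv_smooth.

End Heisenberg.

Section FockModule.
Variables (F : numFieldType) (N : nat) (gamma : 'I_N -> F).

Lemma fock_span (S : set (Fock F N)) : subspace S ->
  (forall s m, S << (s, m) >>) -> forall x, S x.
Proof. by move=> sS Sb; apply: malg_ind => // -[s m]; exact: Sb. Qed.

Definition fock_module : heisenberg_module F N :=
  @heisenberg_of_basis F N (Fock F N) (fun s m => << (s, m) >>)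
    (@var_mul F N) (@var_der F N) (@q_mul F N) (@q_der F N gamma)
    (fun x => mlin_is_linear _) (fun x => mlin_is_linear _)
    (fun x => mlin_is_linear _) (fun x => mlin_is_linear _) gamma
    (fun x s m => mlinU _ _) (fun x s m => mlinU _ _) (fun r s m => mlinU _ _)
    (fun p s m => mlinU _ _) fock_span.

End FockModule.

(** * The form on the Fock space *)

Section FockWeights.
Variables (F : numFieldType) (N : nat).
Local Notation hvar := (hvar N).
Local Notation cm := {cmonom hvar}.

(** The variable dual to a given one: [u_(p,j)] and [v_(p,j)] are exchanged. *)
Definition hswap (x : hvar) : hvar :=
  match x with inl y => inr y | inr y => inl y end.

Definition hdeg (x : hvar) : nat := match x with inl y => y.2.+1 | inr y => y.2.+1 end.

Lemma hswapK : involutive hswap. Proof. by case. Qed.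

Definition cswap (m : cm) : cm :=
  mkcmonom [fsfun x in [fset hswap y | y in finsupp m]%fset => m (hswap x) | 0%N].

Lemma cswapE m x : cswap m x = m (hswap x).
Proof.
rewrite cmE /= fsfunE; case: ifP => // /negbT xm.
apply/esym/eqP; rewrite cmE_eq0; apply: contraNN xm => xm.
by apply/imfsetP; exists (hswap x) => //; rewrite hswapK.
Qed.

Lemma cswapK : involutive cswap.
Proof. by move=> m; apply/eqP/cmP => x; rewrite !cswapE hswapK. Qed.

(** Makes multiplication by [j u_(p,j)] adjoint to the derivative in [v_(p,j)]. *)
Definition var_weight (x : hvar) (n : nat) : F := n`!%:R / (hdeg x)%:R ^+ n.

Definition cweight (m : cm) : F := \prod_(x <- finsupp m) var_weight x (m x).

Lemma var_weight_neq0 x n : var_weight x n != 0.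
Proof.
rewrite mulf_neq0 // ?invr_eq0 ?expf_neq0 ?pnatr_eq0 //; first by rewrite -lt0n fact_gt0.
by case: x.
Qed.

Lemma cweight_neq0 m : cweight m != 0.
Proof. by rewrite /cweight prodf_seq_neq0; apply/allP => x _; exact: var_weight_neq0. Qed.

Lemma cweightE (m : cm) (D : {fset hvar}) : (finsupp m `<=` D)%fset ->
  cweight m = \prod_(x <- D) var_weight x (m x).
Proof.
move=> mD; apply: big_fset_incl => // x _; rewrite -cmE_eq0 => /eqP ->.
by rewrite /var_weight expr0 divr1.
Qed.

Lemma cweight_ucm x m :
  cweight (mulcm (ucm x) m) = (m x).+1%:R / (hdeg x)%:R * cweight m.
Proof.
pose D := (x |` finsupp m)%fset.
have mD : (finsupp m `<=` D)%fset by apply: fsubsetUr.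
have xD : x \in D by rewrite !inE eqxx.
have xmD : (finsupp (mulcm (ucm x) m) `<=` D)%fset.
  apply/fsubsetP => y; rewrite -cmE_neq0 mulcmE ucmE !inE -cmE_neq0 [y == x]eq_sym.
  by case: (x == y).
rewrite (cweightE mD) (cweightE xmD) (bigD1_seq x) ?fset_uniq //=.
rewrite [in RHS](bigD1_seq x) ?fset_uniq //= mulrA; congr (_ * _).
  rewrite mulcmE ucmE eqxx add1n /var_weight factS exprS natrM invfM.
  by rewrite [LHS](AC (2*2) ((1*3)*(2*4))).
by apply: eq_bigr => y /negPf yx; rewrite mulcmE ucmE eq_sym yx add0n.
Qed.

Lemma hdeg_neq0 x : (hdeg x)%:R != 0 :> F.
Proof. by rewrite pnatr_eq0; case: x. Qed.

Section Form.
Variable (H : lmodType F).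
Variables (bas : qexpo N -> cm -> H) (coef : qexpo N -> cm -> H -> F).
Variables (vmul vder : hvar -> H -> H) (qmul : qexpo N -> H -> H) (qder : 'I_N -> H -> H).
Hypotheses (vmul_lin : forall x, linear (vmul x)) (vder_lin : forall x, linear (vder x)).
Hypotheses (qmul_lin : forall r, linear (qmul r)) (qder_lin : forall p, linear (qder p)).
Variable gamma : 'I_N -> F.
Hypothesis vmulE : forall x s m, vmul x (bas s m) = bas s (mulcm (ucm x) m).
Hypothesis vderE : forall x s m,
  vder x (bas s m) = (m x)%:R *: bas s (divcm m (ucm x)).
Hypothesis qmulE : forall r s m, qmul r (bas s m) = bas (r + s) m.
Hypothesis qderE : forall p s m,
  qder p (bas s m) = (gamma p + (s p)%:~R) *: bas s m.
Hypothesis bas_span : forall S : set H, subspace S -> (forall s m, S (bas s m)) ->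
  forall x, S x.
Hypothesis coef_lin : forall s m, linear (coef s m : H -> F^o).
Hypothesis coefE : forall s m s' m', coef s m (bas s' m') = ((s' == s) && (m' == m))%:R.
Hypothesis coef_inj : forall x, (forall s m, coef s m x = 0) -> x = 0.
Variable B : H -> H -> F.
Hypothesis B_linl : forall y, linear (B^~ y : H -> F^o).
Hypothesis BE : forall s m y, B (bas s m) y = cweight m * coef s (cswap m) y.

Let B_linr x : linear (B x : H -> F^o).
Proof.
move=> c y z; rewrite -[RHS]/(c * B x y + B x z); move: x.
apply: (bas_span (S := [set x | B x (c *: y + z) = c * B x y + B x z])).
  split=> [|e u w hu hw] /=; rewrite ?(lin_zero (B_linl _)) ?mulr0 ?addr0 //.
  by rewrite !B_linl hu hw /GRing.scale /=; ring.
by move=> s m /=; rewrite !BE coef_lin /GRing.scale /=; ring.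
Qed.

Let B_bilinear : bilinear_pairing B.
Proof. by split=> [y c u v|x c u v]; [rewrite B_linl|rewrite B_linr]. Qed.

Let B_nondegenerate : nondegenerate_pairing B.
Proof.
split=> [x h|y h]; apply: coef_inj => s m.
  have key z : B z (bas s (cswap m)) = cweight m * coef s m z.
    apply: (bas_span (S := [set z | B z (bas s (cswap m)) = cweight m * coef s m z])).
      split=> [|e u w hu hw] /=.
        by rewrite (lin_zero (B_linl _)) (lin_zero (coef_lin _ _)) mulr0.
      by rewrite B_linl coef_lin hu hw /GRing.scale /=; ring.
    move=> s' m' /=; rewrite BE !coefE (inj_eq (can_inj cswapK)).
    rewrite [s' == s]eq_sym [m' == m]eq_sym.
    by case: (eqVneq m m') => [->|_]; rewrite ?andbF ?mulr0.
  have := key x; rewrite h => /esym/eqP.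
  by rewrite mulf_eq0 (negPf (cweight_neq0 m)) /= => /eqP.
have := h (bas s (cswap m)); rewrite BE cswapK => /eqP.
by rewrite mulf_eq0 (negPf (cweight_neq0 _)) /= => /eqP.
Qed.

Let adj_ext (T T' : H -> H) : linear T -> linear T' ->
  (forall s m s' m', B (T (bas s m)) (bas s' m') = B (bas s m) (T' (bas s' m'))) ->
  adj B T T'.
Proof.
move=> Tl Tl' h x y; move: x.
apply: (bas_span (S := [set x | B (T x) y = B x (T' y)])) => [|s m /=].
  split=> [|e u w hu hw] /=; first by rewrite (lin_zero Tl) !(lin_zero (B_linl _)).
  by rewrite Tl !B_linl hu hw.
move: y; apply: (bas_span (S := [set y | B (T (bas s m)) y = B (bas s m) (T' y)])).
  2: by move=> s' m'; exact: h.
split=> [|e u w hu hw] /=; first by rewrite (lin_zero Tl') !(lin_zero (B_linr _)).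
by rewrite Tl' !B_linr hu hw.
Qed.

Let cswap_ucm x (m : cm) : cswap (mulcm (ucm x) m) = mulcm (ucm (hswap x)) (cswap m).
Proof.
apply/eqP/cmP => y; rewrite cswapE !mulcmE cswapE !ucmE; congr (_ + _)%N.
by rewrite -(inj_eq (can_inj hswapK)) hswapK.
Qed.

Let mulcm_inj (x : hvar) : injective (@mulcm hvar (ucm x)).
Proof. by move=> m m' h; rewrite -(ucm_mulK m x) h ucm_mulK. Qed.

Let adj_vmul x : adj B (fun a => (hdeg x)%:R *: vmul x a) (vder (hswap x)).
Proof.
apply: adj_ext => // [c u v|s m s' m'].
  by rewrite vmul_lin scalerDr !scalerA mulrC.
rewrite vmulE (lin_scale (B_linl _)) vderE (lin_scale (B_linr _)) !BE !coefE cswap_ucm.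
rewrite /GRing.scale /= cweight_ucm !mulrA [(hdeg x)%:R * _]mulrC mulfK ?hdeg_neq0 //.
case: (posnP (m' (hswap x))) => [m0|mp].
  rewrite m0 !mul0r; case: eqP => [_|]; rewrite ?mulr0 //=.
  case: eqP => [mE|]; rewrite ?mulr0 //.
  by move: m0; rewrite mE mulcmE ucmE eqxx.
have -> : (m' == mulcm (ucm (hswap x)) (cswap m))
    = (divcm m' (ucm (hswap x)) == cswap m).
  by rewrite -{1}(ucm_divK mp) (inj_eq (@mulcm_inj _)).
case: eqP => [_|]; rewrite ?mulr0 //=; case: eqP => [mE|]; rewrite ?mulr0 //.
by rewrite -(ucm_divK mp) mE mulcmE ucmE eqxx add1n cswapE hswapK.
Qed.

Let adj_vder x : adj B (vder x) (fun a => (hdeg x)%:R *: vmul (hswap x) a).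
Proof.
apply: adj_ext => // [c u v|s m s' m'].
  by rewrite vmul_lin scalerDr !scalerA mulrC.
rewrite vmulE (lin_scale (B_linr _)) vderE (lin_scale (B_linl _)) !BE !coefE.
rewrite /GRing.scale /=; case: (posnP (m x)) => [m0|mp].
  rewrite m0 mul0r; case: eqP => [_|]; rewrite ?mulr0 //=.
  case: eqP => [mE|]; rewrite ?mulr0 //.
  have := congr1 (fun m => cmonom_val m (hswap x)) mE.
  by rewrite /= mulcmE ucmE eqxx cswapE hswapK m0.
set m1 := divcm m (ucm x); rewrite -(ucm_divK mp) -/m1 cswap_ucm (inj_eq (@mulcm_inj _)).
rewrite cweight_ucm mulcmE ucmE eqxx add1n.
by rewrite !mulrA [(hdeg x)%:R * _]mulrC mulfK ?hdeg_neq0.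
Qed.

Let adj_qmul r : adj B (qmul r) (qmul (- r)).
Proof.
apply: adj_ext => // s m s' m'; rewrite !qmulE !BE !coefE; congr (_ * (_ && _)%:R).
by apply/eqP/eqP => [->|<-]; rewrite ?addKr ?addNKr.
Qed.

Let adj_qder p : adj B (qder p) (qder p).
Proof.
apply: adj_ext => // s m s' m'; rewrite !qderE (lin_scale (B_linr _)) (lin_scale (B_linl _)).
rewrite !BE !coefE; case: eqP => [->|_] //=.
by rewrite !mulr0 !scaler0.
Qed.

Lemma basis_form :
  [/\ bilinear_pairing B, nondegenerate_pairing B, forall r, adj B (qmul r) (qmul (- r)),
      forall p, adj B (qder p) (qder p)
    & forall x, adj B (fun a => (hdeg x)%:R *: vmul x a) (vder (hswap x))
             /\ adj B (vder x) (fun a => (hdeg x)%:R *: vmul (hswap x) a)].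
Proof. by split. Qed.

End Form.
End FockWeights.

Lemma fock_contragredient (F : numFieldType) (N : nat) (gamma : 'I_N -> F) :
  exists B : Fock F N -> Fock F N -> F,
    [/\ bilinear_pairing B, nondegenerate_pairing B,
        forall r, adj B (@q_mul F N r) (@q_mul F N (- r)),
        forall p i, adj B (@u_mode F N p i) (@u_mode F N p (- i))
      & forall p i, adj B (@v_mode F N gamma p i) (@v_mode F N gamma p (- i))].
Proof.
pose B (a b : Fock F N) : F^o :=
  mlin (fun k : qexpo N * {cmonom hvar N} => cweight F k.2 * b@_(k.1, cswap k.2) : F^o) a.
have BE s m y : B << (s, m) >> y = cweight F m * y@_(s, cswap m).
  by rewrite /B mlinU.
have [] := @basis_form F N (Fock F N) (fun s m => << (s, m) >>) (fun s m a => a@_(s, m))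
    (@var_mul F N) (@var_der F N) (@q_mul F N) (@q_der F N gamma)
    (fun x => mlin_is_linear _) (fun x => mlin_is_linear _)
    (fun x => mlin_is_linear _) (fun x => mlin_is_linear _) gamma
    (fun x s m => mlinU _ _) (fun x s m => mlinU _ _) (fun r s m => mlinU _ _)
    (fun p s m => mlinU _ _) (@fock_span F N) _ _ _ B (fun y => mlin_is_linear _) BE.
- by move=> s m c x y; rewrite mcoeffD mcoeffZ.
- by move=> s m s' m'; rewrite mcoeffU -mulr_natr mul1r -xpair_eqE.
- by move=> x h; apply/malgP => -[s m]; rewrite h mcoeff0.
move=> Bb Bn Bq Bd Bv; exists B; split=> // p [[|k]|k].
- by move=> x y; rewrite (lin_zero (pair_linl Bb _)) (lin_zero (pair_linr Bb _)).
- exact: (Bv (inr (p, k))).2.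
- exact: (Bv (inl (p, k))).1.
- exact: Bd.
- exact: (Bv (inl (p, k))).2.
exact: (Bv (inr (p, k))).1.
Qed.

(** * Vertex operators *)

Section VertexOperator.
Variables (F : numFieldType) (N : nat) (h : heisenberg_module F N).
Implicit Types (r : qexpo N) (p q : 'I_N).

Definition hYp r : fseries h := fun e =>
  if 0 < e then \sum_(p < N) ((r p)%:~R / e%:~R) *: hu p (- e) else 0.

Definition hYm r : fseries h := fun e =>
  if e < 0 then - \sum_(p < N) ((r p)%:~R / (- e)%:~R) *: hu p (- e) else 0.

Definition hY r : fseries h := fun e =>
  hq r \o fmul (fexp (hYp r)) (fexp (hYm r)) e.

(** In terms of [1/z] the annihilating exponent has positive exponents only, so that
    the results on exponentials apply to it as well. *)
Definition hYa r : fseries h := fflip (hYm r).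

Lemma hYpE r e x : hYp r e x =
  if 0 < e then \sum_(p < N) ((r p)%:~R / e%:~R) *: hu p (- e) x else 0.
Proof. by rewrite /hYp; case: ifP => // _; rewrite fct_sumE. Qed.

Lemma hYaE r e x : hYa r e x =
  if 0 < e then - \sum_(p < N) ((r p)%:~R / e%:~R) *: hu p e x else 0.
Proof.
rewrite /hYa /fflip /hYm oppr_lt0 !opprK; case: ifP => // _.
by rewrite -[LHS]/(- _ x) fct_sumE.
Qed.

Lemma hYp_lin r e : linear (hYp r e).
Proof.
move=> c x y; rewrite !hYpE; case: ifP => _; last by rewrite scaler0 addr0.
rewrite scaler_sumr -big_split /=; apply: eq_bigr => p _.
by rewrite hu_lin scalerDr !scalerA mulrC.
Qed.

Lemma hYa_lin r e : linear (hYa r e).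
Proof.
move=> c x y; rewrite !hYaE; case: ifP => _; last by rewrite scaler0 addr0.
rewrite scalerN -opprD scaler_sumr -big_split /=; congr (- _); apply: eq_bigr => p _.
by rewrite hu_lin scalerDr !scalerA mulrC.
Qed.

Lemma hYp_pos r e x : e <= 0 -> hYp r e x = 0.
Proof. by move=> e0; rewrite hYpE ifF //; lia. Qed.

Lemma hYa_pos r e x : e <= 0 -> hYa r e x = 0.
Proof. by move=> e0; rewrite hYaE ifF //; lia. Qed.

Lemma hYp_comm r (T : h -> h) : linear T ->
  (forall p i x, T (hu p i x) = hu p i (T x)) -> forall i x, T (hYp r i x) = hYp r i (T x).
Proof.
move=> Tl Tu i x; rewrite !hYpE; case: ifP => _; last exact: lin_zero Tl.
by rewrite (lin_sum Tl); apply: eq_bigr => p _; rewrite (lin_scale Tl) Tu.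
Qed.

Lemma hYa_comm r (T : h -> h) : linear T ->
  (forall p i x, T (hu p i x) = hu p i (T x)) -> forall i x, T (hYa r i x) = hYa r i (T x).
Proof.
move=> Tl Tu i x; rewrite !hYaE; case: ifP => _; last exact: lin_zero Tl.
rewrite (lin_opp Tl) (lin_sum Tl); congr (- _).
by apply: eq_bigr => p _; rewrite (lin_scale Tl) Tu.
Qed.

Lemma hYpC r : fcomm (hYp r) (hYp r).
Proof.
move=> i j x; apply: (@hYp_comm r (hYp r i) (hYp_lin r i)) => p k y.
by apply/esym/(@hYp_comm r (hu p k) (hu_lin p k)) => q l z; exact: huC.
Qed.

Lemma hYaC r : fcomm (hYa r) (hYa r).
Proof.
move=> i j x; apply: (@hYa_comm r (hYa r i) (hYa_lin r i)) => p k y.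
by apply/esym/(@hYa_comm r (hu p k) (hu_lin p k)) => q l z; exact: huC.
Qed.

Lemma hYp_v r p j i x : hv p j (hYp r i x) = hYp r i (hv p j x)
  + (if (0 < i) && (i == j) then (r p)%:~R else 0) *: x.
Proof.
rewrite !hYpE; case: (ltP 0 i) => i0 /=; last by rewrite (lin_zero (hv_lin _ _)) scale0r addr0.
rewrite (lin_sum (hv_lin p j)) (eq_bigr (fun q => ((r q)%:~R / i%:~R) *: hu q (- i) (hv p j x)
    + ((r q)%:~R / i%:~R * (if (j == i) && (p == q) then j%:~R else 0)) *: x)); last first.
  by move=> q _; rewrite (lin_scale (hv_lin p j)) hvu scalerDr scalerA opprK.
rewrite big_split /=; congr (_ + _).
rewrite (bigD1 p) //= big1 ?addr0 => [|q /negPf qp].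
  rewrite eqxx andbT [i == j]eq_sym; case: eqP => [->|_]; last by rewrite mulr0.
  by rewrite mulfVK // intr_eq0; lia.
by rewrite [p == q]eq_sym qp andbF mulr0 scale0r.
Qed.

Lemma hYa_v r p j i x : hv p j (hYa r i x) = hYa r i (hv p j x)
  + (if (0 < i) && (i == - j) then (r p)%:~R else 0) *: x.
Proof.
rewrite !hYaE; case: (ltP 0 i) => i0 /=; last by rewrite (lin_zero (hv_lin _ _)) scale0r addr0.
rewrite (lin_opp (hv_lin p j)) (lin_sum (hv_lin p j)).
rewrite (eq_bigr (fun q => ((r q)%:~R / i%:~R) *: hu q i (hv p j x)
    + ((r q)%:~R / i%:~R * (if (j == - i) && (p == q) then j%:~R else 0)) *: x)); last first.
  by move=> q _; rewrite (lin_scale (hv_lin p j)) hvu scalerDr scalerA.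
rewrite big_split /= opprD; congr (_ + _).
rewrite (bigD1 p) //= big1 ?addr0 => [|q /negPf qp].
  rewrite eqxx andbT -scaleNr; have -> : (j == - i) = (i == - j) by lia.
  case: eqP => [ij|_]; last by rewrite mulr0 oppr0.
  have -> : j = - i by lia.
  by rewrite intrN mulrN opprK mulfVK // intr_eq0; lia.
by rewrite [p == q]eq_sym qp andbF mulr0 scale0r.
Qed.

Section FixedCharge.
Variable r : qexpo N.

Let Hp : fseries h := fexp (hYp r).
Let Ga : fseries h := fexp (hYa r).

Let Hl e : linear (Hp e). Proof. exact: fexp_lin (hYp_lin r) (@hYp_pos r) e. Qed.
Let Gl e : linear (Ga e). Proof. exact: fexp_lin (hYa_lin r) (@hYa_pos r) e. Qed.
Let Hn : nonneg Hp. Proof. exact: fexp_neg (hYp_lin r) (@hYp_pos r). Qed.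

Let H_comm (T : h -> h) : linear T -> (forall p i x, T (hu p i x) = hu p i (T x)) ->
  forall e x, T (Hp e x) = Hp e (T x).
Proof.
move=> Tl Tu; apply: (fexp_comm (hYp_lin r) (@hYp_pos r) (hYpC r) Tl).
exact: hYp_comm.
Qed.

Let G_comm (T : h -> h) : linear T -> (forall p i x, T (hu p i x) = hu p i (T x)) ->
  forall e x, T (Ga e x) = Ga e (T x).
Proof.
move=> Tl Tu; apply: (fexp_comm (hYa_lin r) (@hYa_pos r) (hYaC r) Tl).
exact: hYa_comm.
Qed.

Let H_u p i e x : hu p i (Hp e x) = Hp e (hu p i x).
Proof. by apply: H_comm; [exact: hu_lin|move=> *; exact: huC]. Qed.

Let G_u p i e x : hu p i (Ga e x) = Ga e (hu p i x).
Proof. by apply: G_comm; [exact: hu_lin|move=> *; exact: huC]. Qed.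

Let H_vpos p j e x : 0 < j ->
  hv p j (Hp e x) = Hp e (hv p j x) + (r p)%:~R *: Hp (e - j) x.
Proof.
move=> j0; apply: (fexp_der (hYp_lin r) (@hYp_pos r) (hYpC r)) => //; first exact: hv_lin.
move=> i y; rewrite hYp_v; congr (_ + _ *: _); case: eqP => [->|_]; last by rewrite andbF.
by rewrite j0.
Qed.

Let H_vneg p j e x : j <= 0 -> hv p j (Hp e x) = Hp e (hv p j x).
Proof.
move=> j0; apply: (fexp_comm (hYp_lin r) (@hYp_pos r) (hYpC r)); first exact: hv_lin.
by move=> i y; rewrite hYp_v ifF ?scale0r ?addr0 //; lia.
Qed.

Let G_vneg p j e x : j < 0 ->
  hv p j (Ga e x) = Ga e (hv p j x) + (r p)%:~R *: Ga (e + j) x.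
Proof.
move=> j0; rewrite -[X in e + X]opprK.
apply: (fexp_der (hYa_lin r) (@hYa_pos r) (hYaC r)); [by lia|exact: hv_lin|].
move=> i y; rewrite hYa_v; congr (_ + _ *: _); case: eqP => [->|_]; last by rewrite andbF.
by rewrite ifT //; lia.
Qed.

Let G_vpos p j e x : 0 <= j -> hv p j (Ga e x) = Ga e (hv p j x).
Proof.
move=> j0; apply: (fexp_comm (hYa_lin r) (@hYa_pos r) (hYaC r)); first exact: hv_lin.
by move=> i y; rewrite hYa_v ifF ?scale0r ?addr0 //; lia.
Qed.

(** On a vector killed by the annihilating [u]-modes the exponential is the identity;
    a creation mode of [v] changes its exponents by a bounded amount. *)
Let G_bound x : exists K : nat, forall e : int, K%:Z <= e -> Ga e x = 0.
Proof.
move: x; apply: (h_ind (S := [set x | exists K : nat, forall e : int, K%:Z <= e -> Ga e x = 0])).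
- split=> [|c x y [K hK] [L hL]]; first by exists 0%N => e _; exact: lin_zero (Gl e).
  by exists (maxn K L) => e he; rewrite Gl hK ?hL ?scaler0 ?addr0 //; lia.
- move=> x ux; exists 1%N => e he; have en : e%:~R != 0 :> F by rewrite intr_eq0; lia.
  apply: (scalerI en); rewrite scaler0.
  rewrite (fexp_recursion (hYa_lin r) (@hYa_pos r) (hYaC r)) isum0 // => i.
  have -> : hYa r i (Ga (e - i) x) = Ga (e - i) (hYa r i x).
    apply: G_comm; first exact: hYa_lin.
    move=> p k y; apply/esym/(@hYa_comm r (hu p k) (hu_lin p k)) => *; exact: huC.
  rewrite hYaE; case: i => [[|i]|i]; rewrite ?(lin_zero (Gl _)) ?scaler0 //=.
  by rewrite big1 ?oppr0 ?(lin_zero (Gl _)) ?scaler0 // => p _; rewrite ux scaler0.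
- by move=> p k x [K hK]; exists K => e he; rewrite -G_u hK ?(lin_zero (hu_lin _ _)).
move=> p k x [K hK]; exists (K + k.+1)%N => e he.
have := G_vneg p (j := Negz k) e x isT.
rewrite hK ?(lin_zero (hv_lin _ _)); last by lia.
by rewrite hK ?scaler0 ?addr0 //; lia.
Qed.

Lemma hYE e x : hY r e x = hq r (isum (fun i => Hp i (Ga (i - e) x))).
Proof.
rewrite /hY /= fmulE; congr (hq r _); apply: eq_isum => i.
by rewrite /Ga fexp_flip opprB.
Qed.

Let finY e x : finsum (fun i => Hp i (Ga (i - e) x)).
Proof.
have [K hK] := G_bound x; exists (K + absz e).+1 => i hi.
have [i0|i0] := ltP i 0; first exact: Hn.
by rewrite hK ?(lin_zero (Hl _)) //; lia.
Qed.

Lemma hY_finsum e x : finsum (fun i => fexp (hYp r) i (fexp (hYa r) (i - e) x)).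
Proof. exact: finY. Qed.

Lemma hYEr e x :
  hY r e x = isum (fun i => fexp (hYp r) i (fexp (hYa r) (i - e) (hq r x))).
Proof.
rewrite hYE (lin_isum (hq_lin r) (finY e x)); apply: eq_isum => i.
have qu p j (y : h) : hq r (hu p j y) = hu p j (hq r y) by rewrite huq.
by rewrite (H_comm (hq_lin r) qu) (G_comm (hq_lin r) qu).
Qed.

Lemma hY_field : is_field (hY r).
Proof.
split=> [e c x y|x].
  rewrite !hYE -hq_lin; congr (hq r _); apply: isum_linear; try exact: finY.
  by move=> i; rewrite Gl Hl.
have [K hK] := G_bound x; exists K.+1 => e he.
rewrite hYE isum0 ?(lin_zero (hq_lin r)) // => i.
have [i0|i0] := ltP i 0; first exact: Hn.
by rewrite hK ?(lin_zero (Hl _)) //; lia.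
Qed.

Lemma hY_u p i e x : hu p i (hY r e x) = hY r e (hu p i x).
Proof.
rewrite !hYE huq (lin_isum (hu_lin p i) (finY e x)).
by congr (hq r _); apply: eq_isum => k; rewrite H_u G_u.
Qed.

(** The mode [v^p_(j)] interacts with exactly one factor of the vertex operator:
    with one of the two exponentials, or with [q^r] when [j = 0]. *)
Lemma hY_v p j e x : hv p j (hY r e x) = hY r e (hv p j x) + (r p)%:~R *: hY r (e - j) x.
Proof.
rewrite !hYE hvq (lin_isum (hv_lin p j) (finY e x)) -!(lin_scale (hq_lin r)).
have fZ := lin_finsum (scale_lin (r p)%:~R) (finY (e - j) x).
have [j0|j0|j0] := ltgtP j 0.
- rewrite scale0r (lin_zero (hq_lin r)) addr0 -(lin_add (hq_lin r)); congr (hq r _).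
  rewrite (lin_isum (scale_lin _) (finY (e - j) x)) -isumD //.
  apply: eq_isum => i; rewrite H_vneg ?(ltW j0) // G_vneg // (lin_add (Hl i)).
  have -> : i - (e - j) = i - e + j by lia.
  by rewrite (lin_scale (Hl i)).
- rewrite scale0r (lin_zero (hq_lin r)) addr0 -(lin_add (hq_lin r)); congr (hq r _).
  rewrite (lin_isum (scale_lin _) (finY (e - j) x)) -(isum_shift (- j) (fun i => _ *: _)) -isumD //.
    apply: eq_isum => i; rewrite H_vpos // G_vpos ?(ltW j0) //.
    have -> : i + - j - (e - j) = i - e by lia.
    by [].
  exact: (finsum_shift (- j) fZ).
by rewrite j0 subr0; congr (hq r _ + _); apply: eq_isum => i; rewrite H_vneg ?G_vpos.
Qed.

(** The coefficient of [z^(k-1)] in the sum of the [r_p u^p(z)]. *)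
Let U k (y : h) : h := \sum_(p < N) (r p)%:~R *: hu p (- k) y.

Let UE k y : U k y = k%:~R *: hYp r k y + k%:~R *: hYa r (- k) y.
Proof.
rewrite hYpE hYaE /U oppr_gt0; have [k0|k0|->] := ltgtP k 0.
- rewrite scaler0 add0r scalerN -scaleNr scaler_sumr; apply: eq_bigr => p _.
  rewrite scalerA -intrN mulrCA mulfV ?mulr1 // intr_eq0; lia.
- rewrite scaler0 addr0 scaler_sumr; apply: eq_bigr => p _.
  rewrite scalerA mulrCA mulfV ?mulr1 // intr_eq0; lia.
by rewrite !scaler0 addr0 big1 // => p _; rewrite oppr0 hu0 scaler0.
Qed.

Let Z e x := isum (fun i => Hp i (Ga (i - e) x)).

Let hYa_Hp k e y : hYa r k (Hp e y) = Hp e (hYa r k y).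
Proof.
apply: H_comm; first exact: hYa_lin.
by move=> p i z; apply/esym/(@hYa_comm r (hu p i) (hu_lin p i)) => *; exact: huC.
Qed.

Let hYa_Ga k e y : hYa r k (Ga e y) = Ga e (hYa r k y).
Proof.
apply: G_comm; first exact: hYa_lin.
by move=> p i z; apply/esym/(@hYa_comm r (hu p i) (hu_lin p i)) => *; exact: huC.
Qed.

Let hYa_bound x : exists L : nat, forall k : int, L%:Z <= k -> hYa r k x = 0.
Proof.
have [L hL] := h_smooth x; exists L => k hk; rewrite hYaE; case: ifP => // _.
by rewrite big1 ?oppr0 // => p _; rewrite (hL k hk p).1 scaler0.
Qed.

Let der_creation e x : isum (fun i => i%:~R *: Hp i (Ga (i - e) x))
    = isum (fun k => k%:~R *: hYp r k (Z (e - k) x))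
  /\ finsum (fun k => k%:~R *: hYp r k (Z (e - k) x)).
Proof.
have [K hK] := G_bound x; pose M := (K + absz e).+2.
pose g i k : h := k%:~R *: hYp r k (Hp (i - k) (Ga (i - e) x)).
have g0 i k : k <= 0 \/ i < k \/ K%:Z <= i - e -> g i k = 0.
  case=> [k0|[ik|ie]]; rewrite /g; first by rewrite hYp_pos ?scaler0.
    by rewrite Hn ?(lin_zero (hYp_lin _ _)) ?scaler0 //; lia.
  by rewrite hK // (lin_zero (Hl _)) (lin_zero (hYp_lin _ _)) scaler0.
have inner k : isum (g^~ k) = k%:~R *: hYp r k (Z (e - k) x).
  rewrite /Z (lin_isum (hYp_lin r k) (finY (e - k) x)).
  rewrite (lin_isum (scale_lin _) (lin_finsum (hYp_lin r k) (finY (e - k) x))).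
  rewrite -[RHS](isum_shift (- k)); apply: eq_isum => i; rewrite /g.
  have -> : i + - k - (e - k) = i - e by lia.
  by [].
split; last first.
  exists M => k hk; rewrite -inner isum0 // => i; apply: g0.
  by have [ik|ik] := ltP i k; [right; left|have [kp|kp] := leP k 0; [left|right; right; rewrite /M in hk *; lia]].
transitivity (isum (fun i => isum (g i))).
  by apply: eq_isum => i; rewrite (fexp_recursion (hYp_lin r) (@hYp_pos r) (hYpC r)).
rewrite (@exchange_isum _ g M M) => [|i k hik|i k hik].
- exact: eq_isum.
- apply: g0; have [kp|kp] := leP k 0; first by left.
  by right; have [ik|ik] := ltP i k; [left|right; rewrite /M in hik; lia].
apply: g0; have [kp|kp] := leP k 0; first by left.
by right; have [ik|ik] := ltP i k; [left|right; rewrite /M in hik; lia].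
Qed.

Let der_annihilation e x : isum (fun i => (e - i)%:~R *: Hp i (Ga (i - e) x))
    = isum (fun k => k%:~R *: hYa r (- k) (Z (e - k) x))
  /\ finsum (fun k => k%:~R *: hYa r (- k) (Z (e - k) x)).
Proof.
have [K hK] := G_bound x; have [L hL] := hYa_bound x; pose M := (K + L + absz e).+2.
pose g i k : h := k%:~R *: hYa r (- k) (Hp i (Ga (i - e + k) x)).
have g0 i k : 0 <= k \/ L%:Z <= - k \/ i < 0 \/ K%:Z <= i - e + k -> g i k = 0.
  case=> [k0|[kL|[i0|ie]]]; rewrite /g; first by rewrite hYa_pos ?scaler0 //; lia.
  - by rewrite hYa_Hp hYa_Ga hL // (lin_zero (Gl _)) (lin_zero (Hl _)) scaler0.
  - by rewrite Hn // (lin_zero (hYa_lin _ _)) scaler0.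
  by rewrite hK // (lin_zero (Hl _)) (lin_zero (hYa_lin _ _)) scaler0.
have inner k : isum (g^~ k) = k%:~R *: hYa r (- k) (Z (e - k) x).
  rewrite /Z (lin_isum (hYa_lin r (- k)) (finY (e - k) x)).
  rewrite (lin_isum (scale_lin _) (lin_finsum (hYa_lin r (- k)) (finY (e - k) x))).
  apply: eq_isum => i; rewrite /g; have -> : i - (e - k) = i - e + k by lia.
  by [].
have g1 i k : (i < - M%:Z) || (M%:Z <= i) \/ (k < - M%:Z) || (M%:Z <= k) -> g i k = 0.
  move=> hik; apply: g0; have [k0|k0] := leP 0 k; first by left.
  right; have [kL|kL] := leP L%:Z (- k); first by left.
  right; have [i0|i0] := ltP i 0; first by left.
  by right; case: hik; rewrite /M; lia.
split; last by exists M => k hk; rewrite -inner isum0 // => i; apply: g1; right.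
transitivity (isum (fun i => isum (g i))).
  apply: eq_isum => i.
  have -> : (e - i)%:~R *: Hp i (Ga (i - e) x) = - Hp i ((i - e)%:~R *: Ga (i - e) x).
    by rewrite (lin_scale (Hl i)) -scaleNr -intrN opprB.
  rewrite (fexp_recursion (hYa_lin r) (@hYa_pos r) (hYaC r)).
  have fs := fexp_finsum (hYa_lin r) (@hYa_pos r) (i - e) x.
  rewrite (lin_isum (Hl i) fs) -(isum_refl 0 (g i)) -scaleN1r.
  rewrite (lin_isum (scale_lin _) (lin_finsum (Hl i) fs)); apply: eq_isum => k.
  rewrite /g (lin_scale (Hl i)) hYa_Hp scaleN1r sub0r opprK -scaleNr -intrN.
  by [].
rewrite (@exchange_isum _ g M M) => [|i k hik|i k hik].
- exact: eq_isum.
- by apply: g1; left.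
by apply: g1; right.
Qed.

(** The Euler operator multiplies each exponential by that of its exponent, and the
    two together make up the sum of the [r_p u^p(z)]. *)
Lemma hY_derivative e x : e%:~R *: hY r e x = isum (fun k => U k (hY r (e - k) x))
  /\ finsum (fun k => U k (hY r (e - k) x)).
Proof.
have [E1 f1] := der_creation e x; have [E2 f2] := der_annihilation e x.
have UY k : U k (hY r (e - k) x) = hq r (k%:~R *: hYp r k (Z (e - k) x)
    + k%:~R *: hYa r (- k) (Z (e - k) x)).
  rewrite -UE hYE -/(Z (e - k) x); move: (Z (e - k) x) => z.
  rewrite /U (lin_sum (hq_lin r)); apply: eq_bigr => p _.
  by rewrite huq (lin_scale (hq_lin r)).
have fU : finsum (fun k => U k (hY r (e - k) x)).
  have [K hK] := lin_finsum (hq_lin r) (finsumD f1 f2).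
  by exists K => k hk; rewrite UY hK.
split=> //; under eq_isum => k do rewrite UY.
rewrite -(lin_isum (hq_lin r) (finsumD f1 f2)) isumD // -E1 -E2 hYE -(lin_scale (hq_lin r)).
congr (hq r _); rewrite (lin_isum (scale_lin _) (finY e x)) -isumD.
- by apply: eq_isum => i; rewrite -scalerDl -intrD [i + (e - i)]addrC subrK.
- by have [K hK] := finY e x; exists K => i hi; rewrite hK ?scaler0.
by have [K hK] := finY e x; exists K => i hi; rewrite hK ?scaler0.
Qed.

End FixedCharge.
End VertexOperator.

Section HeisenbergFields.
Variables (F : numFieldType) (N : nat) (h : heisenberg_module F N).
Implicit Types (r : qexpo N) (p q : 'I_N).

Definition hU p : fseries h := of_modes (hu p).
Definition hV p : fseries h := of_modes (hv p).
Definition hOmega : fseries h := \sum_(p < N) nop (hU p) (hV p).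

Lemma hU_field p : is_field (hU p).
Proof.
split=> [e|x]; first exact: hu_lin.
by have [K hK] := h_smooth x; exists K.+1 => e he; apply: (hK _ _ p).1; lia.
Qed.

Lemma hV_field p : is_field (hV p).
Proof.
split=> [e|x]; first exact: hv_lin.
by have [K hK] := h_smooth x; exists K.+1 => e he; apply: (hK _ _ p).2; lia.
Qed.

Lemma hOmega_field : is_field hOmega.
Proof.
apply: is_field_sum => p; apply: is_field_nop; [exact: hU_field|exact: hV_field].
Qed.

Lemma hU_hY p r : fcomm (hU p) (hY r).
Proof. by move=> i j x; exact: hY_u. Qed.

(** This is what makes exact forms act by zero and lets the corrections in the
    adjoint of [d_0] cancel. *)
Lemma hY_translation r e x : (e + 1)%:~R *: hY r (e + 1) x
  = \sum_(p < N) (r p)%:~R *: fmul (hU p) (hY (h := h) r) e x.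
Proof.
have fp p : finsum (fun i => hU p i (hY r (e - i) x)).
  exact: (finsum_comm _ _ (hU_field p) (hY_field h r) (hU_hY p r)).
have [-> _] := hY_derivative r (e + 1) x; rewrite -(isum_shift 1).
transitivity (isum (fun i => \sum_(p < N) (r p)%:~R *: hU p i (hY r (e - i) x))).
  apply: eq_isum => i; apply: eq_bigr => p _.
  have -> : e + 1 - (i + 1) = e - i by lia.
  by rewrite /hU /of_modes opprD.
rewrite isum_split_sum => [|p]; last exact: (lin_finsum (scale_lin _) (fp p)).
by apply: eq_bigr => p _; rewrite fmulE (lin_isum (scale_lin _) (fp p)).
Qed.

Lemma hV_hY p r m j x : hV p m (hY r j x)
  = hY r j (hV p m x) + (r p)%:~R *: hY r (j + m + 1) x.
Proof.
by rewrite /hV /of_modes hY_v; congr (_ + _ *: hY r _ x); lia.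
Qed.

Lemma nop_hY p r k j x : nop (hU p) (hV p) k (hY r j x)
  = hY r j (nop (hU p) (hV p) k x)
    + (r p)%:~R *: fmul (hU p) (hY (h := h) r) (j + k + 1) x.
Proof.
have fU := hU_field p; have fV := hV_field p; have fY := hY_field h r.
have Yl := fY.1 j; have UY := hU_hY p r.
have sl := @scale_lin _ h (r p)%:~R.
have fc y : finsum (fun i => creation (hU p) i (hV p (k - i) y)).
  exact: finsum_creation.
have fa y : finsum (fun i => hV p i (annihilation (hU p) (k - i) y)).
  exact: finsum_annihilation.
have fc' : finsum (fun i => creation (hU p) i (hY r (j + k + 1 - i) x)).
  exact: finsum_creation.
have fa' : finsum (fun i => hY r i (annihilation (hU p) (j + k + 1 - i) x)).
  exact: finsum_annihilation.
have A1 : isum (fun i => creation (hU p) i (hV p (k - i) (hY r j x)))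
    = hY r j (isum (fun i => creation (hU p) i (hV p (k - i) x)))
      + (r p)%:~R *: isum (fun i => creation (hU p) i (hY r (j + k + 1 - i) x)).
  rewrite (lin_isum Yl (fc x)) (lin_isum sl fc') -isumD.
  - apply: eq_isum => i; rewrite !creationE; case: ifP => _; last first.
      by rewrite (lin_zero Yl) scaler0 addr0.
    rewrite hV_hY (lin_add (fU.1 i)) (lin_scale (fU.1 i)) UY.
    by have -> : j + (k - i) + 1 = j + k + 1 - i by lia.
  - exact: (lin_finsum Yl (fc x)).
  exact: (lin_finsum sl fc').
have A2 : isum (fun i => hV p i (annihilation (hU p) (k - i) (hY r j x)))
    = hY r j (isum (fun i => hV p i (annihilation (hU p) (k - i) x)))
      + (r p)%:~R *: isum (fun i => hY r i (annihilation (hU p) (j + k + 1 - i) x)).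
  have fs := finsum_shift (j + 1) (lin_finsum sl fa').
  rewrite (lin_isum Yl (fa x)) (lin_isum sl fa') -(isum_shift (j + 1) (fun i => _ *: _)).
  rewrite -isumD //; last exact: (lin_finsum Yl (fa x)).
  apply: eq_isum => i; have -> : j + k + 1 - (i + (j + 1)) = k - i by lia.
  have -> : i + (j + 1) = j + i + 1 by lia.
  rewrite !annihilationE; case: ifP => _; last first.
    by rewrite !(lin_zero (fV.1 i)) !(lin_zero ((hY_field h r).1 _)) scaler0 addr0.
  by rewrite UY hV_hY.
by rewrite (fmul_nop fU fY UY) !nopE A1 A2 (lin_add Yl) scalerDr addrACA.
Qed.

(** A vertex operator is a primary field of conformal weight 0. *)
Lemma hOmega_hY r k j x : hOmega k (hY r j x)
  = hY r j (hOmega k x) + (j + k + 2)%:~R *: hY r (j + k + 2) x.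
Proof.
have Yl := (hY_field h r).1 j.
rewrite /hOmega !fser_sum (lin_sum Yl).
have -> : j + k + 2 = j + k + 1 + 1 by lia.
by rewrite hY_translation -big_split /=; apply: eq_bigr => p _; exact: nop_hY.
Qed.

Section Form.
Variable B : h -> h -> F.
Hypothesis Bb : bilinear_pairing B.
Hypothesis Bq : forall r, adj B (hq r) (hq (- r)).
Hypothesis Bu : forall p i, adj B (hu p i) (hu p (- i)).
Hypothesis Bv : forall p i, adj B (hv p i) (hv p (- i)).

Lemma fadj_hU p : fadj B (- 2) (hU p) (hU p).
Proof.
move=> k x y; rewrite /hU /of_modes Bu; congr (B x (hu p _ y)); lia.
Qed.

Lemma fadj_hV p : fadj B (- 2) (hV p) (hV p).
Proof.
move=> k x y; rewrite /hV /of_modes Bv; congr (B x (hv p _ y)); lia.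
Qed.

(** The single correction vanishes because [u^p_(0)] does. *)
Lemma fadj_hOmega : fadj B (- 4) hOmega hOmega.
Proof.
apply: fadj_sum => // p e x y.
rewrite (fadj_nop Bb (m := 1) (t := - 2) (hU_field p) (hV_field p) (hU_field p) (hV_field p)
  (fadj_hU p) (fadj_hV p)) big_ord1.
rewrite -[nat_of_ord ord0]/0%N; have U0 z : hU p (- 1) z = 0 by exact: hu0.
by rewrite !U0 (lin_zero ((hV_field p).1 _)) subr0 addr0.
Qed.

Lemma adj_hYp r i : adj B (hYp (h := h) r i) (hYa (h := h) (- r) i).
Proof.
move=> x y; rewrite hYpE hYaE; case: ifP => _; last first.
  by rewrite (lin_zero (pair_linl Bb _)) (lin_zero (pair_linr Bb _)).
rewrite (lin_sum (pair_linl Bb _)) -sumrN (lin_sum (pair_linr Bb _)).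
apply: eq_bigr => p _; rewrite -scaleNr ffunE intrN mulNr opprK.
by rewrite (lin_scale (pair_linl Bb _)) (lin_scale (pair_linr Bb _)) Bu opprK.
Qed.

Lemma adj_hYa r i : adj B (hYa (h := h) r i) (hYp (h := h) (- r) i).
Proof.
move=> x y; rewrite hYpE hYaE; case: ifP => _; last first.
  by rewrite (lin_zero (pair_linl Bb _)) (lin_zero (pair_linr Bb _)).
rewrite -sumrN (lin_sum (pair_linl Bb _)) (lin_sum (pair_linr Bb _)).
apply: eq_bigr => p _; rewrite -scaleNr ffunE intrN mulNr.
by rewrite (lin_scale (pair_linl Bb _)) (lin_scale (pair_linr Bb _)) Bu.
Qed.

(** Taking adjoints exchanges the two exponentials and reverses their order. *)
Lemma fadj_hY r : fadj B 0 (hY (h := h) r) (hY (h := h) (- r)).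
Proof.
move=> e x y; rewrite sub0r [in RHS]hYE.
have EH i : adj B (fexp (hYp r) i) (fexp (hYa (h := h) (- r)) i).
  apply: fexp_adj => //; try exact: hYp_lin; try exact: hYa_lin; try exact: hYp_pos;
    try exact: hYa_pos; try exact: hYpC; try exact: hYaC.
  exact: adj_hYp.
have EG i : adj B (fexp (hYa (h := h) r) i) (fexp (hYp (- r)) i).
  apply: fexp_adj => //; try exact: hYp_lin; try exact: hYa_lin; try exact: hYp_pos;
    try exact: hYa_pos; try exact: hYpC; try exact: hYaC.
  exact: adj_hYa.
rewrite -Bq hYEr; set z := hq r x.
have f1 := hY_finsum r e z; have f2 := hY_finsum (- r) (- e) y.
rewrite (lin_isum (pair_linl Bb y) f1) (lin_isum (pair_linr Bb z) f2).
rewrite -[LHS](isum_shift e); apply: eq_isum => i.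
by rewrite EH EG addrK opprK.
Qed.

End Form.
End HeisenbergFields.

(** * Tensor products *)

Section TensorBasics.
Variables (F : fieldType) (V U : lmodType F).

Lemma tensor_ind (S : set (tensor V U)) : subspace S ->
  (forall v u, S (tens v u)) -> forall x, S x.
Proof.
move=> sS St x; rewrite -[x]lreprK; move: (lrepr x).
have pl := @lpi_is_linear F _ (tensor_rel (V := V) (U := U)).
apply: (malg_ind (S := [set y | S (lpi _ y)])) => [|[v u]]; last exact: St.
split=> [|c y z Sy Sz] /=; first by rewrite (lin_zero pl); exact: sS.1.
by rewrite pl; apply: sS.2.
Qed.

Lemma tensor_ext (W : lmodType F) (f g : tensor V U -> W) : linear f -> linear g ->
  (forall v u, f (tens v u) = g (tens v u)) -> forall x, f x = g x.
Proof.
move=> fl gl fg; apply: (tensor_ind (S := [set x | f x = g x])) => //.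
split=> [|c x y hx hy] /=; first by rewrite (lin_zero fl) (lin_zero gl).
by rewrite fl gl hx hy.
Qed.

Lemma tensor_sum (x : tensor V U) :
  exists s : seq (V * U), x = \sum_(vu <- s) tens vu.1 vu.2.
Proof.
move: x; apply: (tensor_ind (S := [set x | exists s : seq (V * U),
  x = \sum_(vu <- s) tens vu.1 vu.2])) => [|v u]; last first.
  by exists [:: (v, u)]; rewrite big_seq1.
split=> [|c _ _ [s ->] [t ->]]; first by exists [::]; rewrite big_nil.
exists ([seq (c *: vu.1, vu.2) | vu <- s] ++ t); rewrite big_cat big_map; congr (_ + _).
by rewrite scaler_sumr; apply: eq_bigr => vu _; rewrite (lin_scale (tens_linear_l _)).
Qed.

End TensorBasics.

Section TensorMaps.
Variables (F : fieldType) (V U V' U' : lmodType F) (f : V -> V') (g : U -> U').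
Hypotheses (fl : linear f) (gl : linear g).

Let bl u : linear ((fun v u => tens (f v) (g u))^~ u).
Proof. by move=> c x y; rewrite fl (tens_linear_l (g u)). Qed.

Let br v : linear (fun u => tens (f v) (g u)).
Proof. by move=> c x y; rewrite gl (tens_linear_r (f v)). Qed.

Lemma tmap_tens v u : tmap f g (tens v u) = tens (f v) (g u).
Proof. exact: (tlift_tens bl br). Qed.

Lemma tmap_lin : linear (tmap f g).
Proof. exact: (tlift_is_linear bl br). Qed.

End TensorMaps.

Definition onl (F : fieldType) (V U : lmodType F) (a : fseries V) : fseries (tensor V U) :=
  fun e => tmap (a e) id.
Definition onr (F : fieldType) (V U : lmodType F) (a : fseries U) : fseries (tensor V U) :=
  fun e => tmap id (a e).
Arguments onl {F V} U a _ _.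
Arguments onr {F} V {U} a _ _.

Section TensorFields.
Variables (F : fieldType) (V U : lmodType F).
Implicit Types (a b : fseries V) (c d : fseries U).

Lemma onlE a e v u : is_field a -> onl U a e (tens v u) = tens (a e v) u.
Proof. by move=> fa; rewrite /onl tmap_tens //; exact: fa.1. Qed.

Lemma onrE c e v u : is_field c -> onr V c e (tens v u) = tens v (c e u).
Proof. by move=> fc; rewrite /onr tmap_tens //; exact: fc.1. Qed.

Lemma lower_tensor (A : fseries (tensor V U)) : (forall e, linear (A e)) ->
  (forall v u, exists K : nat, forall e : int, e < - K%:Z -> A e (tens v u) = 0) -> lower A.
Proof.
move=> Al h; apply: (tensor_ind (S := [set x | exists K : nat, forall e : int,
  e < - K%:Z -> A e x = 0])) => //.
split=> [|c x y [K hK] [L hL]]; first by exists 0%N => e _; exact: lin_zero (Al e).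
by exists (maxn K L) => e he; rewrite Al hK ?hL ?scaler0 ?addr0 //; lia.
Qed.

Lemma onl_field a : is_field a -> is_field (onl U a).
Proof.
move=> fa; have Al e : linear (onl U a e) by apply: tmap_lin => //; exact: fa.1.
split=> //; apply: lower_tensor => // v u; have [K hK] := fa.2 v.
by exists K => e he; rewrite onlE // hK // (lin_zero (tens_linear_l u)).
Qed.

Lemma onr_field c : is_field c -> is_field (onr V c).
Proof.
move=> fc; have Al e : linear (onr V c e) by apply: tmap_lin => //; exact: fc.1.
split=> //; apply: lower_tensor => // v u; have [K hK] := fc.2 u.
by exists K => e he; rewrite onrE // hK // (lin_zero (tens_linear_r v)).
Qed.

Lemma onl_comm a b : is_field a -> is_field b -> fcomm a b -> fcomm (onl U a) (onl U b).
Proof.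
move=> fa fb ab i j; have [Fa Fb] := (onl_field fa, onl_field fb).
apply: (tensor_ext (f := onl U a i \o onl U b j) (g := onl U b j \o onl U a i)).
- exact: lin_comp (Fa.1 i) (Fb.1 j).
- exact: lin_comp (Fb.1 j) (Fa.1 i).
by move=> v u /=; rewrite !onlE // ab.
Qed.

Lemma onlr_comm a c : is_field a -> is_field c -> fcomm (onl U a) (onr V c).
Proof.
move=> fa fc i j; have [Fa Fc] := (onl_field fa, onr_field fc).
apply: (tensor_ext (f := onl U a i \o onr V c j) (g := onr V c j \o onl U a i)).
- exact: lin_comp (Fa.1 i) (Fc.1 j).
- exact: lin_comp (Fc.1 j) (Fa.1 i).
by move=> v u /=; rewrite (onrE j v u fc) (onlE i v u fa) (onlE i v _ fa) (onrE j _ u fc).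
Qed.

Lemma onl_fmul a b e x : is_field a -> is_field b -> fcomm a b ->
  fmul (onl U a) (onl U b) e x = onl U (fmul a b) e x.
Proof.
move=> fa fb ab; have [Fa Fb] := (onl_field fa, onl_field fb).
have fab := is_field_fmul fa fb ab; have FAB := onl_comm fa fb ab.
move: x; apply: tensor_ext => [||v u].
- exact: (is_field_fmul Fa Fb FAB).1.
- exact: (onl_field fab).1.
rewrite onlE // fmulE (lin_isum (tens_linear_l u) (finsum_comm e v fa fb ab)).
by apply: eq_isum => i; rewrite !onlE.
Qed.

End TensorFields.

Section TensorPairing.
Variables (F : fieldType) (V U V' U' : lmodType F).
Variables (B : V -> V' -> F) (C : U -> U' -> F).
Hypotheses (Bb : bilinear_pairing B) (Cb : bilinear_pairing C).

Let inner v u (y : tensor V' U') : F^o := tlift (fun v' u' => B v v' * C u u' : F^o) y.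

Definition tpair (x : tensor V U) (y : tensor V' U') : F :=
  tlift (fun v u => inner v u y) x.

Let il v u u' : linear ((fun v' u' => B v v' * C u u' : F^o)^~ u').
Proof. by move=> c x y; rewrite Bb.2 mulrDl -mulrA. Qed.

Let ir v u v' : linear (fun u' => B v v' * C u u' : F^o).
Proof. by move=> c x y; rewrite Cb.2 mulrDr mulrCA. Qed.

Let inner_tens v u v' u' : inner v u (tens v' u') = B v v' * C u u'.
Proof. exact: (tlift_tens (il v u) (ir v u)). Qed.

Let inner_lin v u : linear (inner v u).
Proof. exact: (tlift_is_linear (il v u) (ir v u)). Qed.

Let ol u y : linear ((fun v u => inner v u y)^~ u).
Proof.
move=> c v w; move: y.
apply: (tensor_ext (f := inner (c *: v + w) u)
  (g := fun y => c *: inner v u y + inner w u y)) => [||v' u'].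
- exact: inner_lin.
- move=> d x y; rewrite !inner_lin !scalerDr !scalerA [d * c]mulrC.
  by rewrite addrACA.
by rewrite !inner_tens Bb.1 mulrDl -mulrA.
Qed.

Let or v y : linear (fun u => inner v u y).
Proof.
move=> c u w; move: y.
apply: (tensor_ext (f := inner v (c *: u + w))
  (g := fun y => c *: inner v u y + inner v w y)) => [||v' u'].
- exact: inner_lin.
- move=> d x y; rewrite !inner_lin !scalerDr !scalerA [d * c]mulrC.
  by rewrite addrACA.
by rewrite !inner_tens Cb.1 mulrDr mulrCA.
Qed.

Lemma tpair_tens v u v' u' : tpair (tens v u) (tens v' u') = B v v' * C u u'.
Proof. by rewrite /tpair (tlift_tens (fun u => ol u _) (fun v => or v _)) inner_tens. Qed.

Let tpair_linl y : linear (tpair^~ y : _ -> F^o).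
Proof. exact: (tlift_is_linear (fun u => ol u y) (fun v => or v y)). Qed.

Let tpair_linr x : linear (tpair x : _ -> F^o).
Proof.
move=> c y z; rewrite -[RHS]/(c * tpair x y + tpair x z); move: x.
apply: (tensor_ind (S := [set x | tpair x (c *: y + z) = c * tpair x y + tpair x z])).
  split=> [|d x x' hx hx'] /=; first by rewrite !(lin_zero (tpair_linl _)) mulr0 addr0.
  by rewrite !tpair_linl hx hx' /GRing.scale /=; ring.
move=> v u /=; rewrite /tpair !(tlift_tens (fun u => ol u _) (fun v => or v _)).
exact: inner_lin.
Qed.

Lemma tpair_bilinear : bilinear_pairing tpair.
Proof. by split=> [y c u v|x c u v]; [rewrite tpair_linl|rewrite tpair_linr]. Qed.

Lemma tpair_adj (f : V -> V) (f' : V' -> V') (g : U -> U) (g' : U' -> U') :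
  linear f -> linear f' -> linear g -> linear g' ->
  adj B f f' -> adj C g g' -> adj tpair (tmap f g) (tmap f' g').
Proof.
move=> fl fl' gl gl' ff gg x y; move: x.
apply: (tensor_ind (S := [set x | tpair (tmap f g x) y = tpair x (tmap f' g' y)])) => [|v u /=].
  split=> [|c x x' hx hx'] /=.
    by rewrite (lin_zero (tmap_lin fl gl)) !(lin_zero (tpair_linl _)).
  by rewrite (tmap_lin fl gl) !tpair_linl hx hx'.
rewrite (tmap_tens fl gl); move: y.
apply: (tensor_ind (S := [set y | tpair (tens (f v) (g u)) y
  = tpair (tens v u) (tmap f' g' y)])) => [|v' u' /=].
  split=> [|c x x' hx hx'] /=.
    by rewrite (lin_zero (tmap_lin fl' gl')) !(lin_zero (tpair_linr _)).
  by rewrite (tmap_lin fl' gl') !tpair_linr hx hx'.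
by rewrite (tmap_tens fl' gl') !tpair_tens ff gg.
Qed.

(** By induction on the number of pure tensors: if [v] is not zero, pair with a [v']
    that detects it; as [C] is nondegenerate, this expresses [u] by the other right
    factors, and the first summand can be distributed over the others. *)
Lemma tpair_left : (forall v, (forall v', B v v' = 0) -> v = 0) ->
  (forall u, (forall u', C u u' = 0) -> u = 0) ->
  forall x, (forall y, tpair x y = 0) -> x = 0.
Proof.
move=> Bn Cn x; have [s ->] := tensor_sum x; have [n] := ubnP (size s).
elim: n s => // n IH [|[v u] s] sn h; first by rewrite big_nil.
have [v0|vn] := pselect (v = 0).
  move: h; rewrite big_cons /= v0 (lin_zero (tens_linear_l u)) add0r.
  by apply: IH.
have [v' vv'] : exists v', B v v' <> 0.
  by apply: contrapT => hv; apply: vn; apply: Bn => v'; apply: contrapT => vv'; apply: hv; exists v'.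
pose c (w : V) : F := - B w v' / B v v'.
have bn : B v v' != 0 by apply/eqP.
have uE : u = \sum_(wt <- s) c wt.1 *: wt.2.
  apply/eqP; rewrite -subr_eq0; apply/eqP/Cn => u'.
  have Cl := pair_linl Cb u'.
  rewrite (lin_sub Cl) (lin_sum Cl); apply: (mulfI bn); rewrite mulr0 mulrBr mulr_sumr.
  have := h (tens v' u'); rewrite big_cons (lin_add (tpair_linl _)) (lin_sum (tpair_linl _)).
  rewrite tpair_tens => hs; rewrite -[RHS]hs -sumrN; congr (_ + _); apply: eq_bigr => wt _.
  rewrite tpair_tens (lin_scale Cl) /GRing.scale /= /c mulrA mulrCA mulfV // mulr1.
  by rewrite mulNr opprK.
have E : \sum_(wt <- (v, u) :: s) tens wt.1 wt.2
    = \sum_(wt <- [seq (wt.1 + c wt.1 *: v, wt.2) | wt <- s]) tens wt.1 wt.2.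
  rewrite big_cons big_map /= {1}uE (lin_sum (tens_linear_r v)) -big_split /=.
  apply: eq_bigr => wt _; rewrite (lin_add (tens_linear_l _)) addrC; congr (_ + _).
  by rewrite (lin_scale (tens_linear_l _)) (lin_scale (tens_linear_r _)).
by rewrite E; apply: IH; [rewrite size_map|rewrite -E].
Qed.

End TensorPairing.

(** Reduces the right kernel of the pairing to the left one. *)
Lemma tpairC (F : fieldType) (V U V' U' : lmodType F) (B : V -> V' -> F) (C : U -> U' -> F)
  (Bb : bilinear_pairing B) (Cb : bilinear_pairing C) x y :
  tpair B C x y = tpair (fun v' v => B v v') (fun u' u => C u u') y x.
Proof.
have Bb' : bilinear_pairing (fun v' v => B v v') by split; [exact: Bb.2|exact: Bb.1].
have Cb' : bilinear_pairing (fun u' u => C u u') by split; [exact: Cb.2|exact: Cb.1].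
have [T T'] := (tpair_bilinear Bb Cb, tpair_bilinear Bb' Cb').
move: x; apply: (@tensor_ext _ _ _ F^o (tpair B C ^~ y) (tpair (fun v' v => B v v') (fun u' u => C u u') y)).
- exact: (pair_linl T).
- exact: (pair_linr T').
move=> v u; move: y; apply: (@tensor_ext _ _ _ F^o (tpair B C (tens v u))
  ((tpair (fun v' v => B v v') (fun u' u => C u u'))^~ (tens v u))).
- exact: (pair_linr T).
- exact: (pair_linl T').
by move=> v' u'; rewrite !tpair_tens.
Qed.

Lemma tpair_nondegenerate (F : fieldType) (V U V' U' : lmodType F)
    (B : V -> V' -> F) (C : U -> U' -> F) :
  bilinear_pairing B -> bilinear_pairing C ->
  nondegenerate_pairing B -> nondegenerate_pairing C ->
  nondegenerate_pairing (tpair B C).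
Proof.
move=> Bb Cb [Bl Br] [Cl Cr]; split; first exact: tpair_left.
move=> y h; apply: (@tpair_left F V' U' V U (fun v' v => B v v') (fun u' u => C u u')) => //.
- by split; [exact: Bb.2|exact: Bb.1].
- by split; [exact: Cb.2|exact: Cb.1].
by move=> x; rewrite -tpairC.
Qed.

(** * The fields on the triple tensor product *)

Lemma fmul_shiftr (F : fieldType) (V : lmodType F) (a b : fseries V) e x :
  fmul a (fshift b) e x = fmul a b (e + 1) x.
Proof. by rewrite !fmulE; apply: eq_isum => i; rewrite /fshift addrAC. Qed.

Section FockFields.
Variables (F : numFieldType) (N : nat) (gamma : 'I_N -> F).
Implicit Types (p q : 'I_N) (r : qexpo N).

Local Notation h := (fock_module gamma).
Local Notation u := (@u_field F N).
Local Notation v := (@v_field F N gamma).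
Local Notation Y := (@Y_field F N).
Local Notation w := (@omega_hyp F N gamma).

Lemma u_is_field p : is_field (u p). Proof. exact: (hU_field h p). Qed.
Lemma v_is_field p : is_field (v p). Proof. exact: (hV_field h p). Qed.
Lemma Y_is_field r : is_field (Y r). Proof. exact: (hY_field h r). Qed.
Lemma w_is_field : is_field w. Proof. exact: (hOmega_field h). Qed.
Lemma u_Y p r : fcomm (u p) (Y r). Proof. exact: (@hU_hY F N h p r). Qed.

Lemma Y_translation r e x : (e + 1)%:~R *: Y r (e + 1) x
  = \sum_(p < N) (r p)%:~R *: fmul (u p) (Y r) e x.
Proof. exact: (@hY_translation F N h r e x). Qed.

Lemma v_Y p r m j x : v p m (Y r j x) = Y r j (v p m x) + (r p)%:~R *: Y r (j + m + 1) x.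
Proof. exact: (@hV_hY F N h p r m j x). Qed.

Lemma w_Y r k j x : w k (Y r j x) = Y r j (w k x) + (j + k + 2)%:~R *: Y r (j + k + 2) x.
Proof. exact: (@hOmega_hY F N h r k j x). Qed.

Variable B : Fock F N -> Fock F N -> F.
Hypothesis Bb : bilinear_pairing B.
Hypothesis Bq : forall r, adj B (@q_mul F N r) (@q_mul F N (- r)).
Hypothesis Bu : forall p i, adj B (@u_mode F N p i) (@u_mode F N p (- i)).
Hypothesis Bv : forall p i, adj B (@v_mode F N gamma p i) (@v_mode F N gamma p (- i)).

Lemma u_adj p : fadj B (- 2) (u p) (u p).
Proof. exact: (@fadj_hU F N h B Bu p). Qed.
Lemma v_adj p : fadj B (- 2) (v p) (v p).
Proof. exact: (@fadj_hV F N h B Bv p). Qed.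
Lemma w_adj : fadj B (- 4) w w.
Proof. exact: (@fadj_hOmega F N h B Bb Bu Bv). Qed.
Lemma Y_adj r : fadj B 0 (Y r) (Y (- r)).
Proof. exact: (@fadj_hY F N h B Bb Bq Bu r). Qed.

End FockFields.

Section TensorVertexOperators.
Variables (F : numFieldType) (N : nat) (H : lmodType F).
Variables (u v : 'I_N -> fseries H) (Y : qexpo N -> fseries H) (w : fseries H).
Hypotheses (fu : forall p, is_field (u p)) (fv : forall p, is_field (v p)).
Hypotheses (fY : forall r, is_field (Y r)) (fw : is_field w).
Hypothesis uY : forall p r, fcomm (u p) (Y r).
Hypothesis Y_tr : forall r e x, (e + 1)%:~R *: Y r (e + 1) x
  = \sum_(p < N) (r p)%:~R *: fmul (u p) (Y r) e x.
Hypothesis vY : forall p r m j x,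
  v p m (Y r j x) = Y r j (v p m x) + (r p)%:~R *: Y r (j + m + 1) x.
Hypothesis wY : forall r k j x,
  w k (Y r j x) = Y r j (w k x) + (j + k + 2)%:~R *: Y r (j + k + 2) x.
Variable U : vir_module F.
Hypothesis fU : is_field (@omega_vir F U).

Section OneModule.
Variable W : ghat_module F N.
Hypothesis fW : forall X, is_field (mode_field W X).

Local Notation L := (tensor H (tensor W U)).
Definition Lu p : fseries L := onl (tensor W U) (u p).
Definition Lv p : fseries L := onl (tensor W U) (v p).
Definition LY r : fseries L := onl (tensor W U) (Y r).
Definition LE i j : fseries L := onr H (onl U (mode_field W (delta_mx i j))).
Definition Lw : fseries L := onl (tensor W U) w + onr H (onl U (@omega_gl F N W))
  + onr H (onr W (@omega_vir F U)).

Lemma Lu_field p : is_field (Lu p). Proof. exact: onl_field _ (fu p). Qed.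
Lemma Lv_field p : is_field (Lv p). Proof. exact: onl_field _ (fv p). Qed.
Lemma LY_field r : is_field (LY r). Proof. exact: onl_field _ (fY r). Qed.
Lemma LE_field i j : is_field (LE i j).
Proof. exact: (onr_field H (onl_field U (fW (delta_mx i j)))). Qed.
Let fg : is_field (onl U (@omega_gl F N W)).
Proof. exact: (onl_field U (is_field_omega_gl fW)). Qed.
Let fr : is_field (onr W (@omega_vir F U)).
Proof. exact: (onr_field W fU). Qed.
Lemma Lw_field : is_field Lw.
Proof.
exact: (is_fieldD (is_fieldD (onl_field _ fw) (onr_field H fg)) (onr_field H fr)).
Qed.

Lemma Lu_LY p r : fcomm (Lu p) (LY r). Proof. exact: (onl_comm (fu p) (fY r) (uY p r)). Qed.
Lemma Lu_LE p i j : fcomm (Lu p) (LE i j).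
Proof. exact: (onlr_comm (fu p) (onl_field U (fW (delta_mx i j)))). Qed.
Lemma LE_LY i j r : fcomm (LE i j) (LY r).
Proof. exact: (fcomm_sym (onlr_comm (fY r) (onl_field U (fW (delta_mx i j))))). Qed.

Lemma LvE p e a b : Lv p e (tens a b) = tens (v p e a) b.
Proof. exact: (onlE e a b (fv p)). Qed.
Lemma LYE r e a b : LY r e (tens a b) = tens (Y r e a) b.
Proof. exact: (onlE e a b (fY r)). Qed.

Let Lk_field p r : is_field (fmul (Lu p) (LY r)).
Proof. exact: is_field_fmul (Lu_field p) (LY_field r) (Lu_LY p r). Qed.

Lemma LY_translation r e x : (e + 1)%:~R *: LY r (e + 1) x
  = \sum_(p < N) (r p)%:~R *: fmul (Lu p) (LY r) e x.
Proof.
move: x; apply: tensor_ext => [c x y|c x y|a b].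
- by rewrite (LY_field r).1 scalerDr !scalerA mulrC.
- rewrite scaler_sumr -big_split /=; apply: eq_bigr => p _.
  by rewrite (Lk_field p r).1 scalerDr !scalerA mulrC.
rewrite LYE -(lin_scale (tens_linear_l b)) Y_tr (lin_sum (tens_linear_l b)).
apply: eq_bigr => p _; rewrite (lin_scale (tens_linear_l b)); congr (_ *: _).
apply/esym/(etrans (onl_fmul e (tens a b) (fu p) (fY r) (uY p r))).
exact: (onlE e a b (is_field_fmul (fu p) (fY r) (uY p r))).
Qed.

Lemma Lv_LY p r m j x : Lv p m (LY r j x)
  = LY r j (Lv p m x) + (r p)%:~R *: LY r (j + m + 1) x.
Proof.
have [Fv FY] := (Lv_field p, LY_field r).
move: x; apply: (tensor_ext (f := Lv p m \o LY r j)
  (g := fun x => LY r j (Lv p m x) + (r p)%:~R *: LY r (j + m + 1) x)) => [||a b].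
- exact: lin_comp (Fv.1 m) (FY.1 j).
- move=> c x y; rewrite Fv.1 !FY.1 !scalerDr !scalerA [_ * c]mulrC.
  by rewrite addrACA.
rewrite /= !(LYE, LvE) vY.
by rewrite (lin_add (tens_linear_l b)) (lin_scale (tens_linear_l b)).
Qed.

Lemma Lw_LY r k j x : Lw k (LY r j x)
  = LY r j (Lw k x) + (j + k + 2)%:~R *: LY r (j + k + 2) x.
Proof.
have FY := LY_field r; have Fw := onl_field (tensor W U) fw.
have c1 : onl (tensor W U) w k (LY r j x) = LY r j (onl (tensor W U) w k x)
    + (j + k + 2)%:~R *: LY r (j + k + 2) x.
  move: x; apply: (tensor_ext (f := onl (tensor W U) w k \o LY r j)
    (g := fun x => LY r j (onl (tensor W U) w k x)
                   + (j + k + 2)%:~R *: LY r (j + k + 2) x)) => [||a b].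
  - exact: lin_comp (Fw.1 k) (FY.1 j).
  - move=> c x y; rewrite Fw.1 !FY.1 !scalerDr !scalerA [_ * c]mulrC.
    by rewrite addrACA.
  rewrite /= !LYE (onlE k a b fw) (onlE k _ b fw) LYE wY.
  by rewrite (lin_add (tens_linear_l b)) (lin_scale (tens_linear_l b)).
have c2 : onr H (onl U (@omega_gl F N W)) k (LY r j x)
    = LY r j (onr H (onl U (@omega_gl F N W)) k x).
  exact: esym (onlr_comm (fY r) fg j k x).
have c3 : onr H (onr W (@omega_vir F U)) k (LY r j x)
    = LY r j (onr H (onr W (@omega_vir F U)) k x).
  exact: esym (onlr_comm (fY r) fr j k x).
have LwE z : Lw k z = onl (tensor W U) w k z + onr H (onl U (@omega_gl F N W)) k z
    + onr H (onr W (@omega_vir F U)) k z by [].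
have add4 (a b c t : L) : a + b + c + t = a + t + b + c by rewrite [LHS](ACl (1*4*2*3)).
apply: (etrans (etrans (LwE _) (congr2 +%R (congr2 +%R c1 c2) c3))).
apply/esym/(etrans (congr1 (fun z => z + _) (etrans (congr1 (LY r j) (LwE x))
  (etrans (lin_add (FY.1 j) _ _) (congr1 (fun z => z + _) (lin_add (FY.1 j) _ _)))))).
exact: add4.
Qed.

End OneModule.
End TensorVertexOperators.

(** * Adjoints of the generating fields *)

(** The generating fields of the elements [t_0^j t^r x] with [x] one of the [k_a], the
    [d_a] for [a > 0], and [d_0]. *)
Section GeneratingFields.
Variables (F : fieldType) (N : nat) (L : lmodType F).
Variables (u v : 'I_N -> fseries L) (E : 'I_N -> 'I_N -> fseries L) (w : fseries L).
Variable Y : qexpo N -> fseries L.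

Definition gen_k a r : fseries L := fmul (u a) (Y r).
Definition gen_d a r : fseries L :=
  nop (v a) (Y r) + \sum_(p < N) (r p)%:~R *: fmul (E p a) (Y r).
Definition gen_d0 r : fseries L :=
  - nop w (Y r)
  - \sum_(i < N) \sum_(j < N) (r i)%:~R *: fmul (u j) (fmul (E i j) (Y r))
  + \sum_(p < N) (r p)%:~R *: fmul (fder (u p)) (Y r).
End GeneratingFields.

Section GeneratingAdjoints.
Variables (F : numFieldType) (N : nat) (L L' : lmodType F) (B : L -> L' -> F).
Variables (u v : 'I_N -> fseries L) (E : 'I_N -> 'I_N -> fseries L) (w : fseries L).
Variable Y : qexpo N -> fseries L.
Variables (u' v' : 'I_N -> fseries L') (E' : 'I_N -> 'I_N -> fseries L') (w' : fseries L').
Variable Y' : qexpo N -> fseries L'.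
Hypothesis Bb : bilinear_pairing B.
Hypotheses (fu : forall p, is_field (u p)) (fv : forall p, is_field (v p)).
Hypotheses (fY : forall r, is_field (Y r)) (fw : is_field w).
Hypothesis fE : forall i j, is_field (E i j).
Hypotheses (fu' : forall p, is_field (u' p)) (fv' : forall p, is_field (v' p)).
Hypotheses (fY' : forall r, is_field (Y' r)) (fw' : is_field w').
Hypothesis fE' : forall i j, is_field (E' i j).
Hypotheses (uY : forall p r, fcomm (u p) (Y r)) (uE : forall p i j, fcomm (u p) (E i j)).
Hypothesis EY : forall i j r, fcomm (E i j) (Y r).
Hypotheses (uY' : forall p r, fcomm (u' p) (Y' r)) (uE' : forall p i j, fcomm (u' p) (E' i j)).
Hypothesis EY' : forall i j r, fcomm (E' i j) (Y' r).
Hypothesis Y_tr' : forall r e x, (e + 1)%:~R *: Y' r (e + 1) x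
  = \sum_(p < N) (r p)%:~R *: fmul (u' p) (Y' r) e x.
Hypothesis vY' : forall p r m j x,
  v' p m (Y' r j x) = Y' r j (v' p m x) + (r p)%:~R *: Y' r (j + m + 1) x.
Hypothesis wY' : forall r k j x,
  w' k (Y' r j x) = Y' r j (w' k x) + (j + k + 2)%:~R *: Y' r (j + k + 2) x.
Hypotheses (u_ad : forall p, fadj B (- 2) (u p) (u' p)).
Hypotheses (v_ad : forall p, fadj B (- 2) (v p) (v' p)).
Hypotheses (w_ad : fadj B (- 4) w w').
Hypotheses (Y_ad : forall r, fadj B 0 (Y r) (Y' (- r))).
Hypotheses (E_ad : forall i j, fadj B (- 2) (E i j) (pole (V := L') (i == j)%:R - E' i j)).

Local Notation Bl y := (pair_linl Bb y).
Local Notation Br x := (pair_linr Bb x).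

Lemma fadj_gen_k a r : fadj B (- 2) (gen_k u Y a r) (gen_k u' Y' a (- r)).
Proof. exact: (fadj_fmul Bb (fu a) (fY r) (uY a r) (fu' a) (fY' _) (uY' a _) (u_ad a) (Y_ad r)). Qed.

Let Ea i j : fseries L' := pole (V := L') (i == j)%:R - E' i j.

Let fEa i j : is_field (Ea i j).
Proof. by apply: is_fieldD; [exact: is_field_pole|exact: is_fieldN]. Qed.

Let EaY i j r : fcomm (Ea i j) (Y' r).
Proof.
by apply: fcommDl => //; [exact: fcomm_pole|exact: fcommNl].
Qed.

Let EaYE i j r e y : fmul (Ea i j) (Y' r) e y
  = (i == j)%:R *: Y' r (e + 1) y - fmul (E' i j) (Y' r) e y.
Proof.
have NE : fcomm (- E' i j) (Y' r) by exact: fcommNl.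
rewrite (fmulDl e y (is_field_pole _ _) (is_fieldN (fE' i j)) (fY' r) (fcomm_pole _ (fY' r)) NE).
rewrite fmul_pole -[- E' i j]scaleN1r (fmulZl _ e y (fE' i j) (fY' r) (EY' i j r)).
by rewrite scaleN1r.
Qed.

Let EY_ad i j r : fadj B (- 2) (fmul (E i j) (Y r)) (fmul (Ea i j) (Y' (- r))).
Proof.
exact: (fadj_fmul Bb (fE i j) (fY r) (EY i j r) (fEa i j) (fY' _) (EaY i j _) (E_ad i j) (Y_ad r)).
Qed.

(** The commutator left over by the normal ordering is [- r_a Y(q^(-r),z)/z], and the
    diagonal term of the adjoint of [E^(aa)] contributes the opposite. *)
Lemma fadj_gen_d a r : fadj B (- 2) (gen_d v E Y a r) (gen_d v' E' Y' a (- r)).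
Proof.
move=> e x y; rewrite /gen_d !fserD !fser_sum (lin_add (Bl y)) (lin_sum (Bl y)).
rewrite (fadj_nop Bb (m := 1) (fv a) (fY r) (fv' a) (fY' (- r)) (v_ad a) (Y_ad r)).
have -> : \sum_(p < N) B (((r p)%:~R *: fmul (E p a) (Y r)) e x) y
   = B x (\sum_(p < N) (r p)%:~R *: fmul (Ea p a) (Y' (- r)) (- 2 - e) y).
  rewrite (lin_sum (Br x)); apply: eq_bigr => p _.
  by rewrite fserZ (lin_scale (Bl y)) (lin_scale (Br x)) EY_ad.
rewrite -(lin_add (Br x)); congr (B x _).
set e' := - 2 - e.
rewrite big_ord1 -[nat_of_ord ord0]/0%N -[(0.+1)%N%:Z]/(1 : int) vY'.
have -> : e' + 1 + - 1 + 1 = e' + 1 by lia.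
rewrite [X in X - _]addrC addrK -addrA; congr (_ + _).
rewrite ffunE intrN (eq_bigr (fun p => (r p)%:~R *: ((p == a)%:R *: Y' (- r) (e' + 1) y)
   + ((- r) p)%:~R *: fmul (E' p a) (Y' (- r)) e' y)); last first.
  by move=> p _; rewrite EaYE ffunE intrN scalerBr scaleNr.
rewrite big_split /= addrA; rewrite [X in X + _](_ : _ = 0) ?add0r; last first.
  rewrite (bigD1 a) //= eqxx scale1r big1 ?addr0 => [|p /negPf ->].
    by rewrite scaleNr addNr.
  by rewrite scale0r scaler0.
by [].
Qed.

(** Inverting [z] turns a derivative into minus a derivative, and the factor [z^(-2)]
    in the adjoint of [u^p(z)] is differentiated as well. *)
Let fder_ad p : fadj B (- 4) (fder (u p)) (- fder (u' p) - 2 *: fshift (u' p)).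
Proof.
move=> k x y; rewrite fderE (lin_scale (Bl y)) u_ad -(lin_scale (Br x)); congr (B x _).
rewrite fserD !fserN fserZ fderE /fshift.
have -> : - 4 - k + 1 = - 2 - (k + 1) by lia.
rewrite -scaleNr -scalerBl; congr (_ *: _).
have -> : - 2 - (k + 1) = - (k + 1) - 2 by lia.
by rewrite intrB intrN; ring.
Qed.

Let uYtr (r : qexpo N) e y : \sum_(p < N) (r p)%:~R *: fmul (u' p) (Y' r) (e + 1) y
  = (e + 2)%:~R *: Y' r (e + 2) y.
Proof. by rewrite -Y_tr'; have -> : e + 1 + 1 = e + 2 by lia. Qed.

(** With [T] for the coefficient of [d/dz Y(q^(-r),z)] in question, the correction is
    [- 3 T] from [omega], [T] from the diagonal of [E], and [2 T] from the
    derivatives of the [u^p]. *)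
Lemma fadj_gen_d0 r : fadj B (- 4) (gen_d0 u E w Y r) (gen_d0 u' E' w' Y' (- r)).
Proof.
move=> e x y; set e' := - 4 - e; set s := - r.
pose T := (e' + 2)%:~R *: Y' s (e' + 2) y.
(* One [T] for each of the coefficients of [omega] at [z^(-1)], [z^(-2)], [z^(-3)]. *)
have A1 : B (nop w (Y r) e x) y = B x (nop w' (Y' s) e' y + 3%:R *: T).
  rewrite (fadj_nop Bb (m := 3) fw (fY r) fw' (fY' s) w_ad (Y_ad r)); congr (B x (_ + _)).
  rewrite (eq_bigr (fun=> T)) => [|i _]; first by rewrite sumr_const card_ord scaler_nat.
  transitivity (w' (- i.+1%:Z) (Y' s (e' + i.+1%:Z) y)
    - Y' s (e' + i.+1%:Z) (w' (- i.+1%:Z) y)); first by [].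
  rewrite wY' [X in X - _]addrC addrK /T.
  by have -> : e' + i.+1%:Z + - i.+1%:Z + 2 = e' + 2 by lia.
have A2 i j : B (fmul (u j) (fmul (E i j) (Y r)) e x) y
    = B x ((i == j)%:R *: fmul (u' j) (Y' s) (e' + 1) y
           - fmul (u' j) (fmul (E' i j) (Y' s)) e' y).
  have f1 := is_field_fmul (fE i j) (fY r) (EY i j r).
  have f2 := is_field_fmul (fEa i j) (fY' s) (EaY i j s).
  have f3 := is_field_fmul (fE' i j) (fY' s) (EY' i j s).
  have c1 := fcomm_fmul (fE i j) (fY r) (fu j) (EY i j r) (uE j i j) (uY j r).
  have c3 := fcomm_fmul (fE' i j) (fY' s) (fu' j) (EY' i j s) (uE' j i j) (uY' j s).
  have uEa : fcomm (u' j) (Ea i j).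
    apply: fcomm_sym; apply: fcommDl => //; first exact: fcomm_pole.
    by apply: fcommNl => //; apply: fcomm_sym.
  have c2 := fcomm_fmul (fEa i j) (fY' s) (fu' j) (EaY i j s) uEa (uY' j s).
  have := fadj_fmul Bb (fu j) f1 c1 (fu' j) f2 c2 (u_ad j) (EY_ad i j r).
  move=> -> ; congr (B x _).
  rewrite -[- 2 + - 2 - e]/e'.
  have fs := is_field_shift (fY' s).
  have fc := finsum_comm e' y (fu' j) f3 c3.
  have us : fcomm (u' j) (fshift (Y' s)) by move=> k l z; exact: uY'.
  have fd := finsum_comm e' y (fu' j) fs us.
  rewrite -fmul_shiftr !fmulE -scaleN1r addrC.
  rewrite (lin_isum (scale_lin _) fd); apply: isum_linear => //; last first.
    exact: (lin_finsum (scale_lin _) fd).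
  move=> k; rewrite EaYE (lin_sub ((fu' j).1 k)) (lin_scale ((fu' j).1 k)) scaleN1r addrC.
  by [].
have A3 p : B (fmul (fder (u p)) (Y r) e x) y
    = B x (- fmul (fder (u' p)) (Y' s) e' y - 2 *: fmul (u' p) (Y' s) (e' + 1) y).
  have fd := is_field_fder (fu p); have fd' := is_field_fder (fu' p).
  have fs := is_field_shift (fu' p).
  have fD : is_field (- fder (u' p) - 2 *: fshift (u' p)).
    by apply: is_fieldD; apply: is_fieldN => //; apply: is_fieldZ.
  have cd := fcomm_der (fY r) (uY p r); have cd' := fcomm_der (fY' s) (uY' p s).
  have cs : fcomm (fshift (u' p)) (Y' s) by move=> k l z; exact: uY'.
  have cN := fcommNl (fY' s) cd'.
  have cZ := fcommNl (fY' s) (fcommZl 2 (fY' s) cs).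
  have cD := fcommDl (fY' s) cN cZ.
  rewrite (fadj_fmul Bb fd (fY r) cd fD (fY' s) cD (fder_ad p) (Y_ad r)); congr (B x _).
  rewrite -[- 4 + 0 - e]/e'.
  rewrite (fmulDl e' y (is_fieldN fd') (is_fieldN (is_fieldZ 2 fs)) (fY' s) cN cZ).
  rewrite -[- fder _]scaleN1r (fmulZl _ e' y fd' (fY' s) cd') scaleN1r.
  have -> : - (2 *: fshift (u' p)) = (- 2) *: fshift (u' p) by rewrite scaleNr.
  by rewrite (fmulZl _ e' y fs (fY' s) cs) fmul_shift scaleNr.
pose S2 := \sum_(i < N) \sum_(j < N) (s i)%:~R *: fmul (u' j) (fmul (E' i j) (Y' s)) e' y.
pose S3 := \sum_(p < N) (s p)%:~R *: fmul (fder (u' p)) (Y' s) e' y.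
(* A sum weighted by [r] is minus a derivative of [Y(q^(-r),z)]. *)
have Tsum : \sum_(p < N) (r p)%:~R *: fmul (u' p) (Y' s) (e' + 1) y = - T.
  rewrite /T -uYtr -sumrN; apply: eq_bigr => p _.
  by rewrite -scaleNr /s ffunE intrN opprK.
have RHSE : gen_d0 u' E' w' Y' s e' y = - nop w' (Y' s) e' y - S2 + S3.
  rewrite /gen_d0 !fserD !fserN !fser_sum; congr (_ - _ + _).
  by apply: eq_bigr => i _; rewrite fser_sum.
have LHSE : gen_d0 u E w Y r e x = - nop w (Y r) e x
    - \sum_(i < N) \sum_(j < N) (r i)%:~R *: fmul (u j) (fmul (E i j) (Y r)) e x
    + \sum_(p < N) (r p)%:~R *: fmul (fder (u p)) (Y r) e x.
  rewrite /gen_d0 !fserD !fserN !fser_sum; congr (_ - _ + _).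
  by apply: eq_bigr => i _; rewrite fser_sum.
have B2 : B (\sum_(i < N) \sum_(j < N) (r i)%:~R *: fmul (u j) (fmul (E i j) (Y r)) e x) y
    = B x (- T + S2).
  rewrite (lin_sum (Bl y)) -Tsum /S2 -big_split (lin_sum (Br x)); apply: eq_bigr => i _.
  rewrite (lin_sum (Bl y)).
  have -> : (r i)%:~R *: fmul (u' i) (Y' s) (e' + 1) y
      = \sum_(j < N) (r i)%:~R *: ((i == j)%:R *: fmul (u' j) (Y' s) (e' + 1) y).
    rewrite (bigD1 i) //= eqxx scale1r big1 ?addr0 // => j.
    by rewrite eq_sym => /negPf ->; rewrite scale0r scaler0.
  rewrite -big_split (lin_sum (Br x)); apply: eq_bigr => j _ /=.
  rewrite (lin_scale (Bl y)) A2 -(lin_scale (Br x)) scalerBr /s ffunE intrN scaleNr.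
  by [].
have B3 : B (\sum_(p < N) (r p)%:~R *: fmul (fder (u p)) (Y r) e x) y = B x (S3 + 2 *: T).
  have -> : 2 *: T = \sum_(p < N) - ((r p)%:~R *: (2 *: fmul (u' p) (Y' s) (e' + 1) y)).
    rewrite sumrN -[2 *: T]opprK -scalerN -Tsum scaler_sumr; congr (- _).
    by apply: eq_bigr => p _; rewrite !scalerA mulrC.
  rewrite (lin_sum (Bl y)) /S3 -big_split (lin_sum (Br x)); apply: eq_bigr => p _ /=.
  rewrite (lin_scale (Bl y)) A3 -(lin_scale (Br x)) scalerBr scalerN /s ffunE intrN scaleNr.
  by [].
rewrite LHSE RHSE !(lin_add (Bl y)) !(lin_opp (Bl y)) A1 B2 B3.
rewrite -!(lin_opp (Br x)) -!(lin_add (Br x)); congr (B x _).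
clear; move: (nop w' (Y' s) e' y) S2 S3 T => n a b t.
rewrite !opprD opprK [LHS](AC (2*2*2) (1*4*5*(2*3*6))) /=.
rewrite [X in _ + X](_ : _ = 0) ?addr0 //.
rewrite -scaleNr -[X in _ + X + _]scale1r -!scalerDl (_ : _ + _ = 0) ?scale0r //.
by ring.
Qed.

End GeneratingAdjoints.

(** * From the generating fields to the toroidal algebra *)

Section ToroidalAction.
Variables (F : fieldType) (N : nat) (L L' : lmodType F) (B : L -> L' -> F).
Hypothesis Bb : bilinear_pairing B.

Lemma mlin_adj (op : expo N -> L -> L) (op' : expo N -> L' -> L') f x y :
  (forall m, adj B (op m) (op' (- m))) ->
  B (mlin (fun m => op m x) f) y = B x (mlin (fun m => op' m y) (laurent_inv f)).
Proof.
move=> oo; move: f; apply: (@mlin_ext F _ F^o (fun f => B (mlin (fun m => op m x) f) y)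
  (fun f => B x (mlin (fun m => op' m y) (laurent_inv f)))) => [c f g|c f g|m].
- by rewrite mlin_is_linear (pair_linl Bb).
- by rewrite /laurent_inv !mlin_is_linear (pair_linr Bb).
by rewrite /laurent_inv !mlinU oo.
Qed.

Section ClassOfForm.
Variable kop : 'I_N.+1 -> expo N -> L' -> L'.
Hypothesis kop_exact : forall (m : expo N) y, \sum_a (m a)%:~R *: kop a m y = 0.

(** Exact forms act by zero, so a form acts through its class. *)
Lemma kop_class (w w' : oneform F N) y : w - w' \in lspan (@exact_forms F N) ->
  \sum_a mlin (fun m => kop a m y) (w a) = \sum_a mlin (fun m => kop a m y) (w' a).
Proof.
move=> /lspan_exact_formsP [f wf].
have ex : \sum_a mlin (fun m => kop a m y) (laurent_der a f) = 0.
  move: f {wf}; apply: (@mlin_ext F _ L'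
    (fun f => \sum_a mlin (fun m => kop a m y) (laurent_der a f)) (fun=> 0)) => [c f g|c f g|m].
  - rewrite scaler_sumr -big_split; apply: eq_bigr => a _.
    by rewrite /laurent_der !mlin_is_linear.
  - by rewrite scaler0 addr0.
  rewrite -[RHS](kop_exact m y); apply: eq_bigr => a _.
  by rewrite /laurent_der mlinU (lin_scale (mlin_is_linear _)) mlinU.
rewrite -[RHS]addr0 -[X in _ = _ + X]ex -big_split; apply: eq_bigr => a _ /=.
rewrite -(lin_add (mlin_is_linear _)); congr (mlin _ _).
by have /ffunP/(_ a) := wf; rewrite !ffunE => <-; rewrite addrC subrK.
Qed.

End ClassOfForm.

Lemma toroidal_adj (dop kop : 'I_N.+1 -> expo N -> L -> L)
  (dop' kop' : 'I_N.+1 -> expo N -> L' -> L') :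
  (forall (m : expo N) y, \sum_a (m a)%:~R *: kop' a m y = 0) ->
  (forall a m, adj B (dop a m) (dop' a (- m))) ->
  (forall a m, adj B (kop a m) (kop' a (- m))) ->
  forall (z : DK F N) x y,
  B (\sum_a mlin (fun m => dop a m x) (z.1 a)
     + \sum_a mlin (fun m => kop a m x) (lrepr z.2 a)) y
  = B x (\sum_a mlin (fun m => dop' a m y) ((sigma z).1 a)
     + \sum_a mlin (fun m => kop' a m y) (lrepr (sigma z).2 a)).
Proof.
move=> ex dd kk [f k] x y; have [Bl Br] := (pair_linl Bb y, pair_linr Bb x).
have cl := kop_class ex y (w := lrepr (sigma (f, k)).2) (w' := sigma_form (lrepr k)).
rewrite cl; last by rewrite -opprB rpredN; exact: lpi_repr.
rewrite (lin_add Bl) (lin_add Br) !(lin_sum Bl) !(lin_sum Br).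
congr (_ + _); apply: eq_bigr => a _; rewrite /= ffunE; exact: mlin_adj.
Qed.

End ToroidalAction.

(** * The contragredient pairing *)

Section PoleFields.
Variables (F : fieldType) (V U : lmodType F).

Lemma onl_poleB c (a : fseries V) : is_field a ->
  onl U (pole c - a) = pole c - onl U a.
Proof.
move=> fa; apply/funext => e; apply/funext.
have fp : is_field (pole c - a) by apply: is_fieldD; [exact: is_field_pole|exact: is_fieldN].
have fP : is_field (pole c - onl U a).
  by apply: is_fieldD; [exact: is_field_pole|exact: is_fieldN (onl_field U fa)].
apply: tensor_ext (tmap_lin (fp.1 e) (@lin_id _ _)) (fP.1 e) _ => v u.
apply: (etrans (onlE e v u fp)).
rewrite !fserD !fserN (onlE e v u fa) !poleE.
rewrite (lin_sub (tens_linear_l u)); congr (_ - _).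
by case: ifP => _; [exact: (lin_scale (tens_linear_l u))|exact: (lin_zero (tens_linear_l u))].
Qed.

Lemma onr_poleB c (a : fseries U) : is_field a ->
  onr V (pole c - a) = pole c - onr V a.
Proof.
move=> fa; apply/funext => e; apply/funext.
have fp : is_field (pole c - a) by apply: is_fieldD; [exact: is_field_pole|exact: is_fieldN].
have fP : is_field (pole c - onr V a).
  by apply: is_fieldD; [exact: is_field_pole|exact: is_fieldN (onr_field V fa)].
apply: tensor_ext (tmap_lin (@lin_id _ _) (fp.1 e)) (fP.1 e) _ => v u.
apply: (etrans (onrE e v u fp)).
rewrite !fserD !fserN (onrE e v u fa) !poleE.
rewrite (lin_sub (tens_linear_r v)); congr (_ - _).
by case: ifP => _; [exact: (lin_scale (tens_linear_r v))|exact: (lin_zero (tens_linear_r v))].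
Qed.

End PoleFields.

Section Assembly.
Variables (F : numFieldType) (N : nat) (gamma : 'I_N -> F).
Variables (V V' : ghat_module F N) (U : vir_module F).
Hypotheses (fV : forall X, is_field (mode_field V X)) (fV' : forall X, is_field (mode_field V' X)).
Hypothesis V'1 : forall v : V', ghat_center v = v.
Hypothesis fU : is_field (@omega_vir F U).
Variables (BH : Fock F N -> Fock F N -> F) (BV : V -> V' -> F) (BU : U -> U -> F).
Hypotheses (BHb : bilinear_pairing BH) (BVb : bilinear_pairing BV) (BUb : bilinear_pairing BU).
Hypothesis Bq : forall r, adj BH (@q_mul F N r) (@q_mul F N (- r)).
Hypothesis Bu : forall p i, adj BH (@u_mode F N p i) (@u_mode F N p (- i)).
Hypothesis Bv : forall p i, adj BH (@v_mode F N gamma p i) (@v_mode F N gamma p (- i)).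
Hypothesis BX : forall n X v v', BV (ghat_mode n X v) v'
  = BV v ((if n == 0 then \tr X else 0) *: v' - ghat_mode (- n) X v').
Hypothesis BL : forall n x y, BU (vir_mode n x) y = BU x (vir_mode (- n) y).

Let B := tpair BH (tpair BV BU).
Let BVU : bilinear_pairing (tpair BV BU) := tpair_bilinear BVb BUb.

Lemma B_bilinear : bilinear_pairing B.
Proof. exact: tpair_bilinear BHb BVU. Qed.

Let fu p := u_is_field gamma p.
Let fv p := v_is_field gamma p.
Let fY r := Y_is_field gamma r.
Let fw := w_is_field gamma.

Let onl_adj s (a a' : fseries (Fock F N)) : is_field a -> is_field a' -> fadj BH s a a' ->
  fadj B s (onl (tensor V U) a) (onl (tensor V' U) a').
Proof.
move=> fa fa' aa k; apply: (tpair_adj BHb BVU (fa.1 k) (fa'.1 (s - k)) (@lin_id _ _) (@lin_id _ _)).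
  exact: aa.
by [].
Qed.

Let gl_adj s (a : fseries V) (a' : fseries V') : is_field a -> is_field a' ->
  fadj BV s a a' -> fadj B s (onr (Fock F N) (onl U a)) (onr (Fock F N) (onl U a')).
Proof.
move=> fa fa' aa k; apply: (tpair_adj BHb BVU (@lin_id _ _) (@lin_id _ _)
  (tmap_lin (fa.1 k) (@lin_id _ _)) (tmap_lin (fa'.1 (s - k)) (@lin_id _ _))) => //.
exact: (tpair_adj BVb BUb (fa.1 k) (fa'.1 (s - k)) (@lin_id _ _) (@lin_id _ _) (aa k)).
Qed.

Let vir_adj s (a a' : fseries U) : is_field a -> is_field a' ->
  fadj BU s a a' -> fadj B s (onr (Fock F N) (onr V a)) (onr (Fock F N) (onr V' a')).
Proof.
move=> fa fa' aa k; apply: (tpair_adj BHb BVU (@lin_id _ _) (@lin_id _ _)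
  (tmap_lin (@lin_id _ _) (fa.1 k)) (tmap_lin (@lin_id _ _) (fa'.1 (s - k)))) => //.
exact: (tpair_adj BVb BUb (@lin_id _ _) (@lin_id _ _) (fa.1 k) (fa'.1 (s - k)) _ (aa k)).
Qed.

Local Notation u := (@u_field F N).
Local Notation v := (@v_field F N gamma).
Local Notation Y := (@Y_field F N).
Local Notation w := (@omega_hyp F N gamma).

Local Notation Lu_ W := (@Lu F N (Fock F N) u U W).
Local Notation Lv_ W := (@Lv F N (Fock F N) v U W).
Local Notation LY_ W := (@LY F N (Fock F N) Y U W).
Local Notation LE_ W := (@LE F N (Fock F N) U W).
Local Notation Lw_ W := (@Lw F N (Fock F N) w U W).

Let Lu_ad p : fadj B (- 2) (Lu_ V p) (Lu_ V' p).
Proof. exact: (onl_adj (fu p) (fu p) (u_adj gamma Bu p)). Qed.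
Let Lv_ad p : fadj B (- 2) (Lv_ V p) (Lv_ V' p).
Proof. exact: (onl_adj (fv p) (fv p) (v_adj Bv p)). Qed.
Let LY_ad r : fadj B 0 (LY_ V r) (LY_ V' (- r)).
Proof. exact: (onl_adj (fY r) (fY (- r)) (Y_adj gamma BHb Bq Bu r)). Qed.

Let LE_ad i j : fadj B (- 2) (LE_ V i j) (pole (i == j)%:R - LE_ V' i j).
Proof.
have fE := fV (delta_mx i j); have fE' := fV' (delta_mx i j).
have fp : is_field (pole (\tr (delta_mx i j)) - mode_field V' (delta_mx i j)).
  by apply: is_fieldD; [exact: is_field_pole|exact: is_fieldN].
have := gl_adj fE fp (fadj_mode BX (delta_mx i j)).
by rewrite (onl_poleB U _ fE') (onr_poleB _ _ (onl_field U fE')) trace_delta.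
Qed.

Let vir_ad : fadj BU (- 4) (@omega_vir F U) (@omega_vir F U).
Proof.
move=> k x y; rewrite /omega_vir BL; congr (BU x (vir_mode _ y)); lia.
Qed.

Let Lw_ad : fadj B (- 4) (Lw_ V) (Lw_ V').
Proof.
have a1 := onl_adj fw fw (w_adj BHb Bu Bv).
have a2 := gl_adj (is_field_omega_gl fV) (is_field_omega_gl fV') (fadj_omega_gl fV fV' V'1 BVb BX).
have a3 := vir_adj fU fU vir_ad.
exact: (fadjD B_bilinear (fadjD B_bilinear a1 a2) a3).
Qed.

Let uY W p r : fcomm (Lu_ W p) (LY_ W r).
Proof. exact: (Lu_LY fu fY (u_Y gamma)). Qed.
Let uE W (fW : forall X, is_field (mode_field W X)) p i j : fcomm (Lu_ W p) (LE_ W i j).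
Proof. exact: (Lu_LE fu fW). Qed.
Let EY W (fW : forall X, is_field (mode_field W X)) i j r : fcomm (LE_ W i j) (LY_ W r).
Proof. exact: (LE_LY fY fW). Qed.
Let Ytr W r e x : (e + 1)%:~R *: LY_ W r (e + 1) x
  = \sum_(p < N) (r p)%:~R *: fmul (Lu_ W p) (LY_ W r) e x.
Proof. exact: (LY_translation fu fY (u_Y gamma) (Y_translation gamma)). Qed.

Let k_ad a r : fadj B (- 2) (gen_k (Lu_ V) (LY_ V) a r) (gen_k (Lu_ V') (LY_ V') a (- r)).
Proof.
exact: (fadj_gen_k B_bilinear (Lu_field fu U V) (LY_field fY U V) (Lu_field fu U V')
  (LY_field fY U V') (@uY V) (@uY V') Lu_ad LY_ad a r).
Qed.

Let d_ad a r : fadj B (- 2) (gen_d (Lv_ V) (LE_ V) (LY_ V) a r)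
  (gen_d (Lv_ V') (LE_ V') (LY_ V') a (- r)).
Proof.
exact: (fadj_gen_d B_bilinear (Lv_field fv U V) (LY_field fY U V) (LE_field (Fock F N) U fV)
  (Lv_field fv U V') (LY_field fY U V') (LE_field (Fock F N) U fV') (EY fV) (EY fV')
  (fun p r m j x => Lv_LY fv fY (@v_Y F N gamma) p r m j x) Lv_ad LY_ad LE_ad a r).
Qed.

Let d0_ad r : fadj B (- 4) (gen_d0 (Lu_ V) (LE_ V) (Lw_ V) (LY_ V) r)
  (gen_d0 (Lu_ V') (LE_ V') (Lw_ V') (LY_ V') (- r)).
Proof.
exact: (fadj_gen_d0 B_bilinear (Lu_field fu U V) (LY_field fY U V) (Lw_field fw fU fV)
  (LE_field (Fock F N) U fV) (Lu_field fu U V') (LY_field fY U V') (Lw_field fw fU fV')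
  (LE_field (Fock F N) U fV') (@uY V) (uE fV) (EY fV) (@uY V') (uE fV') (EY fV') (@Ytr V')
  (fun r k j x => Lw_LY fY fw (@w_Y F N gamma) fU fV' r k j x) Lu_ad Lw_ad LY_ad LE_ad r).
Qed.

Lemma tail_expoN (m : expo N) : tail_expo (- m) = - tail_expo m.
Proof. by apply/ffunP => p; rewrite !ffunE. Qed.

Lemma k_op_adj a m : adj B (@k_op F N V U a m) (@k_op F N V' U a (- m)).
Proof.
rewrite /k_op tail_expoN ffunE; case: (unlift ord0 a) => [p|] x y.
  rewrite (k_ad p (tail_expo m) (- m ord0 - 1) x y).
  by have -> : - 2 - (- m ord0 - 1) = - (- m ord0) - 1 by lia.
rewrite (LY_ad (tail_expo m) (- m ord0) x y).
by have -> : 0 - - m ord0 = - (- m ord0) by lia.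
Qed.

Lemma d_op_adj a m : adj B (@d_op F N gamma V U a m) (@d_op F N gamma V' U a (- m)).
Proof.
rewrite /d_op tail_expoN ffunE; case: (unlift ord0 a) => [p|] x y.
  rewrite (d_ad p (tail_expo m) (- m ord0 - 1) x y).
  by have -> : - 2 - (- m ord0 - 1) = - (- m ord0) - 1 by lia.
rewrite (d0_ad (tail_expo m) (- m ord0 - 2) x y).
by have -> : - 4 - (- m ord0 - 2) = - (- m ord0) - 2 by lia.
Qed.

Lemma k_op_exact (m : expo N) x : \sum_a (m a)%:~R *: @k_op F N V' U a m x = 0.
Proof.
rewrite big_ord_recl {1}/k_op unlift_none.
rewrite (eq_bigr (fun p => (tail_expo m p)%:~R
    *: fmul (Lu_ V' p) (LY_ V' (tail_expo m)) (- m ord0 - 1) x)); last first.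
  by move=> p _; rewrite /k_op liftK ffunE.
rewrite -(@Ytr V' (tail_expo m) (- m ord0 - 1) x) subrK.
by rewrite -[k0_field _ _ x]/(LY_ V' (tail_expo m) (- m ord0) x) -scalerDl -intrD addrN scale0r.
Qed.

Lemma B_contragredient : contragredient_pairing gamma B.
Proof.
move=> z x y; exact: (toroidal_adj B_bilinear k_op_exact d_op_adj k_op_adj z x y).
Qed.

End Assembly.

Theorem theorem8p2 (R : realType) (N : nat) (hN : (1 <= N)%N)
    (W : gl_module R[i] N) (hW : gl_simple W)
    (gamma : 'I_N -> R[i]) (h : R[i])
    (V V' : ghat_module R[i] N) (U : vir_module R[i])
    (hV : is_Lgl W V) (hV' : is_Lgl (gl_dual W) V') (hU : is_LVir h U) :
  exists B : Lmod V U -> Lmod V' U -> R[i],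
    [/\ bilinear_pairing B,
        nondegenerate_pairing B
      & contragredient_pairing gamma B].
Proof.
have hW' := gl_dual_simple hW.
have [BH [BHb BHn Bq Bu Bv]] := fock_contragredient gamma.
have [BV [BVb BVn BX]] := gl_contragredient hW hV hV'.
have [BU [BUb BUn BL]] := vir_contragredient hU.
exists (tpair BH (tpair BV BU)); split.
- exact: tpair_bilinear BHb (tpair_bilinear BVb BUb).
- exact: tpair_nondegenerate BHb (tpair_bilinear BVb BUb) BHn
    (tpair_nondegenerate BVb BUb BVn BUn).
exact: (B_contragredient (is_field_mode hW hV) (is_field_mode hW' hV') (center1 hW' hV')
  (vir_smooth hU) BHb BVb BUb Bq Bu Bv BX BL).
Qed.
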